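(* Let $n\ge1$, let $m>0$ be real, let $\gamma>0$ if $n\ge2m$ and $\gamma\ge1-\frac{n}{2m}$ if $n<2m$, and suppose $q\in L_{\gamma+n/(2m)}(\mathbb{R}^n)$. Let $H_{m,q}$ be the operator in $L_2(\mathbb{R}^n)$ associated with $(-\Delta)^m+q$. Then every eigenvalue $\lambda\in\mathbb{C}\setminus[0,\infty)$ of $H_{m,q}$ satisfies $$|\lambda|^{\gamma}\le C(n,m,\alpha,\theta)\int_{\mathbb{R}^n}|q(x)|^{\gamma+\frac{n}{2m}}\,dx,$$ where $\alpha=\gamma+\frac{n}{2m}$, $\theta=\arg\lambda\in(0,2\pi)$, $$C(n,m,\alpha,\theta)=(4\pi)^{-n/2}\,\bigl(m\,\Gamma(n/2)\bigr)^{-1}I_m(n,\alpha,\theta),\qquad I_m(n,\alpha,\theta)=\int_0^\infty\frac{t^{\frac{n}{2m}-1}}{(t^2-2t\cos\theta+1)^{\alpha/2}}\,dt.$$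
   Context: $\Gamma$ is the gamma function. The complex-valued measurable potential $q$ is factorized as $q=ab$ with $a=|q|^{1/2}$, $b=(\operatorname{sgn}q)|q|^{1/2}$, where $\operatorname{sgn}q(x)=q(x)/|q(x)|$ if $q(x)\ne0$ and $\operatorname{sgn}q(x)=0$ otherwise. $H_0=(-\Delta)^m$ is the operator in $L_2(\mathbb{R}^n)$ with domain the Sobolev space $W_2^{2m}(\mathbb{R}^n)$ acting, on the Fourier side, as multiplication by $|\xi|^{2m}$; $A,B$ are the operators of multiplication by $a,b$ in $L_2(\mathbb{R}^n)$ with maximal domains. For $u\in L_{2,\mathrm{loc}}(\mathbb{R}^n)$ put $M_{\nu,2}(u)=\sup_{x}\int_{|x-y|<1}|u(y)|^2|x-y|^{\nu-n}\,dy$. Standing assumptions: for some $0<\kappa<m$ one has $M_{\nu,2}(a)<\infty$ for some $0<\nu<2\kappa$ and $M_{\mu,2}(b)<\infty$ for some $0<\mu<2(m-\kappa)$; and $\int_{|x-y|<1}|q(y)|\,dy\to0$ as $|x|\to\infty$. Under these assumptions, for $z\in\mathbb{C}\setminus[0,\infty)$ the operator $B(H_0-z)^{-1}A$ is densely defined and has a unique bounded extension $Q(z)$ to $L_2(\mathbb{R}^n)$, which is compact, and $H_0+AB$ admits a closed extension $H_{m,q}$ with $\sigma_{ess}(H_{m,q})=\sigma_{ess}(H_0)=[0,\infty)$ such that $\lambda\in\mathbb{C}\setminus[0,\infty)$ is an eigenvalue of $H_{m,q}$ if and only if $-1$ is an eigenvalue of $Q(\lambda)$. This $H_{m,q}$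 is the operator associated with $(-\Delta)^m+q$. *)

(* Defs.v *)
From HB Require Import structures.
From mathcomp Require Import all_boot all_order all_algebra.
From mathcomp Require Import all_classical all_reals all_analysis.
From mathcomp Require Export complex.

Set Implicit Arguments.
Unset Strict Implicit.
Unset Printing Implicit Defensive.
Import Order.TTheory GRing.Theory Num.Theory numFieldNormedType.Exports.
Local Open Scope classical_set_scope.
Local Open Scope ring_scope.
Local Open Scope complex_scope.

(* The modulus of a complex number, with values in R (the norm `|z| of R[i]
   takes values in R[i]). *)
Notation cabs := (@ComplexField.Normc.normc _).

Section lebesgue_tuple.
Context {R : realType}.

Definition cons_pair n (p : n.-tuple R * measurableTypeR R) : n.+1.-tuple R :=
  [tuple of p.2 :: p.1].

Lemma measurable_cons_pair n :
  measurable_fun [set: n.-tuple R * measurableTypeR R] (@cons_pair n).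
Proof. by apply: measurable_cons; [exact: measurable_snd|exact: measurable_fst]. Qed.

Definition lebesgue_cons n (mu : {measure set (n.-tuple R) -> \bar R}) :
    {measure set (n.+1.-tuple R) -> \bar R} :=
  measure_function_pushforward__canonical__measure_function_Measure
    (product_measure1 mu (@lebesgue_measure R)) (@measurable_cons_pair n).

Fixpoint lebesgue_tuple n : {measure set (n.-tuple R) -> \bar R} :=
  if n is n'.+1 then lebesgue_cons (lebesgue_tuple n') else dirac [tuple].

End lebesgue_tuple.
Arguments lebesgue_tuple R n : clear implicits.

Section euclidean.
Context {R : realType} {n : nat}.
Implicit Types x y : n.-tuple R.

Definition dotp x y : R := \sum_(i < n) tnth x i * tnth y i.
Definition enorm x : R := Num.sqrt (\sum_(i < n) tnth x i ^+ 2).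
Definition edist x y : R := Num.sqrt (\sum_(i < n) (tnth x i - tnth y i) ^+ 2).

End euclidean.

Section L2.
Context {R : realType} {n : nat}.
Local Notation mu := (lebesgue_tuple R n).
Implicit Types f g u v : n.-tuple R -> R[i].

Definition cmeasurable f :=
  measurable_fun setT (fun x => complex.Re (f x)) /\
  measurable_fun setT (fun x => complex.Im (f x)).

Definition Lp_norm (p : R) f : \bar R := 'N[mu]_p%:E[EFin \o (cabs \o f)]%E.

Definition in_Lp (p : R) f := cmeasurable f /\ (Lp_norm p f < +oo)%E.

Definition L2 : set (n.-tuple R -> R[i]) := in_Lp 2.

Definition cvgL2 (f_ : nat -> n.-tuple R -> R[i]) f :=
  Lp_norm 2 (fun x => f_ k x - f x) @[k --> \oo] --> 0%E.

Definition cintegral (D : set (n.-tuple R)) f : R[i] :=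
  (\int[mu]_(x in D) complex.Re (f x)) +i* (\int[mu]_(x in D) complex.Im (f x)).

Definition expi (t : R) : R[i] := cos t +i* sin t.

(* The integral defining the Fourier transform, truncated to the ball of
   radius k; this makes sense for every f in L2. *)
Definition fourier_trunc f (k : nat) (xi : n.-tuple R) : R[i] :=
  ((2 * pi) `^ (- (n%:R / 2)))%:C *
  cintegral [set x | enorm x <= k%:R] (fun x => f x * expi (- dotp x xi)).

(* g is the (Plancherel) Fourier transform of f. *)
Definition is_fourier f g := [/\ L2 f, L2 g & cvgL2 (fourier_trunc f) g].

(* W_2^s, for real s. *)
Definition sobolev (s : R) : set (n.-tuple R -> R[i]) :=
  [set u | exists uh, is_fourier u uh /\
     L2 (fun xi => ((1 + enorm xi ^+ 2) `^ (s / 2))%:C * uh xi)].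

End L2.

(* Unbounded operators in L2 are given by their graphs: T u v means that u is
   in the domain of T and T u = v.  Elements of L2 are represented by functions,
   so that graphs have to be stable under a.e. equality. *)
Definition operator (R : realType) (n : nat) :=
  (n.-tuple R -> R[i]) -> (n.-tuple R -> R[i]) -> Prop.

Section operators.
Context {R : realType} {n : nat}.
Local Notation mu := (lebesgue_tuple R n).
Local Notation fct := (n.-tuple R -> R[i]).
Implicit Types (S T : operator R n) (u v w : fct) (z : R[i]).

Record linear_operator T : Prop := LinearOperator {
  op_L2 : forall u v, T u v -> L2 u /\ L2 v ;
  op_ae : forall u v u' v', T u v -> L2 u' -> L2 v' ->
    u = u' %[ae mu] -> v = v' %[ae mu] -> T u' v' ;
  op_fun : forall u v v', T u v -> T u v' -> v = v' %[ae mu] ;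
  op0 : T (fun=> 0) (fun=> 0) ;
  op_lin : forall z u v u' v', T u v -> T u' v' ->
    T (fun x => z * u x + u' x) (fun x => z * v x + v' x)
}.

Definition op_inv S : operator R n := fun u v => S v u.

Definition op_comp S T : operator R n :=
  fun u w => exists v, T u v /\ S v w.

Definition op_add S T : operator R n :=
  fun u w => exists v v', [/\ S u v, T u v' & w = (fun x => v x + v' x)].

Definition op_shift T z : operator R n :=
  fun u w => exists v, T u v /\ w = (fun x => v x - z * u x).

Definition op_mul (g : fct) : operator R n :=
  fun u v => [/\ L2 u, L2 v & v = (fun x => g x * u x) %[ae mu]].

Definition extends S T := forall u v, T u v -> S u v.

Definition closed_operator T := linear_operator T /\
  forall (u_ v_ : nat -> fct) u v, (forall k, T (u_ k) (v_ k)) ->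
    L2 u -> L2 v -> cvgL2 u_ u -> cvgL2 v_ v -> T u v.

Definition bounded_operator T := [/\ linear_operator T,
  (forall u, L2 u -> exists v, T u v) &
  exists M : R, forall u v, T u v -> (Lp_norm 2 v <= M%:E * Lp_norm 2 u)%E].

Definition bounded_extension T S := bounded_operator S /\ extends S T.

Definition eigenvalue_of T z :=
  exists u, [/\ L2 u, ~ (u = (fun=> 0) %[ae mu]) & T u (fun x => z * u x)].

(* Finite-dimensional kernel, closed range, range of finite codimension; meant
   for closed T. *)
Definition fredholm T := [/\
  (exists N (e : 'I_N -> fct), forall u, T u (fun=> 0) ->
     exists c : 'I_N -> R[i],
       u = (fun x => \sum_(i < N) c i * e i x) %[ae mu]),
  (forall (u_ v_ : nat -> fct) v, (forall k, T (u_ k) (v_ k)) ->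
     L2 v -> cvgL2 v_ v -> exists u, T u v) &
  (exists N (e : 'I_N -> fct), (forall i, L2 (e i)) /\
     forall v, L2 v -> exists u w (c : 'I_N -> R[i]), T u w /\
       v = (fun x => w x + \sum_(i < N) c i * e i x) %[ae mu])].

(* Several definitions of the essential spectrum are in use for closed
   operators (semi-Fredholm, Fredholm, Fredholm of index 0, complement of the
   discrete spectrum); they agree for the operators considered below. *)
Definition ess_spectrum T : set R[i] := [set z | ~ fredholm (op_shift T z)].

End operators.

Section schroedinger.
Context {R : realType} {n : nat}.
Local Notation mu := (lebesgue_tuple R n).
Variables (m : R) (q : n.-tuple R -> R[i]).

(* The half-line [0, +oo[ in the complex plane: in R[i], 0 <= z means that z is
   real and nonnegative. *)
Definition halfline : set R[i] := [set z | 0 <= z].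

Definition H0 : operator R n := fun u v => sobolev (2 * m) u /\
  exists2 uh, is_fourier u uh &
    is_fourier v (fun xi => (enorm xi `^ (2 * m))%:C * uh xi).

Definition sgnq x : R[i] := if q x == 0 then 0 else q x / (cabs (q x))%:C.
Definition a_of x : R[i] := (Num.sqrt (cabs (q x)))%:C.
Definition b_of x : R[i] := sgnq x * (Num.sqrt (cabs (q x)))%:C.

Definition Aop : operator R n := op_mul a_of.
Definition Bop : operator R n := op_mul b_of.

Definition M2 (nu : R) (u : n.-tuple R -> R[i]) : \bar R :=
  ereal_sup (range (fun x =>
    (\int[mu]_(y in [set y | (edist x y < 1)%R])
       (cabs (u y) ^+ 2 * edist x y `^ (nu - n%:R))%:E)%E)).

Definition standing_assumptions :=
  (exists kappa : R, [/\ 0 < kappa, kappa < m,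
     (exists nu : R, [/\ 0 < nu, nu < 2 * kappa & (M2 nu a_of < +oo)%E]) &
     (exists nu : R, [/\ 0 < nu, nu < 2 * (m - kappa) & (M2 nu b_of < +oo)%E])])
  /\
  (forall eps : R, 0 < eps -> exists r : R, forall x, r < enorm x ->
     (\int[mu]_(y in [set y | (edist x y < 1)%R]) (cabs (q y))%:E < eps%:E)%E).

Definition BRA (z : R[i]) : operator R n :=
  op_comp Bop (op_comp (op_inv (op_shift H0 z)) Aop).

(* BRA z is densely defined, so these conditions determine Q z. *)
Definition is_Q (Q : R[i] -> operator R n) :=
  forall z, ~ halfline z -> bounded_extension (BRA z) (Q z).

(* The closed extensions of H0 + AB that are associated with (-Delta)^m + q:
   they have the essential spectrum of H0, and their eigenvalues off the
   half-line are given by the Birman-Schwinger principle. *)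
Record is_Hmq (Q : R[i] -> operator R n) (H : operator R n) : Prop := IsHmq {
  Hmq_closed : closed_operator H ;
  Hmq_extends : extends H (op_add H0 (op_comp Aop Bop)) ;
  Hmq_ess : ess_spectrum H = ess_spectrum H0 /\ ess_spectrum H0 = halfline ;
  Hmq_eigen : forall z, ~ halfline z ->
    (eigenvalue_of H z <-> eigenvalue_of (Q z) (- 1))
}.

End schroedinger.
Arguments H0 {R n}.

Section constants.
Context {R : realType}.

(* theta = arg z, normalised to ]0, 2 pi[. *)
Definition is_arg (z : R[i]) (theta : R) :=
  [/\ 0 < theta, theta < 2 * pi & z = (cabs z)%:C * expi theta].

Definition Gamma_fun (s : R) : R :=
  \int[lebesgue_measure]_(t in `]0, +oo[) (t `^ (s - 1) * expR (- t)).

Definition I_m (m : R) (n : nat) (alpha theta : R) : \bar R :=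
  (\int[lebesgue_measure]_(t in `]0%R, +oo[)
     (t `^ (n%:R / (2 * m) - 1) /
      (t ^+ 2 - 2 * t * cos theta + 1) `^ (alpha / 2))%:E)%E.

Definition C_const (n : nat) (m alpha theta : R) : \bar R :=
  (((4 * pi) `^ (- (n%:R / 2)) * (m * Gamma_fun (n%:R / 2))^-1)%:E *
   I_m m n alpha theta)%E.

End constants.

(* Main.v *)
From HB Require Import structures.
Require Import Defs.
From mathcomp Require Import all_boot all_order all_algebra.
From mathcomp Require Import all_classical all_reals all_analysis.
From mathcomp Require Import ring lra measurable_realfun.

(* With g(xi) = 1 / (|xi|^(2m) - lambda), the Birman-Schwinger operator Q(lambda)
   is, up to a unimodular factor, |q|^(1/2) F^-1 g F |q|^(1/2), F being the Fourier
   transform. Splitting g symmetrically, its norm is at most the squared norm of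
   |g|^(1/2) F |q|^(1/2). The norm of T_s = |g|^(alpha s/2) F |q|^(alpha s/2) is
   at most 1 at s = 0 (Plancherel), and its square is at most the Hilbert-Schmidt
   bound (2 pi)^-n |g|_alpha^alpha |q|_alpha^alpha at s = 1; moreover
   N(s) = |T_s| satisfies N((s+t)/2)^2 <= N(s) N(t), because T*T for the midpoint
   has the same spectral radius as T_s* T_t. Hence at s = 1/alpha,
     |Q(lambda)|^alpha <= (2 pi)^-n |g|_alpha^alpha |q|_alpha^alpha,
   a Kato-Seiler-Simon inequality. If -1 is an
   eigenvalue of Q(lambda), the right-hand side is at least 1, and scaling by
   |lambda| gives |g|_alpha^alpha = (2 pi)^n |lambda|^(-gamma) C(n, m, alpha, theta). *)

Set Implicit Arguments.
Unset Strict Implicit.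
Unset Printing Implicit Defensive.
Import Order.TTheory GRing.Theory Num.Theory numFieldNormedType.Exports.
Local Open Scope classical_set_scope.
Local Open Scope ring_scope.
Local Open Scope complex_scope.

(** * Complex-valued integrals *)

(** Multiplication by |q|^(1/2) is unbounded as soon as [q] is, and the Fourier transform of an L2
    function is only a limit. So every estimate is proved for bounded functions whose support has
    finite measure, where all integrals converge absolutely and Fubini applies, with constants free
    of the truncation; monotone convergence removes the truncation at the end. The midpoint
    inequality stands in for complex interpolation: it uses only Cauchy-Schwarz and the growth rate
    of powers, so the crude Hilbert-Schmidt bounds that start it may depend on the truncation, since
    they enter only as constants that disappear as powers grow or square roots are iterated. The
    resolvent of [H0] is not built on all of L2: the hypothesis on the essential spectrum makes
    [H0 - lambda] Fredholm, hence of closed range, and solutions are identified almost everywhere on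
    the Fourier side. Strictness matters at the end: the norm of [Q lambda] must be below 1 to
    exclude the eigenvalue -1, so the bound is proved by contradiction. *)

Section complex_modulus.
Variable R : realType.
Implicit Types z w : R[i].

Lemma cabs_sqr z : cabs z ^+ 2 = complex.Re z ^+ 2 + complex.Im z ^+ 2.
Proof. by case: z => a b /=; rewrite sqr_sqrtr// addr_ge0// sqr_ge0. Qed.

Lemma cabs_ge0 z : 0 <= cabs z.
Proof. by case: z => a b /=; exact: sqrtr_ge0. Qed.

Lemma cabsM z w : cabs (z * w) = cabs z * cabs w.
Proof. exact: ComplexField.Normc.normcM. Qed.

Lemma cabsD z w : cabs (z + w) <= cabs z + cabs w.
Proof. exact: le_normcD. Qed.

Lemma cabsN z : cabs (- z) = cabs z.
Proof. exact: normcN. Qed.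

Lemma cabs0 : cabs (0 : R[i]) = 0.
Proof. exact: ComplexField.Normc.normc0. Qed.

Lemma cabs_eq0 z : cabs z = 0 -> z = 0.
Proof. exact: ComplexField.Normc.eq0_normc. Qed.

Lemma cabs_gt0 z : z != 0 -> 0 < cabs z.
Proof.
by move=> z0; rewrite lt0r cabs_ge0 andbT; apply: contra z0 => /eqP/cabs_eq0->.
Qed.

Lemma cabs_real (x : R) : cabs x%:C = `|x|.
Proof. by rewrite /= expr0n/= addr0 sqrtr_sqr. Qed.

Lemma cabs_conj z : cabs (conjc z) = cabs z.
Proof. by case: z => a b /=; rewrite sqrrN. Qed.

Lemma Re_le_cabs z : `|complex.Re z| <= cabs z.
Proof.
by rewrite -(@ler_pXn2r _ 2)// ?nnegrE ?cabs_ge0//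
  cabs_sqr real_normK ?num_real// lerDl sqr_ge0.
Qed.

Lemma Im_le_cabs z : `|complex.Im z| <= cabs z.
Proof.
by rewrite -(@ler_pXn2r _ 2)// ?nnegrE ?cabs_ge0//
  cabs_sqr real_normK ?num_real// lerDr sqr_ge0.
Qed.

Lemma cabs_le_ReIm z : cabs z <= `|complex.Re z| + `|complex.Im z|.
Proof.
rewrite -(@ler_pXn2r _ 2)// ?nnegrE ?cabs_ge0// ?addr_ge0//.
rewrite cabs_sqr sqrrD !real_normK ?num_real//.
by rewrite addrAC lerDl mulrn_wge0// mulr_ge0.
Qed.

Lemma ReD z w : complex.Re (z + w) = complex.Re z + complex.Re w.
Proof. by case: z w => ? ? []. Qed.

Lemma ImD z w : complex.Im (z + w) = complex.Im z + complex.Im w.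
Proof. by case: z w => ? ? []. Qed.

Lemma RecM z w : complex.Re (z * w) =
  complex.Re z * complex.Re w - complex.Im z * complex.Im w.
Proof. by case: z w => ? ? []. Qed.

Lemma ImcM z w : complex.Im (z * w) =
  complex.Re z * complex.Im w + complex.Im z * complex.Re w.
Proof. by case: z w => ? ? [] ? ? /=; rewrite addrC. Qed.

Lemma ReN z : complex.Re (- z) = - complex.Re z. Proof. by case: z. Qed.

Lemma ImN z : complex.Im (- z) = - complex.Im z. Proof. by case: z. Qed.

Lemma Re_conjc z : complex.Re (conjc z) = complex.Re z. Proof. by case: z. Qed.

Lemma Im_conjc z : complex.Im (conjc z) = - complex.Im z. Proof. by case: z. Qed.

Lemma mulc_conj z : z * (conjc z) = (cabs z ^+ 2)%:C.
Proof.
rewrite cabs_sqr; case: z => a b /=; apply/eqP; rewrite eq_complex /=.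
by apply/andP; split; apply/eqP; ring.
Qed.

Lemma eqcP z w : complex.Re z = complex.Re w -> complex.Im z = complex.Im w ->
  z = w.
Proof. by case: z w => ? ? [? ?]/= -> ->. Qed.

Lemma conjcM z w : (conjc (z * w)) = conjc z * (conjc w).
Proof. exact: rmorphM. Qed.

Lemma complex_realM (x y : R) : (x * y)%:C = x%:C * y%:C.
Proof. exact: rmorphM. Qed.

End complex_modulus.

Lemma measurable_sqrt (R : realType) : measurable_fun setT (@Num.sqrt R).
Proof. by apply: continuous_measurable_fun; exact: sqrt_continuous. Qed.

Section cmeas.
Context d (T : measurableType d) (R : realType).
Implicit Types (f g : T -> R[i]).

(** For tuples this is convertible to [cmeasurable]; the general form also serves products, sections
    and the line. *)
Definition cmeas f := measurable_fun setT (@complex.Re R \o f) /\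
  measurable_fun setT (@complex.Im R \o f).

Lemma cmeasD f g : cmeas f -> cmeas g -> cmeas (fun x => f x + g x).
Proof.
move=> [f1 f2] [g1 g2]; split.
  rewrite (_ : _ \o _ = (@complex.Re R \o f) \+ (@complex.Re R \o g)).
    exact: measurable_funD.
  by apply/funext => x /=; rewrite ReD.
rewrite (_ : _ \o _ = (@complex.Im R \o f) \+ (@complex.Im R \o g)).
  exact: measurable_funD.
by apply/funext => x /=; rewrite ImD.
Qed.

Lemma cmeasM f g : cmeas f -> cmeas g -> cmeas (fun x => f x * g x).
Proof.
move=> [f1 f2] [g1 g2]; split.
  rewrite (_ : _ \o _ = ((@complex.Re R \o f) \* (@complex.Re R \o g)) \-
      ((@complex.Im R \o f) \* (@complex.Im R \o g))).
    by apply: measurable_funB; exact: measurable_funM.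
  by apply/funext => x /=; rewrite RecM.
rewrite (_ : _ \o _ = ((@complex.Re R \o f) \* (@complex.Im R \o g)) \+
    ((@complex.Im R \o f) \* (@complex.Re R \o g))).
  by apply: measurable_funD; exact: measurable_funM.
by apply/funext => x /=; rewrite ImcM.
Qed.

Lemma cmeas_cst z : cmeas (fun=> z).
Proof. by split; exact: measurable_cst. Qed.

Lemma cmeasN f : cmeas f -> cmeas (fun x => - f x).
Proof.
move=> mf; rewrite (_ : (fun _ => _) = (fun x => (-1) * f x)).
  exact: cmeasM (cmeas_cst _) _.
by apply/funext => x; rewrite mulN1r.
Qed.

Lemma cmeasB f g : cmeas f -> cmeas g -> cmeas (fun x => f x - g x).
Proof. by move=> mf mg; apply: cmeasD => //; exact: cmeasN. Qed.

Lemma cmeas_real (h : T -> R) : measurable_fun setT h -> cmeas (fun x => (h x)%:C).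
Proof. by move=> mh; split => //; exact: measurable_cst. Qed.

Lemma cmeas_conj f : cmeas f -> cmeas (fun x => (conjc (f x))).
Proof.
move=> [f1 f2]; split.
  rewrite (_ : _ \o _ = @complex.Re R \o f)//.
  by apply/funext => x /=; rewrite Re_conjc.
rewrite (_ : _ \o _ = -%R \o (@complex.Im R \o f)).
  exact: measurableT_comp.
by apply/funext => x /=; rewrite Im_conjc.
Qed.

Lemma measurable_cabs f : cmeas f -> measurable_fun setT (cabs \o f).
Proof.
move=> [f1 f2].
rewrite (_ : _ \o _ =
  Num.sqrt \o (fun x => (complex.Re (f x)) ^+ 2 + (complex.Im (f x)) ^+ 2)).
  apply: measurableT_comp => //; first exact: measurable_sqrt.
  by apply: measurable_funD; exact: measurable_funX.
by apply/funext => x /=; case: (f x).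
Qed.

Lemma cmeas_if (D : set T) f : measurable D -> cmeas f ->
  cmeas (fun x => (\1_D x)%:C * f x).
Proof.
by move=> mD mf; apply: cmeasM => //; apply: cmeas_real; exact: measurable_indic.
Qed.

End cmeas.

Section cmeas_comp.
Context d d' (T : measurableType d) (T' : measurableType d') (R : realType).

Lemma cmeas_comp (f : T -> R[i]) (h : T' -> T) : cmeas f ->
  measurable_fun setT h -> cmeas (f \o h).
Proof. by move=> [f1 f2] mh; split; rewrite compA; exact: measurableT_comp. Qed.

End cmeas_comp.

Section cint.
Context d (T : measurableType d) (R : realType).
Variable mu : {measure set T -> \bar R}.
Implicit Types (f g : T -> R[i]).

Definition csummable f :=
  mu.-integrable setT (EFin \o (@complex.Re R \o f)) /\
  mu.-integrable setT (EFin \o (@complex.Im R \o f)).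

(** A component whose integral is infinite counts as 0, so the algebraic rules below assume
    [csummable]. *)
Definition cint f : R[i] :=
  (\int[mu]_x complex.Re (f x)) +i* (\int[mu]_x complex.Im (f x)).

Lemma eq_cint f g : f =1 g -> cint f = cint g.
Proof. by move=> fg; congr cint; apply/funext. Qed.

Lemma csummable_meas f : csummable f -> cmeas f.
Proof. by move=> [/measurable_int/measurable_EFinP ? /measurable_int/measurable_EFinP ?]. Qed.

Lemma csummableP f : csummable f <->
  cmeas f /\ mu.-integrable setT (EFin \o (cabs \o f)).
Proof.
split=> [cf|[mf intf]].
  split; first exact: csummable_meas.
  case: cf (csummable_meas cf) => f1 f2 mf.
  apply: (@le_integrable _ _ _ mu setT _ _ (EFin \o (fun x => `|complex.Re (f x)| + `|complex.Im (f x)|))) => //.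
  - by apply/measurable_EFinP; exact: measurable_cabs.
  - move=> x _ /=; rewrite lee_fin ger0_norm ?cabs_ge0//.
    by rewrite ger0_norm ?addr_ge0// cabs_le_ReIm.
  - rewrite (_ : _ \o _ = (EFin \o (@Num.norm R R \o (@complex.Re R \o f))) \+ (EFin \o (@Num.norm R R \o (@complex.Im R \o f))))%E//.
    apply: integrableD => //; exact: integrable_norm.
by split; apply: le_integrable intf => //; [
    by apply/measurable_EFinP; case: mf |
    move=> x _ /=; rewrite lee_fin (ger0_norm (cabs_ge0 _)) Re_le_cabs|
    by apply/measurable_EFinP; case: mf |
    move=> x _ /=; rewrite lee_fin (ger0_norm (cabs_ge0 _)) Im_le_cabs].
Qed.

Lemma le_csummable f (h : T -> R) : cmeas f ->
  mu.-integrable setT (EFin \o h) -> (forall x, cabs (f x) <= h x) ->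
  csummable f.
Proof.
move=> mf ih fh; apply/csummableP; split => //.
apply: le_integrable ih => //; first by apply/measurable_EFinP; exact: measurable_cabs.
move=> x _ /=; rewrite lee_fin (ger0_norm (cabs_ge0 _)).
by apply: (le_trans (fh x)); exact: ler_norm.
Qed.

Lemma csummableD f g : csummable f -> csummable g ->
  csummable (fun x => f x + g x).
Proof.
move=> /csummableP[mf f1] /csummableP[mg g1].
apply: (@le_csummable _ (fun x => cabs (f x) + cabs (g x))) => //.
- exact: cmeasD.
- rewrite (_ : _ \o _ = (EFin \o (cabs \o f)) \+ (EFin \o (cabs \o g)))%E//.
  exact: integrableD.
- by move=> x; exact: cabsD.
Qed.

Lemma csummableMb f g c : csummable f -> cmeas g -> (forall x, cabs (g x) <= c) ->
  csummable (fun x => g x * f x).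
Proof.
move=> /csummableP[mf f1] mg gc.
apply: (@le_csummable _ (fun x => c * cabs (f x))) => //.
- exact: cmeasM.
- rewrite (_ : _ \o _ = (fun x => c%:E * (EFin \o (cabs \o f)) x))%E//.
  exact: integrableZl.
- by move=> x; rewrite cabsM ler_wpM2r// cabs_ge0.
Qed.

Lemma csummableZ f z : csummable f -> csummable (fun x => z * f x).
Proof. by move=> sf; apply: (@csummableMb f _ (cabs z)) => //; exact: cmeas_cst. Qed.

Lemma csummable_conj f : csummable f -> csummable (fun x => (conjc (f x))).
Proof.
move=> /csummableP[mf f1]; apply: (@le_csummable _ (cabs \o f)) => //.
  exact: cmeas_conj.
by move=> x /=; rewrite cabs_conj.
Qed.

Lemma Re_cint f : complex.Re (cint f) = \int[mu]_x complex.Re (f x).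
Proof. by []. Qed.

Lemma Im_cint f : complex.Im (cint f) = \int[mu]_x complex.Im (f x).
Proof. by []. Qed.

Lemma cintD f g : csummable f -> csummable g ->
  cint (fun x => f x + g x) = cint f + cint g.
Proof.
move=> [f1 f2] [g1 g2]; apply: eqcP; rewrite ?ReD ?ImD ?Re_cint ?Im_cint.
  by under eq_Rintegral do rewrite ReD; exact: RintegralD.
by under eq_Rintegral do rewrite ImD; exact: RintegralD.
Qed.

Lemma cintZ f z : csummable f -> cint (fun x => z * f x) = z * cint f.
Proof.
have iZ (a : R) (h : T -> R) : mu.-integrable setT (EFin \o h) ->
    mu.-integrable setT (EFin \o (fun x => a * h x)).
  by move=> ih; rewrite (_ : _ \o _ = (fun x => a%:E * (EFin \o h) x))%E//; exact: integrableZl.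
move=> [f1 f2]; apply: eqcP; rewrite ?RecM ?ImcM ?Re_cint ?Im_cint.
  under eq_Rintegral do rewrite RecM.
  by rewrite RintegralB// ?RintegralZl//; exact: iZ.
under eq_Rintegral do rewrite ImcM.
by rewrite RintegralD// ?RintegralZl//; exact: iZ.
Qed.

Lemma cintZr f z : csummable f -> cint (fun x => f x * z) = cint f * z.
Proof. by move=> sf; rewrite mulrC -cintZ//; apply: eq_cint => x; rewrite mulrC. Qed.

Lemma cintN f : csummable f -> cint (fun x => - f x) = - cint f.
Proof. by move=> sf; rewrite -mulN1r -cintZ//; apply: eq_cint => x; rewrite mulN1r. Qed.

Lemma cintB f g : csummable f -> csummable g ->
  cint (fun x => f x - g x) = cint f - cint g.
Proof.
move=> sf sg; rewrite cintD ?cintN//.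
rewrite (_ : (fun _ => _) = (fun x => (-1) * g x)); first exact: csummableZ.
by apply/funext => x; rewrite mulN1r.
Qed.

Lemma cint_conj f : csummable f -> cint (fun x => (conjc (f x))) = (conjc (cint f)).
Proof.
move=> [f1 f2]; apply: eqcP; rewrite ?Re_conjc ?Im_conjc ?Re_cint ?Im_cint.
  by apply: eq_Rintegral => x _; rewrite Re_conjc.
under eq_Rintegral do rewrite Im_conjc -mulN1r.
by rewrite RintegralZl// mulN1r.
Qed.

(* Rotate the integral onto the positive axis. *)
Lemma cabs_cint f : csummable f -> cabs (cint f) <= \int[mu]_x cabs (f x).
Proof.
move=> sf; have /csummableP[mf cf] := sf.
have [->|z0] := eqVneq (cint f) 0.
  by rewrite cabs0; apply: Rintegral_ge0 => x _; exact: cabs_ge0.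
have sz := csummableZ (conjc (cint f)) sf.
rewrite -(ler_pM2l (cabs_gt0 z0)) -expr2.
have -> : cabs (cint f) ^+ 2 = complex.Re (cint (fun x => (conjc (cint f)) * f x)).
  by rewrite cintZ// mulrC mulc_conj.
rewrite Re_cint -RintegralZl//.
apply: le_Rintegral => //; first by case: sz.
  rewrite (_ : _ \o _ = (fun x => (cabs (cint f))%:E * (EFin \o (cabs \o f)) x))%E//.
  exact: integrableZl.
move=> x _; apply: (le_trans (ler_norm _)); apply: (le_trans (Re_le_cabs _)).
by rewrite cabsM cabs_conj.
Qed.

End cint.

Section cfubini.
Context d1 d2 (X : measurableType d1) (Y : measurableType d2) (R : realType).
Variable mu : {sigma_finite_measure set X -> \bar R}.
Variable nu : {sigma_finite_measure set Y -> \bar R}.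

Lemma measurable_int_section1 (h : X * Y -> R) : measurable_fun setT h ->
  measurable_fun setT (fun y => \int[mu]_x h (x, y)).
Proof.
move=> mh; rewrite /Rintegral.
apply: measurableT_comp => //.
rewrite (_ : (fun _ => _) = (fun y => \int[mu]_x (EFin \o h)^\+ (x, y) -
    \int[mu]_x (EFin \o h)^\- (x, y)))%E.
  apply: emeasurable_funB.
    apply: (@measurable_fun_fubini_tonelli_G _ _ _ _ _ _ ((EFin \o h)^\+)%E) => //.
    by apply: measurable_funepos; exact/measurable_EFinP.
  apply: (@measurable_fun_fubini_tonelli_G _ _ _ _ _ _ ((EFin \o h)^\-)%E) => //.
  by apply: measurable_funeneg; exact/measurable_EFinP.
apply/funext => y; rewrite integralE; congr (_ - _)%E; apply: eq_integral => x _;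
  by rewrite ?funeposE ?funenegE.
Qed.

Lemma cmeas_int_section1 (h : X * Y -> R[i]) : cmeas h ->
  cmeas (fun y => cint mu (fun x => h (x, y))).
Proof.
by move=> [h1 h2]; split; [exact: (measurable_int_section1 h1)|
  exact: (measurable_int_section1 h2)].
Qed.

Lemma cmeas_section1 (h : X * Y -> R[i]) y : cmeas h -> cmeas (fun x => h (x, y)).
Proof. by move=> mh; apply: (cmeas_comp mh); exact: pair2_measurable. Qed.

Lemma cmeas_section2 (h : X * Y -> R[i]) x : cmeas h -> cmeas (fun y => h (x, y)).
Proof. by move=> mh; apply: (cmeas_comp mh); exact: pair1_measurable. Qed.

Lemma cint_prod2 (h : X * Y -> R[i]) : csummable (mu \x nu)%E h ->
  cint (mu \x nu)%E h = cint nu (fun y => cint mu (fun x => h (x, y))).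
Proof.
have fub (g : X * Y -> R) : (mu \x nu)%E.-integrable setT (EFin \o g) ->
    \int[(mu \x nu)%E]_z g z = \int[nu]_y \int[mu]_x g (x, y).
  move=> ig; rewrite /Rintegral; congr fine.
  have /= <- := integral21_prod_meas1 ig.
  apply: ae_eq_integral => //.
  - exact: (measurable_fubini_G ig).
  - apply/measurable_EFinP; apply: measurable_int_section1.
    by apply/measurable_EFinP; exact: measurable_int ig.
  (* Almost every section is integrable, so [fine] in the inner real integral loses nothing. *)
  - apply: filterS (ae_integrable2 ig) => y iy _; rewrite /= fineK//.
    exact: integrable_fin_num.
move=> [h1 h2]; apply: eqcP; rewrite ?Re_cint ?Im_cint.
  exact: (fub (@complex.Re R \o h) h1).
exact: (fub (@complex.Im R \o h) h2).
Qed.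

Lemma cint_prod1 (h : X * Y -> R[i]) : csummable (mu \x nu)%E h ->
  cint (mu \x nu)%E h = cint mu (fun x => cint nu (fun y => h (x, y))).
Proof.
have fub (g : X * Y -> R) : (mu \x nu)%E.-integrable setT (EFin \o g) ->
    \int[(mu \x nu)%E]_z g z = \int[mu]_x \int[nu]_y g (x, y).
  move=> ig; rewrite /Rintegral; congr fine.
  have /= <- := integral12_prod_meas1 ig.
  apply: ae_eq_integral => //.
  - exact: (measurable_fubini_F ig).
  - apply/measurable_EFinP; apply: measurableT_comp => //.
    exact: (measurable_fubini_F ig).
  - apply: filterS (ae_integrable1 ig) => y iy _; rewrite /= fineK//.
    exact: integrable_fin_num.
move=> [h1 h2]; apply: eqcP; rewrite ?Re_cint ?Im_cint.
  exact: (fub (@complex.Re R \o h) h1).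
exact: (fub (@complex.Im R \o h) h2).
Qed.

Lemma cfubini (h : X * Y -> R[i]) : csummable (mu \x nu)%E h ->
  cint nu (fun y => cint mu (fun x => h (x, y))) =
  cint mu (fun x => cint nu (fun y => h (x, y))).
Proof. by move=> sh; rewrite -cint_prod2// cint_prod1. Qed.

Lemma csummable_prod (u : X -> R[i]) (v : Y -> R[i]) (k : X * Y -> R[i]) c :
  csummable mu u -> csummable nu v -> cmeas k -> (forall z, cabs (k z) <= c) ->
  csummable (mu \x nu)%E (fun z => k z * (u z.1 * v z.2)).
Proof.
move=> /csummableP[mu1 iu] /csummableP[mv iv] mk kc.
apply: csummableMb kc => //.
have muv : cmeas (fun z : X * Y => u z.1 * v z.2).
  by apply: cmeasM; [exact: cmeas_comp mu1 _|exact: cmeas_comp mv _].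
apply/csummableP; split => //.
apply/integrable12ltyP; first exact/measurable_EFinP/measurable_cabs.
have -> : (\int[mu]_x \int[nu]_y `|(EFin \o (cabs \o (fun z => (u z.1 * v z.2)%R))) (x, y)| =
   \int[mu]_x ((cabs (u x))%:E * \int[nu]_y (cabs (v y))%:E))%E.
  apply: eq_integral => x _; rewrite -ge0_integralZl//.
  - apply: eq_integral => y _ /=; rewrite cabsM -EFinM ger0_norm//.
    by rewrite mulr_ge0// cabs_ge0.
  - exact/measurable_EFinP/measurable_cabs.
  - by move=> y _; rewrite lee_fin cabs_ge0.
  - by rewrite lee_fin cabs_ge0.
rewrite ge0_integralZr//.
- apply: lte_mul_pinfty.
  + by apply: integral_ge0 => x _; rewrite lee_fin cabs_ge0.
  + exact: (integrable_fin_num _ iu).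
  + by have /fin_numPlt/andP[] := integrable_fin_num measurableT iv.
- exact/measurable_EFinP/measurable_cabs.
- by move=> x _; rewrite lee_fin cabs_ge0.
- by apply: integral_ge0 => y _; rewrite lee_fin cabs_ge0.
Qed.

(** Fubini for the bilinear form of a bounded kernel; conjugating [v] turns it into adjointness
    ([kop_adj]). *)
Lemma cint_kernel (u : X -> R[i]) (v : Y -> R[i]) (k : X * Y -> R[i]) c :
  csummable mu u -> csummable nu v -> cmeas k -> (forall z, cabs (k z) <= c) ->
  cint nu (fun y => cint mu (fun x => k (x, y) * u x) * v y) =
  cint mu (fun x => u x * cint nu (fun y => k (x, y) * v y)).
Proof.
move=> su sv mk kc.
transitivity (cint nu (fun y => cint mu (fun x => k (x, y) * (u x * v y)))).
  apply: eq_cint => y; rewrite -cintZr.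
    by apply: eq_cint => x; rewrite mulrA.
  by apply: (@csummableMb _ _ _ _ _ _ c) => //; exact: cmeas_section1.
transitivity (cint mu (fun x => cint nu (fun y => k (x, y) * (u x * v y)))).
  by rewrite -(cfubini (csummable_prod su sv mk kc)).
apply: eq_cint => x; rewrite -cintZ.
  by apply: eq_cint => y; rewrite mulrCA.
by apply: (@csummableMb _ _ _ _ _ _ c) => //; exact: cmeas_section2.
Qed.

End cfubini.

(** * Cauchy-Schwarz by optimisation, and log-convex sequences *)

Section real_lemmas.
Variable R : realType.
Implicit Types (x y A B : R).

(** The choice t = x / A turns the hypothesis into x <= A B / x, without square roots. This is the
    passage from the weighted inequality between means to Cauchy-Schwarz. *)
Lemma amgm_optimal x A B : 0 <= x -> 0 <= A -> 0 <= B ->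
  (forall t, 0 < t -> 2 * x <= t * A + t^-1 * B) -> x ^+ 2 <= A * B.
Proof.
move=> x0 A0 B0 H; have [->|xn0] := eqVneq x 0; first by rewrite expr0n mulr_ge0.
have {}x0 : 0 < x by rewrite lt0r xn0.
have [Ae|An0] := eqVneq A 0.
  (* With A = 0 a large t gives a contradiction: this one makes the right-hand side x B / (B + 1),
     which is less than x. *)
  have t0 : 0 < (B + 1) / x by rewrite divr_gt0// ltr_wpDl.
  have := H _ t0; rewrite Ae mulr0 add0r invf_div mulrAC -mulrA => h.
  suff : x * (B / (B + 1)) < 2 * x by rewrite ltNge h.
  rewrite mulrC ltr_pM2r// ltr_pdivrMr ?ltr_wpDl//; lra.
have {}A0 : 0 < A by rewrite lt0r An0.
have t0 : 0 < x / A by rewrite divr_gt0.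
have := H _ t0; rewrite -mulrA mulVf// mulr1 invf_div => h.
have : x <= A / x * B by lra.
by rewrite mulrAC ler_pdivlMr// expr2.
Qed.

(** Log-convexity makes the ratios a(k+1) / a(k) nondecreasing. If the first one, x, exceeded y,
    then a(k) would grow at least like x^k, which the bound by C y^k forbids. *)
Lemma log_convex_ratio_le (a : nat -> R) (C y : R) : (forall k, 0 <= a k) ->
  0 <= y -> (forall k, a k.+1 ^+ 2 <= a k * a k.+2) ->
  (forall k, a k.+2 <= C * y ^+ k) -> a 1%N <= y * a 0%N.
Proof.
move=> a0 y0 lc le; have [e|an0] := eqVneq (a 0%N) 0.
  have := lc 0%N; rewrite e mul0r mulr0 => h.
  by rewrite real_leNgt ?num_real//; apply/negP => p; move: h; rewrite leNgt exprn_gt0.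
have p0 : 0 < a 0%N by rewrite lt0r an0 a0.
rewrite -ler_pdivrMr//; set x := a 1%N / a 0%N.
rewrite leNgt; apply/negP => yx.
have x0 : 0 < x := le_lt_trans y0 yx.
have a1 : a 1%N = x * a 0%N by rewrite /x divfK.
have step k : 0 < a k /\ x * a k <= a k.+1.
  elim: k => [|k [pk IH]]; first by rewrite a1.
  have pk1 : 0 < a k.+1 by apply: lt_le_trans IH; rewrite mulr_gt0.
  split => //; rewrite -(ler_pM2l pk); apply: le_trans (lc k).
  by rewrite mulrCA mulrA expr2 ler_pM2r.
have grow k : x ^+ k * a 0%N <= a k.
  elim: k => [|k IH]; first by rewrite expr0 mul1r.
  apply: le_trans (step k).2; by rewrite exprS -mulrA ler_pM2l.
have yx0 : 0 <= y / x by rewrite divr_ge0// ltW.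
have : ((y / x) ^+ k @[k --> \oo] --> (0:R))%classic.
  by apply: cvg_expr; rewrite ger0_norm// ltr_pdivrMr// mul1r.
(* Growth and bound together give x^2 a(0) <= C (y / x)^k for all k, whose right-hand side tends to
   0; |C| + 1 is a positive substitute for C. *)
have eps0 : 0 < x ^+ 2 * a 0%N / (`|C| + 1).
  by rewrite divr_gt0// mulr_gt0// exprn_gt0.
move=> /cvgrPdist_lt/(_ _ eps0)[N _ /(_ N)]/(_ (leqnn N)) /=.
rewrite sub0r normrN ger0_norm ?exprn_ge0//.
rewrite ltr_pdivlMr ?ltr_wpDl// expr_div_n -mulrA (mulrC (_^-1)) mulrA.
rewrite ltr_pdivrMr ?exprn_gt0// mulrAC -exprD ltNge => /negP; apply.
apply: (le_trans (grow _)); rewrite add2n; apply: (le_trans (le N)).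
rewrite mulrC ler_wpM2l ?exprn_ge0//.
by apply: le_trans (ler_norm _) _; rewrite lerDl.
Qed.

End real_lemmas.

(* [S] is symmetric and its powers factor through those of [Y]; the moments of a
   symmetric operator being log-convex, [S] is bounded by any bound of [Y]. *)
Lemma symmetric_power_bound (R : realType) (V : Type) (D : set V)
    (ip : V -> V -> R) (S Y Z1 Z2 : V -> V) (c1 c2 y : R) :
  (forall u v, D u -> D v -> ip u v ^+ 2 <= ip u u * ip v v) ->
  (forall u, D u -> 0 <= ip u u) ->
  (forall u, D u -> D (S u)) -> (forall u, D u -> D (Y u)) ->
  (forall u, D u -> D (Z1 u)) -> (forall u, D u -> D (Z2 u)) ->
  (forall u v, D u -> D v -> ip (S u) v = ip u (S v)) ->
  (forall u, D u -> S (S u) = Z1 (Z2 u)) ->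
  (forall u, D u -> S (Z1 u) = Z1 (Y u)) ->
  0 <= y -> 0 <= c1 ->
  (forall u, D u -> ip (Z1 u) (Z1 u) <= c1 * ip u u) ->
  (forall u, D u -> ip (Z2 u) (Z2 u) <= c2 * ip u u) ->
  (forall u, D u -> ip (Y u) (Y u) <= y * ip u u) ->
  forall u, D u -> ip (S u) (S u) <= y * ip u u.
Proof.
move=> CS ip0 DS DY DZ1 DZ2 sym SS SZ y0 c10 bZ1 bZ2 bY u Du.
have Dk k : D (iter k S u) by elim: k => //= k; exact: DS.
have DYk k v : D v -> D (iter k Y v) by move=> Dv; elim: k => //= k; exact: DY.
pose a k := ip (iter k S u) (iter k S u).
apply: (@log_convex_ratio_le _ a (c1 * (c2 * ip u u)) y) => //.
- by move=> k; exact: ip0.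
- move=> k; rewrite /a.
  have -> : ip (iter k.+1 S u) (iter k.+1 S u) = ip (iter k S u) (iter k.+2 S u).
    by rewrite [in LHS]iterS sym// -iterS.
  exact: CS.
(* Here S^(k+2) u = Z1 (Y^k (Z2 u)), so the growth rate of the moments comes from [Y] alone, while
   [c1] and [c2] go into the constant. *)
- move=> k; have -> : a k.+2 = ip (Z1 (iter k Y (Z2 u))) (Z1 (iter k Y (Z2 u))).
    suff e : iter k.+2 S u = Z1 (iter k Y (Z2 u)) by rewrite /a e.
    elim: k => [|k IH]; first by rewrite /= SS.
    by rewrite iterS IH SZ ?iterS//; exact/DYk/DZ2.
  have D2 := DZ2 _ Du; apply: (le_trans (bZ1 _ (DYk _ _ D2))).
  rewrite -!mulrA ler_wpM2l//.
  apply: (@le_trans _ _ (y ^+ k * ip (Z2 u) (Z2 u))).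
    elim: k => [|k IH]; first by rewrite expr0 mul1r.
    rewrite iterS; apply: (le_trans (bY _ (DYk _ _ D2))).
    by rewrite exprS -mulrA ler_wpM2l.
  by rewrite mulrC mulrA ler_wpM2r ?exprn_ge0// bZ2.
Qed.

(** * Integral operators with bounded kernel *)

Section L2g.
Context d (T : measurableType d) (R : realType).
Variable mu : {measure set T -> \bar R}.
Implicit Types (u v : T -> R[i]).

Definition sqn u : \bar R := (\int[mu]_x (cabs (u x) ^+ 2)%:E)%E.

(** Squared norms come in two forms: the extended [sqn] suits monotone convergence, the real [nsq]
    suits algebra, and [sqnE] links them on [L2g]. *)
Definition nsq u : R := fine (sqn u).

Definition L2g u := cmeas u /\ (sqn u < +oo)%E.

Lemma sqn_ge0 u : (0 <= sqn u)%E.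
Proof. by apply: integral_ge0 => x _; rewrite lee_fin sqr_ge0. Qed.

Lemma nsq_ge0 u : 0 <= nsq u.
Proof. by rewrite fine_ge0// sqn_ge0. Qed.

Lemma measurable_cabs2 u : cmeas u -> measurable_fun setT (fun x => cabs (u x) ^+ 2).
Proof. by move=> mu1; apply: measurable_funX; exact: measurable_cabs. Qed.

Lemma sqnE u : L2g u -> sqn u = (nsq u)%:E.
Proof. by move=> [_ h]; rewrite fineK// ge0_fin_numE// sqn_ge0. Qed.

Lemma integrable_cabs2 u : L2g u ->
  mu.-integrable setT (EFin \o (fun x => cabs (u x) ^+ 2)).
Proof.
move=> [mu1 h]; apply/integrableP; split; first exact/measurable_EFinP/measurable_cabs2.
by under eq_integral do rewrite /= ger0_norm ?sqr_ge0//.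
Qed.

Lemma le_sqn u v : cmeas u -> cmeas v -> (forall x, cabs (u x) <= cabs (v x)) ->
  (sqn u <= sqn v)%E.
Proof.
move=> mu1 mv uv; apply: ge0_le_integral => //.
- by move=> x _; rewrite lee_fin sqr_ge0.
- exact/measurable_EFinP/measurable_cabs2.
- exact/measurable_EFinP/measurable_cabs2.
- by move=> x _; rewrite lee_fin ler_pXn2r ?nnegrE ?cabs_ge0.
Qed.

Lemma le_L2g u v : cmeas u -> L2g v -> (forall x, cabs (u x) <= cabs (v x)) -> L2g u.
Proof. by move=> mu1 [mv h] uv; split => //; apply: le_lt_trans h; exact: le_sqn. Qed.

Lemma sqnZ z u : cmeas u -> sqn (fun x => z * u x) = ((cabs z ^+ 2)%:E * sqn u)%E.
Proof.
move=> mu1; rewrite /sqn -ge0_integralZl//.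
- by apply: eq_integral => x _; rewrite cabsM exprMn EFinM.
- exact/measurable_EFinP/measurable_cabs2.
- by move=> x _; rewrite lee_fin sqr_ge0.
- by rewrite lee_fin sqr_ge0.
Qed.

Lemma sqnN u : sqn (fun x => - u x) = sqn u.
Proof. by apply: eq_integral => x _; rewrite cabsN. Qed.

(** Triangle inequality for squared norms without square roots, from 2ab <= t a^2 + b^2 / t. A small
    t leaves the coefficient of [u] close to 1, as [no_eigenvalue] needs. *)
Lemma sqnD u v t : 0 < t -> cmeas u -> cmeas v ->
  (sqn (fun x => (u x + v x)%R) <= (1 + t)%:E * sqn u + (1 + t^-1)%:E * sqn v)%E.
Proof.
move=> t0 mu1 mv; rewrite /sqn.
have t1 : 0 <= 1 + t by lra.
have t2 : 0 <= 1 + t^-1 by rewrite addr_ge0// invr_ge0 ltW.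
rewrite -!ge0_integralZl//; last 4 first.
- exact/measurable_EFinP/measurable_cabs2.
- by move=> x _; rewrite lee_fin sqr_ge0.
- exact/measurable_EFinP/measurable_cabs2.
- by move=> x _; rewrite lee_fin sqr_ge0.
rewrite -ge0_integralD//; last 4 first.
- by move=> x _; rewrite -EFinM lee_fin mulr_ge0// sqr_ge0.
- apply: emeasurable_funM => //; exact/measurable_EFinP/measurable_cabs2.
- by move=> x _; rewrite -EFinM lee_fin mulr_ge0// sqr_ge0.
- apply: emeasurable_funM => //; exact/measurable_EFinP/measurable_cabs2.
apply: ge0_le_integral => //.
- by move=> x _; rewrite lee_fin sqr_ge0.
- exact/measurable_EFinP/measurable_cabs2/cmeasD.
- apply: emeasurable_funD; apply: emeasurable_funM => //; exact/measurable_EFinP/measurable_cabs2.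
- move=> x _; rewrite -!EFinM -EFinD lee_fin.
  have h := cabsD (u x) (v x).
  apply: (@le_trans _ _ ((cabs (u x) + cabs (v x)) ^+ 2)).
    by rewrite ler_pXn2r ?nnegrE ?addr_ge0 ?cabs_ge0.
  set a := cabs (u x); set b := cabs (v x).
  have : 0 <= t^-1 * (t * a - b) ^+ 2 by rewrite mulr_ge0 ?invr_ge0 ?sqr_ge0// ltW.
  have -> : t^-1 * (t * a - b) ^+ 2 = t * a ^+ 2 - 2 * a * b + t^-1 * b ^+ 2.
    by field; rewrite gt_eqF.
  lra.
Qed.

Lemma L2gD u v : L2g u -> L2g v -> L2g (fun x => u x + v x).
Proof.
move=> lu lv; split; first by apply: cmeasD; [case: lu|case: lv].
have [mu1 _] := lu; have [mv _] := lv.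
apply: le_lt_trans (sqnD (@ltr01 R) mu1 mv) _.
by rewrite (sqnE lu) (sqnE lv) -!EFinM -EFinD ltry.
Qed.

Lemma L2gZ z u : L2g u -> L2g (fun x => z * u x).
Proof.
move=> lu; have [mu1 _] := lu; split; first exact: cmeasM (cmeas_cst _ _) mu1.
by rewrite sqnZ// (sqnE lu) -EFinM ltry.
Qed.

Lemma L2gN u : L2g u -> L2g (fun x => - u x).
Proof. by move=> lu; have [mu1 h] := lu; split; [exact: cmeasN|rewrite sqnN]. Qed.

Lemma L2gB u v : L2g u -> L2g v -> L2g (fun x => u x - v x).
Proof. by move=> lu lv; apply: L2gD => //; exact: L2gN. Qed.

Lemma L2g_conj u : L2g u -> L2g (fun x => (conjc (u x))).
Proof.
move=> lu; apply: (le_L2g _ lu); first by apply: cmeas_conj; case: lu.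
by move=> x; rewrite cabs_conj.
Qed.

Lemma L2gMb g u c : L2g u -> cmeas g -> (forall x, cabs (g x) <= c) ->
  L2g (fun x => g x * u x).
Proof.
move=> lu mg gc; have [mu1 _] := lu.
apply: (@le_L2g _ (fun x => `|c|%:C * u x)); first exact: cmeasM.
  exact: L2gZ.
move=> x; rewrite !cabsM ler_wpM2r ?cabs_ge0// cabs_real normr_id.
exact: le_trans (gc x) (ler_norm _).
Qed.

Lemma csummable_L2gM u v : L2g u -> L2g v -> csummable mu (fun x => u x * v x).
Proof.
move=> lu lv; apply: (@le_csummable _ _ _ _ _ (fun x => cabs (u x) ^+ 2 + cabs (v x) ^+ 2)).
- by apply: cmeasM; [case: lu|case: lv].
- rewrite (_ : _ \o _ = ((EFin \o (fun x => (cabs (u x) ^+ 2)%R)) \+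
     (EFin \o (fun x => (cabs (v x) ^+ 2)%R)))%E)//.
  by apply: integrableD => //; exact: integrable_cabs2.
- move=> x; rewrite cabsM.
  have := sqr_ge0 (cabs (u x) - cabs (v x)); have := sqr_ge0 (cabs (u x) + cabs (v x)).
  set a := cabs _; set b := cabs _; rewrite !expr2; nra.
Qed.

Lemma cint_CS u v : L2g u -> L2g v ->
  cabs (cint mu (fun x => u x * v x)) ^+ 2 <= nsq u * nsq v.
Proof.
move=> lu lv; have suv := csummable_L2gM lu lv.
apply: amgm_optimal; rewrite ?cabs_ge0 ?nsq_ge0// => t t0.
apply: (@le_trans _ _ (2 * \int[mu]_x cabs (u x * v x))).
  by rewrite ler_pM2l//; exact: cabs_cint.
have iu := integrable_cabs2 lu; have iv := integrable_cabs2 lv.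
have eu : nsq u = \int[mu]_x (cabs (u x) ^+ 2) by [].
have ev : nsq v = \int[mu]_x (cabs (v x) ^+ 2) by [].
have iZ (a : R) (h : T -> R) : mu.-integrable setT (EFin \o h) ->
    mu.-integrable setT (EFin \o (fun x => a * h x)).
  by move=> ih; rewrite (_ : _ \o _ = (fun x => a%:E * (EFin \o h) x))%E//; exact: integrableZl.
rewrite eu ev -!RintegralZl//; last by have /csummableP[] := suv.
rewrite -RintegralD//; [|exact: iZ|exact: iZ].
apply: le_Rintegral => //; first by apply: iZ; have /csummableP[] := suv.
  rewrite (_ : _ \o _ = ((EFin \o (fun x => (t * cabs (u x) ^+ 2)%R)) \+
     (EFin \o (fun x => (t^-1 * cabs (v x) ^+ 2)%R)))%E)//.
  by apply: integrableD => //; exact: iZ.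
move=> x _; rewrite cabsM; set a := cabs _; set b := cabs _.
have : 0 <= t^-1 * (t * a - b) ^+ 2 by rewrite mulr_ge0 ?invr_ge0 ?sqr_ge0// ltW.
have -> : t^-1 * (t * a - b) ^+ 2 = t * a ^+ 2 - 2 * a * b + t^-1 * b ^+ 2.
  by field; rewrite gt_eqF.
lra.
Qed.

Lemma nsqE u : L2g u -> cint mu (fun x => u x * (conjc (u x))) = (nsq u)%:C.
Proof.
move=> lu; apply: eqcP; rewrite ?Re_cint ?Im_cint.
  by apply: eq_Rintegral => x _; rewrite mulc_conj.
rewrite (@eq_Rintegral _ _ _ _ _ (cst 0)) ?Rintegral_cst ?mul0r//.
by move=> x _; rewrite mulc_conj.
Qed.

(** Such functions lie in L1 and in L2, and the operators [sand] and [sandadj] with weights of this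
    class preserve it, so that they can be iterated. *)
Definition bfs u := [/\ cmeas u, exists M : R, forall x, cabs (u x) <= M &
  exists E, [/\ measurable E, (mu E < +oo)%E & forall x, ~ E x -> u x = 0]].

Lemma bfs_meas u : bfs u -> cmeas u. Proof. by case. Qed.

Lemma bfs_L2g u : bfs u -> L2g u.
Proof.
move=> [mu1 [M uM] [E [mE fE uE]]]; split => //.
apply: (@le_lt_trans _ _ (\int[mu]_(x in E) (M ^+ 2)%:E)%E).
  rewrite [in leRHS]integral_mkcond; apply: ge0_le_integral => //.
  - by move=> x _; rewrite lee_fin sqr_ge0.
  - exact/measurable_EFinP/measurable_cabs2.
  - by apply/(measurable_restrictT _ mE); exact: measurable_cst.
  - move=> x _; rewrite patchE; case: ifPn => [_|/negP xE].
      by rewrite lee_fin ler_pXn2r ?nnegrE ?cabs_ge0// (le_trans _ (uM x))// cabs_ge0.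
    by rewrite uE ?cabs0 ?expr0n//; move=> ?; apply: xE; rewrite inE.
rewrite integral_cst//; apply: lte_mul_pinfty => //.
by rewrite lee_fin sqr_ge0.
Qed.

Lemma bfs_csummable u : bfs u -> csummable mu u.
Proof.
move=> [mu1 [M uM] [E [mE fE uE]]].
apply: (@le_csummable _ _ _ _ _ (fun x => M * \1_E x)) => //.
  rewrite (_ : _ \o _ = (fun x => M%:E * (EFin \o \1_E) x))%E//.
  apply: integrableZl => //; apply/integrableP; split.
    exact/measurable_EFinP/measurable_indic.
  under eq_integral do rewrite /= ger0_norm//.
  by rewrite integral_indic// setIT.
move=> x; rewrite indicE; have [xE|xE] := boolP (x \in E); first by rewrite mulr1.
by rewrite mulr0 uE ?cabs0//; move=> ?; move/negP: xE; apply; rewrite inE.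
Qed.

Lemma bfsMb g u c : bfs u -> cmeas g -> (forall x, cabs (g x) <= c) ->
  bfs (fun x => g x * u x).
Proof.
move=> [mu1 [M uM] [E [mE fE uE]]] mg gc; split.
- exact: cmeasM.
- exists (c * M) => x; rewrite cabsM ler_pM ?cabs_ge0//.
- by exists E; split => // x /uE ->; rewrite mulr0.
Qed.

Lemma bfsMr g u c : bfs u -> cmeas g -> (forall x, cabs (g x) <= c) ->
  bfs (fun x => u x * g x).
Proof.
by move=> bu mg gc; under eq_fun do rewrite mulrC; exact: bfsMb bu mg gc.
Qed.

Lemma bfsM u v : bfs u -> bfs v -> bfs (fun x => u x * v x).
Proof. by move=> bu [mv [M vM] _]; exact: bfsMr bu mv vM. Qed.

End L2g.

Section kernel.
Context d1 d2 (X : measurableType d1) (Y : measurableType d2) (R : realType).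
Variable mu : {sigma_finite_measure set X -> \bar R}.
Variable nu : {sigma_finite_measure set Y -> \bar R}.
Variables (e : X * Y -> R[i]) (c : R).
Hypotheses (me : cmeas e) (ec : forall z, cabs (e z) <= c).

Definition kop u y := cint mu (fun x => e (x, y) * u x).

Definition kadj v x := cint nu (fun y => (conjc (e (x, y))) * v y).

Lemma csummable_kop u y : csummable mu u -> csummable mu (fun x => e (x, y) * u x).
Proof. by move=> su; apply: (@csummableMb _ _ _ _ _ _ c) => //; exact: cmeas_section1. Qed.

Lemma cmeas_kop u : cmeas u -> cmeas (kop u).
Proof.
move=> mu1; apply: (cmeas_int_section1 mu (h := fun z => e z * u z.1)).
by apply: cmeasM => //; exact: cmeas_comp mu1 _.
Qed.

Lemma kop_le u y : csummable mu u -> cabs (kop u y) <= c * \int[mu]_x cabs (u x).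
Proof.
move=> su; have sk := csummable_kop y su; apply: (le_trans (cabs_cint sk)).
rewrite -RintegralZl//; last by have /csummableP[] := su.
apply: le_Rintegral => //.
- by have /csummableP[] := sk.
- rewrite (_ : _ \o _ = (fun x => c%:E * (EFin \o (cabs \o u)) x))%E//.
  by apply: integrableZl => //; have /csummableP[] := su.
- by move=> x _; rewrite cabsM ler_wpM2r ?cabs_ge0.
Qed.

Lemma kop_adj u v : csummable mu u -> csummable nu v ->
  cint nu (fun y => kop u y * (conjc (v y))) = cint mu (fun x => u x * (conjc (kadj v x))).
Proof.
move=> su sv; rewrite /kop.
rewrite (cint_kernel su (csummable_conj sv) me ec); apply: eq_cint => x.
congr (_ * _); rewrite /kadj. rewrite -cint_conj.
  by apply: eq_cint => y; rewrite conjcM conjcK.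
apply: (@csummableMb _ _ _ _ _ _ c) => //.
  by apply: cmeas_conj; exact: cmeas_section2.
by move=> y; rewrite cabs_conj.
Qed.

Lemma kopD u v y : csummable mu u -> csummable mu v ->
  kop (fun x => u x + v x) y = kop u y + kop v y.
Proof.
move=> su sv; rewrite -cintD; [|exact: csummable_kop|exact: csummable_kop].
by apply: eq_cint => x; rewrite mulrDr.
Qed.

Lemma kopZ z u y : csummable mu u -> kop (fun x => z * u x) y = z * kop u y.
Proof.
move=> su; rewrite -cintZ; last exact: csummable_kop.
by apply: eq_cint => x; rewrite mulrCA.
Qed.

(** The kernel h(y) e(x, y) f(x) is square integrable, with squared Hilbert-Schmidt norm at most c^2
    |f|^2 |h|^2; the bound follows from Cauchy-Schwarz in x at fixed y. *)
Lemma kop_HS (f u : X -> R[i]) (h : Y -> R[i]) : bfs mu f -> bfs mu u -> bfs nu h ->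
  nsq nu (fun y => h y * kop (fun x => f x * u x) y) <=
  (c ^+ 2 * nsq mu f * nsq nu h) * nsq mu u.
Proof.
move=> bf bu bh; have lf := bfs_L2g bf; have lu := bfs_L2g bu; have lh := bfs_L2g bh.
have bfu := bfsM bf bu; have sfu := bfs_csummable bfu.
have key y : cabs (kop (fun x => f x * u x) y) ^+ 2 <= c ^+ 2 * nsq mu f * nsq mu u.
  rewrite /kop.
  rewrite (@eq_cint _ _ _ mu _ (fun x => (e (x, y) * f x) * u x)); last first.
    by move=> x; rewrite mulrA.
  have lef : L2g mu (fun x => e (x, y) * f x).
    by apply: (@L2gMb _ _ _ _ _ _ c) => //; exact: cmeas_section1.
  apply: (le_trans (cint_CS lef lu)); rewrite ler_wpM2r ?nsq_ge0//.
  have := sqnZ mu c%:C (bfs_meas bf).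
  rewrite cabs_real real_normK ?num_real// (sqnE lf) -EFinM => ec'.
  have -> : c ^+ 2 * nsq mu f = nsq mu (fun x => c%:C * f x) by rewrite /nsq ec'.
  have lcf := L2gZ c%:C lf.
  rewrite -lee_fin -(sqnE lef) -(sqnE lcf); apply: le_sqn.
  - by case: lef.
  - by case: lcf.
  - move=> x; rewrite !cabsM ler_wpM2r ?cabs_ge0// cabs_real.
    exact: le_trans (ec _) (ler_norm _).
have lT : L2g nu (fun y => h y * kop (fun x => f x * u x) y).
  rewrite (_ : (fun _ => _) = (fun y => kop (fun x => f x * u x) y * h y)).
    apply: (L2gMb lh); first exact/cmeas_kop/(bfs_meas bfu).
    by move=> y; exact: kop_le.
  by apply/funext => y; rewrite mulrC.
set K := c ^+ 2 * nsq mu f * nsq mu u in key.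
have K0 : 0 <= K by rewrite /K mulr_ge0 ?nsq_ge0// mulr_ge0 ?nsq_ge0// sqr_ge0.
have lKh := L2gZ (Num.sqrt K)%:C lh.
have -> : c ^+ 2 * nsq mu f * nsq nu h * nsq mu u = nsq nu (fun y => (Num.sqrt K)%:C * h y).
  have := sqnZ nu (Num.sqrt K)%:C (bfs_meas bh).
  rewrite cabs_real real_normK ?num_real// sqr_sqrtr// (sqnE lh) -EFinM /nsq => ->.
  by rewrite /= /K /nsq; ring.
rewrite -lee_fin -(sqnE lT) -(sqnE lKh); apply: le_sqn.
- by case: lT.
- by case: lKh.
- move=> y; rewrite !cabsM mulrC ler_wpM2r ?cabs_ge0// cabs_real.
  rewrite ger0_norm ?sqrtr_ge0// -(@ler_pXn2r _ 2) ?nnegrE ?cabs_ge0 ?sqrtr_ge0//.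
  by apply: (le_trans (key y)); rewrite sqr_sqrtr.
Qed.

End kernel.

Section ip.
Context d (T : measurableType d) (R : realType).
Variable mu : {measure set T -> \bar R}.
Implicit Types (u v : T -> R[i]).

(** The real part is enough: it is symmetric, [ip u u] is the squared norm, and
    [symmetric_power_bound] works with a real form. *)
Definition ip u v : R := complex.Re (cint mu (fun x => u x * conjc (v x))).

Lemma ip_id u : L2g mu u -> ip u u = nsq mu u.
Proof. by move=> lu; rewrite /ip nsqE. Qed.

Lemma ipC u v : L2g mu u -> L2g mu v -> ip u v = ip v u.
Proof.
move=> lu lv; rewrite /ip -Re_conjc -cint_conj; last exact/csummable_L2gM/L2g_conj.
by congr complex.Re; apply: eq_cint => x; rewrite conjcM conjcK mulrC.
Qed.

Lemma ip_CS u v : L2g mu u -> L2g mu v -> ip u v ^+ 2 <= nsq mu u * nsq mu v.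
Proof.
move=> lu lv; have -> : nsq mu v = nsq mu (fun x => conjc (v x)).
  by rewrite /nsq; congr fine; apply: eq_integral => x _; rewrite cabs_conj.
apply: le_trans (cint_CS lu (L2g_conj lv)).
rewrite -real_normK ?num_real// ler_pXn2r ?nnegrE ?cabs_ge0//.
exact: Re_le_cabs.
Qed.

End ip.

(** * Interpolation of weighted kernel operators *)

Section sandwich.
Context d1 d2 (X : measurableType d1) (Y : measurableType d2) (R : realType).
Variable mu : {sigma_finite_measure set X -> \bar R}.
Variable nu : {sigma_finite_measure set Y -> \bar R}.
Variables (e : X * Y -> R[i]) (c : R).
Hypotheses (me : cmeas e) (ec : forall z, cabs (e z) <= c).
Implicit Types (f : X -> R) (h : Y -> R).

(** For this kernel [kop] is convertible to the adjoint [kadj], so the results on [kop] cover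
    both. *)
Definition eswap (z : Y * X) := conjc (e (z.2, z.1)).

Lemma cmeas_eswap : cmeas eswap.
Proof.
apply: cmeas_conj; apply: (cmeas_comp me (h := fun z : Y * X => (z.2, z.1))).
exact: measurable_swap.
Qed.

Lemma eswap_le z : cabs (eswap z) <= c.
Proof. by rewrite cabs_conj. Qed.

Definition sand f h u y := (h y)%:C * kop mu e (fun x => (f x)%:C * u x) y.

Definition sandadj f h v x := (f x)%:C * kadj nu e (fun y => (h y)%:C * v y) x.

Definition bfsr d (T : measurableType d) (la : {measure set T -> \bar R}) (f : T -> R) :=
  bfs la (fun x => (f x)%:C).

Lemma bfs_sand f h u : bfsr mu f -> bfsr nu h -> bfs mu u -> bfs nu (sand f h u).
Proof.
move=> bf bh bu; have bfu := bfsM bf bu.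
apply: (@bfsMr _ _ _ _ _ _ (c * \int[mu]_x cabs ((f x)%:C * u x)) bh).
  by apply: cmeas_kop => //; exact: bfs_meas bfu.
by move=> y; apply: kop_le => //; exact: bfs_csummable.
Qed.

Lemma bfs_sandadj f h v : bfsr mu f -> bfsr nu h -> bfs nu v -> bfs mu (sandadj f h v).
Proof.
move=> bf bh bv; have bhv := bfsM bh bv.
apply: (@bfsMr _ _ _ _ _ _ (c * \int[nu]_y cabs ((h y)%:C * v y)) bf).
  by apply: (cmeas_kop nu cmeas_eswap); exact: bfs_meas bhv.
by move=> x; apply: (kop_le cmeas_eswap eswap_le); exact: bfs_csummable.
Qed.

Lemma sand_adj f h u v : bfsr mu f -> bfsr nu h -> bfs mu u -> bfs nu v ->
  ip nu (sand f h u) v = ip mu u (sandadj f h v).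
Proof.
move=> bf bh bu bv; rewrite /ip; congr complex.Re.
have bfu := bfs_csummable (bfsM bf bu); have bhv := bfs_csummable (bfsM bh bv).
have := kop_adj me ec bfu bhv.
rewrite (_ : cint nu _ = cint nu (fun x => sand f h u x * conjc (v x))); last first.
  by apply: eq_cint => y; rewrite conjcM conjc_real /sand mulrA; congr (_ * _); rewrite mulrC.
move=> ->; apply: eq_cint => x.
by rewrite /sandadj conjcM conjc_real mulrA; congr (_ * _); rewrite mulrC.
Qed.

Lemma sand_HS f h u : bfsr mu f -> bfsr nu h -> bfs mu u ->
  nsq nu (sand f h u) <=
  c ^+ 2 * nsq mu (fun x => (f x)%:C) * nsq nu (fun y => (h y)%:C) * nsq mu u.
Proof. by move=> bf bh bu; exact: (kop_HS me ec bf bu bh). Qed.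

(** The constant bounds the squared norm, so the midpoint inequality takes the form of a geometric
    mean. *)
Definition sand_bound f h (a : R) :=
  forall u, bfs mu u -> nsq nu (sand f h u) <= a * nsq mu u.

(** With T for [sand f h] and T' for its adjoint: |T'v|^2 = <T T'v, v> <= |T T'v| |v| <= sqrt(a)
    |T'v| |v|. *)
Lemma sandadj_bound f h a : bfsr mu f -> bfsr nu h -> 0 <= a -> sand_bound f h a ->
  forall v, bfs nu v -> nsq mu (sandadj f h v) <= a * nsq nu v.
Proof.
move=> bf bh a0 ha v bv; have bA := bfs_sandadj bf bh bv.
set n := nsq mu _; have n0 : 0 <= n := nsq_ge0 _ _.
have [ne|nn] := eqVneq n 0; first by rewrite ne mulr_ge0// nsq_ge0.
have np : 0 < n by rewrite lt0r nn.
rewrite -(ler_pM2l np) -expr2.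
have -> : n = ip nu (sand f h (sandadj f h v)) v.
  by rewrite sand_adj// ip_id//; exact: bfs_L2g.
apply: (le_trans (ip_CS _ _)); [exact/bfs_L2g/bfs_sand|exact: bfs_L2g|].
rewrite mulrA ler_wpM2r ?nsq_ge0// sand_adj// ip_id; last exact: bfs_L2g.
by rewrite mulrC; exact: ha.
Qed.

Lemma eq_sand f f' h u u' : (forall x, (f x)%:C * u x = (f' x)%:C * u' x) ->
  sand f h u = sand f' h u'.
Proof.
move=> E; have {}E : (fun x => (f x)%:C * u x) = (fun x => (f' x)%:C * u' x).
  exact/funext.
by rewrite /sand E.
Qed.

(** Write K for the kernel operator, K' for its adjoint and P = K' hr^2 K. Since hs ht = hr^2, the
    operators of the proof are S = fr P fr, W = fs P ft, Z1 = fr P ft and Z2 = fs P fr; then fs ft =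
    fr^2 gives S S = Z1 Z2 and S Z1 = Z1 W. The squared norm of W is at most a b, hence so is that
    of S, and |T u|^2 = <S u, u> for T = [sand fr hr] yields the geometric mean. *)
Lemma sand_bound_mid (fr fs ft : X -> R) (hr hs ht : Y -> R) (a b : R) :
  bfsr mu fr -> bfsr mu fs -> bfsr mu ft ->
  bfsr nu hr -> bfsr nu hs -> bfsr nu ht ->
  (forall x, fs x * ft x = fr x * fr x) -> (forall y, hs y * ht y = hr y * hr y) ->
  0 <= a -> 0 <= b -> sand_bound fs hs a -> sand_bound ft ht b ->
  sand_bound fr hr (Num.sqrt (a * b)).
Proof.
move=> bfr bfs' bft bhr bhs bht ef eh a0 b0 Ba Bb u bu.
pose S u := sandadj fr hr (sand fr hr u).
pose W u := sandadj fs hs (sand ft ht u).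
pose Z1 u := sandadj fr hr (sand ft hr u).
pose Z2 u := sandadj fs hr (sand fr hr u).
(* [Z1] and [Z2] only have to be bounded, so the Hilbert-Schmidt bound suffices for them. *)
have Scrude f h : bfsr mu f -> bfsr nu h -> exists2 C, 0 <= C & sand_bound f h C.
  move=> bf bh; exists (c ^+ 2 * nsq mu (fun x => (f x)%:C) * nsq nu (fun y => (h y)%:C)).
    by rewrite mulr_ge0 ?nsq_ge0// mulr_ge0 ?nsq_ge0// sqr_ge0.
  by move=> ? ?; exact: sand_HS.
have comp f f' h h' (a' b' : R) : bfsr mu f -> bfsr mu f' -> bfsr nu h -> bfsr nu h' ->
    0 <= a' -> sand_bound f h a' -> sand_bound f' h' b' -> forall v, bfs mu v ->
    nsq mu (sandadj f h (sand f' h' v)) <= a' * b' * nsq mu v.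
  move=> bf bf' bh bh' a'0 Ba' Bb' v bv.
  apply: (le_trans (sandadj_bound bf bh a'0 Ba' (bfs_sand bf' bh' bv))).
  by rewrite -mulrA ler_wpM2l//; exact: Bb'.
have [C1 C10 B1] := Scrude _ _ bfr bhr.
have [C2 C20 B2] := Scrude _ _ bft bhr.
have [C3 C30 B3] := Scrude _ _ bfs' bhr.
have bS v : bfs mu v -> bfs mu (S v) by move=> bv; apply: bfs_sandadj => //; exact: bfs_sand.
have bW v : bfs mu v -> bfs mu (W v) by move=> bv; apply: bfs_sandadj => //; exact: bfs_sand.
have bZ1 v : bfs mu v -> bfs mu (Z1 v) by move=> bv; apply: bfs_sandadj => //; exact: bfs_sand.
have bZ2 v : bfs mu v -> bfs mu (Z2 v) by move=> bv; apply: bfs_sandadj => //; exact: bfs_sand.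
have ab0 : 0 <= a * b by rewrite mulr_ge0.
have efC x : (fs x)%:C * (ft x)%:C = (fr x)%:C * (fr x)%:C :> R[i].
  by rewrite -!complex_realM ef.
have ehC y : (hs y)%:C * (ht y)%:C = (hr y)%:C * (hr y)%:C :> R[i].
  by rewrite -!complex_realM eh.
have bound : nsq mu (S u) <= a * b * nsq mu u.
  rewrite -!ip_id; [|exact: bfs_L2g|exact/bfs_L2g/bS].
  apply: (@symmetric_power_bound R _ (bfs mu) (ip mu) S W Z1 Z2 (C1 * C2) (C3 * C1) (a * b)).
  - by move=> v w bv bw; rewrite !ip_id; try exact: bfs_L2g; apply: ip_CS; exact: bfs_L2g.
  - by move=> v bv; rewrite ip_id ?nsq_ge0//; exact: bfs_L2g.
  - exact: bS.
  - exact: bW.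
  - exact: bZ1.
  - exact: bZ2.
  - move=> v w bv bw.
    rewrite (ipC (bfs_L2g (bS _ bv)) (bfs_L2g bw)) /S.
    rewrite -(sand_adj bfr bhr bw (bfs_sand bfr bhr bv)).
    rewrite -(sand_adj bfr bhr bv (bfs_sand bfr bhr bw)).
    by apply: ipC; apply: bfs_L2g; exact: bfs_sand.
  - move=> v bv; have E : sand fr hr (S v) = sand ft hr (Z2 v).
      by apply: eq_sand => x; rewrite /S /Z2 /sandadj !mulrA (mulrC (ft x)%:C) efC.
    exact: (f_equal (sandadj fr hr) E).
  - move=> v bv; have E : sand fr hr (Z1 v) = sand ft hr (W v).
      apply: eq_sand => x; rewrite /Z1 /W /sandadj !mulrA (mulrC (ft x)%:C) efC.
      have E' : (fun y => (hr y)%:C * sand ft hr v y) = (fun y => (hs y)%:C * sand ft ht v y).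
        by apply/funext => y; rewrite /sand !mulrA ehC.
      by rewrite E'.
    exact: (f_equal (sandadj fr hr) E).
  - exact: ab0.
  - by rewrite mulr_ge0.
  - move=> v bv; rewrite !ip_id; [|exact: bfs_L2g|exact/bfs_L2g/bZ1].
    exact: comp.
  - move=> v bv; rewrite !ip_id; [|exact: bfs_L2g|exact/bfs_L2g/bZ2].
    exact: comp.
  - move=> v bv; rewrite !ip_id; [|exact: bfs_L2g|exact/bfs_L2g/bW].
    exact: comp.
  - exact: bu.
have lT := bfs_L2g (bfs_sand bfr bhr bu).
have -> : nsq nu (sand fr hr u) = ip mu (S u) u.
  rewrite ipC; [|exact/bfs_L2g/bS|exact: bfs_L2g].
  by rewrite -(ip_id lT) (sand_adj bfr bhr bu (bfs_sand bfr bhr bu)).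
rewrite -(@ger0_norm _ (_ * nsq mu u)) ?mulr_ge0 ?sqrtr_ge0 ?nsq_ge0//.
apply: (le_trans (ler_norm _)).
rewrite -(@ler_pXn2r _ 2) ?nnegrE// !real_normK ?num_real// exprMn sqr_sqrtr//.
apply: (le_trans (ip_CS _ _)); [exact/bfs_L2g/bS|exact: bfs_L2g|].
by rewrite expr2 mulrA ler_wpM2r ?nsq_ge0.
Qed.

(* The bounds [C M^s] improve to [sqrt C M^s] by splitting [s] as the midpoint
   of [0] and [2s], or of [1] and [2s-1]. *)
Lemma sand_bound_interp (f : R -> X -> R) (h : R -> Y -> R) (M C : R) :
  0 < M ->
  (forall s, 0 <= s <= 1 -> bfsr mu (f s)) -> (forall s, 0 <= s <= 1 -> bfsr nu (h s)) ->
  (forall s t x, 0 <= s <= 1 -> 0 <= t <= 1 ->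
    f s x * f t x = f ((s + t) / 2) x * f ((s + t) / 2) x) ->
  (forall s t y, 0 <= s <= 1 -> 0 <= t <= 1 ->
    h s y * h t y = h ((s + t) / 2) y * h ((s + t) / 2) y) ->
  sand_bound (f 0) (h 0) 1 -> sand_bound (f 1) (h 1) M ->
  (forall s, 0 <= s <= 1 -> sand_bound (f s) (h s) C) ->
  forall s, 0 <= s <= 1 -> sand_bound (f s) (h s) (M `^ s).
Proof.
move=> M0 bf bh fM hM B0 B1 BC.
(* On [0, 1] one has max(1, 1/M) M^s >= 1, so the uniform bound [C] can be put in the form C1 M^s;
   C1 >= 1 keeps all iterated square roots at least 1. *)
have [C1 C11 BC1] : exists2 C1, 1 <= C1 &
    forall s, 0 <= s <= 1 -> sand_bound (f s) (h s) (C1 * M `^ s).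
  exists (Num.max 1 (C * Num.max 1 M^-1)); first by rewrite le_max lexx.
  move=> s /[dup] sI /andP[s0 s1] u bu; apply: (le_trans (BC s sI u bu)).
  rewrite ler_wpM2r ?nsq_ge0//.
  have [C0|C0] := leP C 0.
    by apply: (le_trans C0); rewrite mulr_ge0 ?powR_ge0// le_max ler01.
  apply: (@le_trans _ _ (C * Num.max 1 M^-1 * M `^ s)); last first.
    by rewrite ler_wpM2r ?powR_ge0// le_max lexx orbT.
  rewrite -mulrA -[leLHS]mulr1 ler_pM2l//.
  have [M1|M1] := leP 1 M.
    have i1 : M^-1 <= 1 by rewrite invf_le1.
    rewrite (max_idPl i1) mul1r; apply: (@le_trans _ _ (M `^ 0)); first by rewrite powRr0.
    exact: ler_powR.
  apply: (@le_trans _ _ (M^-1 * M `^ s)).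
    apply: (@le_trans _ _ (M^-1 * M `^ 1)).
      by rewrite powRr1 ?mulVf ?gt_eqF// ltW.
    rewrite ler_pM2l ?invr_gt0//; by apply: ger_powR => //; rewrite M0 ltW.
  by rewrite ler_wpM2r ?powR_ge0// le_max lexx orbT.
have step C2 : 1 <= C2 ->
    (forall s, 0 <= s <= 1 -> sand_bound (f s) (h s) (C2 * M `^ s)) ->
    (forall s, 0 <= s <= 1 -> sand_bound (f s) (h s) (Num.sqrt C2 * M `^ s)).
  move=> C21 B s /[dup] sI /andP[s0 s1].
  have C20 : 0 <= C2 := le_trans ler01 C21.
  have I0 : 0 <= (0 : R) <= 1 by rewrite lexx ler01.
  have I1 : 0 <= (1 : R) <= 1 by rewrite ler01 lexx.
  have [s2|s2] := leP s 2^-1.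
    have tI : 0 <= 2 * s <= 1 by lra.
    have es : (0 + 2 * s) / 2 = s by field.
    have -> : Num.sqrt C2 * M `^ s = Num.sqrt (1 * (C2 * M `^ (2 * s))).
      rewrite mul1r sqrtrM// mulrC (mulrC 2) powRrM powR_mulrn ?powR_ge0//.
      by rewrite sqrtr_sqr ger0_norm ?powR_ge0// mulrC.
    apply: (@sand_bound_mid _ (f 0) (f (2 * s)) _ (h 0) (h (2 * s))); try by [exact: bf|exact: bh|].
    - by move=> x; rewrite fM// es.
    - by move=> x; rewrite hM// es.
    - by rewrite mulr_ge0 ?powR_ge0.
    - exact: B.
  have tI : 0 <= 2 * s - 1 <= 1 by lra.
  have es : (1 + (2 * s - 1)) / 2 = s by field.
  have -> : Num.sqrt C2 * M `^ s = Num.sqrt (M * (C2 * M `^ (2 * s - 1))).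
    rewrite mulrCA -[X in C2 * (X * _)]powRr1 ?ltW// -powRD; last by rewrite (gt_eqF M0) implybT.
    rewrite addrC subrK sqrtrM// (mulrC 2) powRrM powR_mulrn ?powR_ge0//.
    by rewrite sqrtr_sqr ger0_norm ?powR_ge0.
  apply: (@sand_bound_mid _ (f 1) (f (2 * s - 1)) _ (h 1) (h (2 * s - 1))); try by [exact: bf|exact: bh|].
  - by move=> x; rewrite fM// es.
  - by move=> x; rewrite hM// es.
  - exact: ltW.
  - by rewrite mulr_ge0 ?powR_ge0.
  - exact: B.
have iter_step k : 1 <= iter k Num.sqrt C1 /\
    forall s, 0 <= s <= 1 -> sand_bound (f s) (h s) (iter k Num.sqrt C1 * M `^ s).
  elim: k => [//|k [IH1 IH2]]; split; last exact: step.
  by rewrite iterS -sqrtr1 ler_wsqrtr.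
(* Since sqrt z - 1 <= (z - 1) / 2, each square root at least halves the excess over 1. *)
have cvg1 k : iter k Num.sqrt C1 - 1 <= (C1 - 1) / 2 ^+ k.
  elim: k => [|k IH]; first by rewrite expr0 divr1.
  rewrite iterS exprS invfM mulrCA; set z := iter k _ _ in IH *.
  have [z1 _] := iter_step k; rewrite -/z in z1.
  apply: (@le_trans _ _ (2^-1 * (z - 1))); last by rewrite ler_pM2l// invr_gt0.
  have sz : Num.sqrt z ^+ 2 = z by rewrite sqr_sqrtr// (le_trans _ z1).
  have := sqr_ge0 (Num.sqrt z - 1); rewrite sqrrB1 sz; lra.
move=> s sI u bu; apply/ler_addgt0Pr => eps eps0.
(* This threshold for 2^-N makes the error (C1 - 1) 2^-N M^s |u|^2 less than eps; the added units
   keep the denominator positive. *)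
have d0 : 0 < eps / ((C1 + 1) * (M `^ s * nsq mu u + 1)).
  rewrite divr_gt0// mulr_gt0//; first by lra.
  by rewrite ltr_wpDl// mulr_ge0 ?powR_ge0 ?nsq_ge0.
have : ((2^-1 : R) ^+ k @[k --> \oo] --> (0:R))%classic.
  by apply: cvg_expr; rewrite ger0_norm; lra.
move=> /cvgrPdist_lt/(_ _ d0)[N _ /(_ N)]/(_ (leqnn N)) /=.
rewrite sub0r normrN ger0_norm ?exprn_ge0// => hN.
have [z1 Bz] := iter_step N; apply: (le_trans (Bz s sI u bu)).
have := cvg1 N; set z := iter N _ _ in z1 Bz * => zle.
set A := M `^ s * nsq mu u in hN *.
have A0 : 0 <= A by rewrite mulr_ge0 ?powR_ge0 ?nsq_ge0.
rewrite -mulrA -/A.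
have p0 : 0 < 2^-1 ^+ N :> R by rewrite exprn_gt0.
rewrite ltr_pdivlMr in hN; last by rewrite mulr_gt0//; lra.
rewrite -exprVn in zle.
set p := 2^-1 ^+ N in zle hN p0.
have : (z - 1) * A <= (C1 - 1) * p * A by rewrite ler_wpM2r.
have : (C1 - 1) * p * A <= p * ((C1 + 1) * (A + 1)).
  rewrite -mulrA mulrCA ler_pM2l//; nra.
lra.
Qed.

End sandwich.

(** * Lebesgue measure on R^n *)

Section cube.
Context {R : realType}.
Local Notation leb1 := (@lebesgue_measure R).

(** Unlike balls, cubes are products of intervals ([cube_cons]), which suits induction on the
    dimension. *)
Definition cube n (k : R) : set (n.-tuple R) :=
  [set x | forall i, `|tnth x i| <= k].

Local Arguments cube n k : clear implicits.

Lemma measurable_cube n k : measurable (@cube n k).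
Proof.
rewrite (_ : cube n k = \bigcap_(i in [set: 'I_n]) [set x | `|tnth x i| <= k]).
  apply: fin_bigcap_measurable => // i _.
  have mi : measurable_fun setT (fun x : n.-tuple R => `|tnth x i|).
    by apply: measurableT_comp => //; exact: measurable_tnth.
  rewrite (_ : [set x | _] = (fun x => `|tnth x i|) @^-1` `]-oo, k]).
    by rewrite -[X in measurable X]setTI; exact: mi.
  by apply/seteqP; split => x /=; rewrite in_itv.
by apply/seteqP; split => [x h i _|x h i]; exact: h.
Qed.

Lemma cons_pair_tnthS n (p : n.-tuple R * measurableTypeR R) (i : 'I_n) :
  tnth (cons_pair p) (lift ord0 i) = tnth p.1 i.
Proof. by rewrite /cons_pair (tnth_nth 0) /= -tnth_nth. Qed.

Lemma cons_pair_tnth0 n (p : n.-tuple R * measurableTypeR R) :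
  tnth (cons_pair p) ord0 = p.2.
Proof. by rewrite /cons_pair (tnth_nth 0). Qed.

Lemma cube_cons n k (x : n.-tuple R) (t : R) :
  cube n.+1 k (cons_pair (x, t)) <-> cube n k x /\ `|t| <= k.
Proof.
split=> [h|[h1 h2] i].
  split; last by have := h ord0; rewrite cons_pair_tnth0.
  by move=> i; have := h (lift ord0 i); rewrite cons_pair_tnthS.
by case: (unliftP ord0 i) => [j ->|->]; rewrite ?cons_pair_tnthS ?cons_pair_tnth0//; exact: h1.
Qed.

Lemma cube_bigcup n : \bigcup_k @cube n k%:R = setT.
Proof.
apply/seteqP; split => // x _.
pose M := \sum_(i < n) `|tnth x i|.
exists (Num.bound M) => // i; apply: (@le_trans _ _ M).
  by rewrite /M (bigD1 i)//= lerDl sumr_ge0.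
have M0 : 0 <= M by rewrite sumr_ge0.
by apply/ltW/archi_boundP.
Qed.

Lemma lebesgue_tuple_cube n (k : R) : (lebesgue_tuple R n (cube n k) < +oo)%E.
Proof.
elim: n => [|n IH]/=; first by rewrite /dirac/= ltry.
rewrite /lebesgue_cons/= /pushforward.
rewrite (_ : _ @^-1` _ = cube n k `*` `[- k, k]%classic); last first.
  apply/seteqP; split => -[x t]/=; rewrite in_itv/= -ler_norml.
    by move=> /cube_cons.
  by move=> h; exact/cube_cons.
have -> := @product_measure1E _ _ _ _ R (lebesgue_tuple R n) leb1 _ _ (@measurable_cube n k) (measurable_itv _).
apply: lte_mul_pinfty => //; first by rewrite ge0_fin_numE.
by rewrite /= lebesgue_measure_itv/=; case: ifP => _; rewrite ?ltry// -EFinN -EFinD ltry.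
Qed.

Lemma sigma_finite_lebesgue_tuple n : sigma_finite setT (lebesgue_tuple R n).
Proof.
exists (fun k => cube n k%:R); first by rewrite cube_bigcup.
by move=> k; split; [exact: measurable_cube|exact: lebesgue_tuple_cube].
Qed.

End cube.
Arguments cube {R} n k.

(** A constant that can carry the sigma-finite structure required by Tonelli and Fubini. *)
Definition leb (R : realType) n (A : set (n.-tuple R)) : \bar R := lebesgue_tuple R n A.
Arguments leb R n : clear implicits.

HB.instance Definition _ (R : realType) n :=
  isMeasure.Build _ _ _ (leb R n) (measure0 (lebesgue_tuple R n))
   (measure_ge0 (lebesgue_tuple R n)) (@measure_semi_sigma_additive _ _ _ (lebesgue_tuple R n)).

HB.instance Definition _ (R : realType) n :=
  Measure_isSigmaFinite.Build _ _ _ (leb R n) (@sigma_finite_lebesgue_tuple R n).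

Section leb_integral.
Context {R : realType}.
Local Notation leb1 := (@lebesgue_measure R).

Lemma integral_lebE n (D : set (n.-tuple R)) (f : n.-tuple R -> \bar R) :
  (\int[lebesgue_tuple R n]_(x in D) f x = \int[leb R n]_(x in D) f x)%E.
Proof. by apply: eq_measure_integral. Qed.

Lemma cmeas_cons n (f : n.+1.-tuple R -> R[i]) : cmeas f -> cmeas (f \o @cons_pair R n).
Proof. by move=> mf; apply: (cmeas_comp mf); exact: measurable_cons_pair. Qed.

Lemma ge0_integral_leb_cons n (f : n.+1.-tuple R -> \bar R) :
  measurable_fun setT f -> (forall x, 0 <= f x)%E ->
  (\int[leb R n.+1]_x f x =
   \int[leb R n]_x \int[leb1]_t f (cons_pair (x, t)))%E.
Proof.
move=> mf f0; rewrite -integral_lebE /= /lebesgue_cons.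
rewrite (@ge0_integral_pushforward _ _ _ _ _ _ (@measurable_cons_pair R n) (product_measure1 (lebesgue_tuple R n) leb1) setT)//.
rewrite preimage_setT.
exact: (@fubini_tonelli1 _ _ _ _ _ (leb R n) leb1 (f \o (@cons_pair R n))
  (measurableT_comp mf (@measurable_cons_pair R n)) (fun z => f0 _)).
Qed.

Lemma ge0_integral_leb_consC n (f : n.+1.-tuple R -> \bar R) :
  measurable_fun setT f -> (forall x, 0 <= f x)%E ->
  (\int[leb R n.+1]_x f x =
   \int[leb1]_t \int[leb R n]_x f (cons_pair (x, t)))%E.
Proof.
move=> mf f0; rewrite ge0_integral_leb_cons//.
exact: (@fubini_tonelli _ _ _ _ _ (leb R n) leb1 (f \o (@cons_pair R n))
  (measurableT_comp mf (@measurable_cons_pair R n)) (fun z => f0 _)).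
Qed.

Lemma cint_leb_cons n (f : n.+1.-tuple R -> R[i]) : csummable (leb R n.+1) f ->
  cint (leb R n.+1) f =
  cint (leb R n) (fun x => cint leb1 (fun t => f (cons_pair (x, t)))).
Proof.
move=> sf; have mf := csummable_meas sf.
have push (h : n.+1.-tuple R -> R) : (leb R n.+1).-integrable setT (EFin \o h) ->
   \int[leb R n.+1]_x h x = \int[(leb R n \x leb1)%E]_z h (cons_pair z) /\
   (leb R n \x leb1)%E.-integrable setT (EFin \o (h \o @cons_pair R n)).
  move=> ih; have mh := measurable_int _ ih.
  have mhc : measurable_fun setT ((EFin \o h) \o @cons_pair R n).
    exact: (measurableT_comp mh (@measurable_cons_pair R n)).
  have ihc : (leb R n \x leb1)%E.-integrable setT ((EFin \o h) \o @cons_pair R n).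
    apply/(integrable12ltyP (leb R n) leb1 mhc).
    by have /integrableP[_] := ih; rewrite ge0_integral_leb_cons//; exact: measurableT_comp.
  split; last exact: ihc.
  rewrite /Rintegral -integral_lebE; congr fine.
  exact: (@integral_pushforward _ _ _ _ _ _ (@measurable_cons_pair R n)
    (product_measure1 (leb R n) leb1) setT (EFin \o h)).
have sfc : csummable (leb R n \x leb1)%E (f \o @cons_pair R n).
  by case: sf => s1 s2; split; [exact: (push _ s1).2|exact: (push _ s2).2].
rewrite -(cint_prod1 sfc).
by case: sf => s1 s2; apply: eqcP; [exact: (push _ s1).1|exact: (push _ s2).1].
Qed.

End leb_integral.

Section affine_change.
Context {R : realType}.
Local Notation leb1 := (@lebesgue_measure R).

Local Notation push1 phi mphi :=
  (measure_function_pushforward__canonical__measure_function_Measure leb1 (f := phi : measurableTypeR R -> measurableTypeR R) mphi).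

(** The image of Lebesgue measure under the translation agrees with it on half-open intervals, hence
    everywhere. *)
Lemma ge0_integral_shift (f : R -> \bar R) (b : R) :
  measurable_fun setT f -> (forall x, 0 <= f x)%E ->
  (\int[leb1]_x f (x + b)%R = \int[leb1]_x f x)%E.
Proof.
move=> mf f0.
have mphi : measurable_fun setT (fun x : measurableTypeR R => (x + b)%R : measurableTypeR R).
  exact: measurable_funD.
have E : forall A, measurable A -> leb1 A = push1 (fun x => x + b) mphi A.
  apply: lebesgue_measure_unique => _ [[a c]] _ <- /=; rewrite /pushforward.
  rewrite (_ : _ @^-1` _ = `]a - b, c - b]%classic).
    rewrite !lebesgue_measure_itv/= !lte_fin ltrD2r.
    by case: ifP => // _; rewrite -!EFinD; congr _%:E; ring.
  by apply/seteqP; split => x/=; rewrite !in_itv/= ltrBlDr lerBrDr.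
rewrite [RHS](eq_measure_integral (push1 (fun x => x + b) mphi)); last by move=> A mA _; exact: E.
by rewrite (@ge0_integral_pushforward _ _ _ _ _ _ mphi leb1 setT).
Qed.

Lemma ge0_integral_scale (f : R -> \bar R) (a : R) : 0 < a ->
  measurable_fun setT f -> (forall x, 0 <= f x)%E ->
  (a%:E * \int[leb1]_x f (a * x)%R = \int[leb1]_x f x)%E.
Proof.
move=> a0 mf f0.
have mphi : measurable_fun setT (fun x : measurableTypeR R => (a * x)%R : measurableTypeR R).
  exact: measurable_funM.
have a0' : 0 <= a := ltW a0.
pose an : {nonneg R} := NngNum a0'.
have E : forall A, measurable A -> leb1 A = mscale an (push1 (fun x => a * x) mphi) A.
  apply: lebesgue_measure_unique => _ [[c e]] _ <- /=; rewrite /mscale/= /pushforward.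
  rewrite (_ : _ @^-1` _ = `]c / a, e / a]%classic).
    rewrite !lebesgue_measure_itv/= !lte_fin ltr_pM2r ?invr_gt0//.
    case: ifP => // _; last by rewrite mule0.
    by rewrite -!EFinD -EFinM; congr _%:E; field; rewrite gt_eqF.
  by apply/seteqP; split => x/=; rewrite !in_itv/= ltr_pdivrMr// ler_pdivlMr// mulrC.
rewrite [RHS](eq_measure_integral (mscale an (push1 (fun x => a * x) mphi))); last by move=> A mA _; exact: E.
rewrite ge0_integral_mscale//=.
by rewrite (@ge0_integral_pushforward _ _ _ _ _ _ mphi leb1 setT).
Qed.

Lemma ge0_integral_opp (f : R -> \bar R) :
  measurable_fun setT f -> (forall x, 0 <= f x)%E ->
  (\int[leb1]_x f (- x)%R = \int[leb1]_x f x)%E.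
Proof.
move=> mf f0.
have mphi : measurable_fun setT (fun x : measurableTypeR R => (- x)%R : measurableTypeR R).
  exact: measurable_funN.
rewrite [RHS](eq_measure_integral (push1 (fun x => - x) mphi)); last first.
  by move=> A mA _; exact/esym/lebesgue_measureN.
by rewrite (@ge0_integral_pushforward _ _ _ _ _ _ mphi leb1 setT).
Qed.

Lemma Rintegral_opp (f : R -> R) : measurable_fun setT f ->
  \int[leb1]_x f (- x) = \int[leb1]_x f x.
Proof.
move=> mf; rewrite /Rintegral; congr fine; rewrite [LHS]integralE [RHS]integralE.
congr (_ - _)%E.
  rewrite -[RHS]ge0_integral_opp//; first by apply: eq_integral => x _; rewrite !funeposE.
  by apply: measurable_funepos; exact/measurable_EFinP.
rewrite -[RHS]ge0_integral_opp//; first by apply: eq_integral => x _; rewrite !funenegE.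
by apply: measurable_funeneg; exact/measurable_EFinP.
Qed.

End affine_change.

Lemma cvge0P (R : realType) (a : nat -> \bar R) : (forall k, 0 <= a k)%E ->
  (a @ \oo --> 0%E)%classic <->
  (forall eps : R, 0 < eps -> \forall k \near \oo, (a k <= eps%:E)%E).
Proof.
move=> a0; split.
  move=> /fine_cvgP[fa /cvgrPdist_le ca] eps eps0; near=> k.
  have fk : a k \is a fin_num by near: k.
  rewrite -(fineK fk) lee_fin; apply: (le_trans (ler_norm _)).
  by rewrite -normrN -sub0r; near: k; exact: ca.
move=> H; apply/fine_cvgP; split.
  near=> k; rewrite ge0_fin_numE//; apply: le_lt_trans (ltry 1).
  by near: k; exact: H.
apply/cvgrPdist_le => eps eps0; near=> k.
rewrite sub0r normrN ger0_norm ?fine_ge0//.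
have h : (a k <= eps%:E)%E by near: k; exact: H.
by rewrite -lee_fin fineK// ge0_fin_numE//; apply: le_lt_trans h (ltry _).
Unshelve. all: by end_near. Qed.

(** * Plancherel's theorem *)

Section translation_continuity.
Context {R : realType}.
Local Notation leb1 := (@lebesgue_measure R).

Definition translate_dist (f : R -> R) (z : R) : \bar R :=
  (\int[leb1]_x (`|f (x - z) - f x|)%:E)%E.

Lemma measurable_translate (f : R -> R) (z : R) : measurable_fun setT f ->
  measurable_fun setT (fun x : R => f (x - z)).
Proof. by move=> mf; apply: (measurableT_comp mf); exact: measurable_funB. Qed.

(* By density of the continuous functions in L^1. *)
Lemma cvg_translate_dist (f : R -> R) (k M : R) (z : nat -> R) :
  measurable_fun setT f -> 0 <= k -> (forall x, `|f x| <= M) ->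
  (forall x, k < `|x| -> f x = 0) -> (forall j, `|z j| <= 1) ->
  (z j @[j --> \oo] --> 0)%classic ->
  (translate_dist f (z j) @[j --> \oo] --> 0)%E%classic.
Proof.
move=> mf k0 fM f0 z1 zcvg.
(* Three intervals: [f] lives on [-k, k], [J] contains the supports of [f] and of its translates by
   at most 1, and [E] still contains x - z j for x in [J]. *)
have [E EE] : {E | E = `[- (k + 2), k + 2]%classic} by exists `[- (k + 2), k + 2]%classic.
have mE : measurable E by rewrite EE; exact: measurable_itv.
have fE : (leb1 E < +oo)%E.
  by rewrite EE /= lebesgue_measure_itv/=; case: ifP => _; rewrite ?ltry// -EFinN -EFinD ltry.
pose J := `[- (k + 1), k + 1]%classic.
have mJ : measurable J by exact: measurable_itv.
have JE : J `<=` E by rewrite EE => x; rewrite /J/= !in_itv/=; lra.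
have fJ : (leb1 J < +oo)%E by apply: le_lt_trans fE; apply: le_measure => //; rewrite inE.
have bint (D : set R) (h : R -> R) (N : R) : measurable D -> (leb1 D < +oo)%E ->
    measurable_fun D h -> (forall x, D x -> `|h x| <= N) -> leb1.-integrable D (EFin \o h).
  move=> mD fD mh hN; apply: measurable_bounded_integrable => //.
  by exists N; split; [exact: num_real|move=> y Ny x Dx; apply: le_trans (hN x Dx) (ltW Ny)].
have intf : leb1.-integrable E (EFin \o f).
  by apply: (bint _ _ M) => //; exact: measurable_funTS.
have [g_ [cg ig gcvg]] := approximation_continuous_integrable mE fE intf.
apply/cvge0P => [j|eps eps0]; first by apply: integral_ge0 => x _; rewrite lee_fin.
have eps30 : 0 < eps / 3 by rewrite divr_gt0.
have [N fg] : exists N, (\int[leb1]_(x in E) `|(f x - g_ N x)%:E| <= (eps / 3)%:E)%E.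
  have H j : (0 <= \int[leb1]_(z in E) `|(f z - g_ j z)%:E|)%E by exact: integral_ge0.
  by have [N _ /(_ N (leqnn N)) h] := (cvge0P H).1 gcvg _ eps30; exists N.
set g := g_ N in fg; have {cg}cg : continuous g := cg N.
have mg : measurable_fun setT g by exact: continuous_measurable_fun.
have mfg : measurable_fun setT (fun x => `|f x - g x|).
  by apply: measurableT_comp => //; exact: measurable_funB.
pose phi (x : R) : R := `|f x - g x| * \1_E x.
have mphi : measurable_fun setT phi.
  by apply: measurable_funM => //; exact: measurable_indic.
have phi0 x : 0 <= phi x by rewrite mulr_ge0.
have intphi : (\int[leb1]_x (phi x)%:E <= (eps / 3)%:E)%E.
  apply: le_trans fg; rewrite [leRHS]integral_mkcond le_eqVlt; apply/orP; left; apply/eqP.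
  apply: eq_integral => x _; rewrite patchE /phi indicE.
  by case: (x \in _); [rewrite mulr1|rewrite mulr0].
have [B gB] : exists B, forall x, E x -> `|g x| <= B.
  have cE : compact E by rewrite EE; exact: segment_compact.
  have /compact_bounded[B [_ HB]] := continuous_compact (continuous_subspaceT cg) cE.
  by exists (B + 1) => x Ex; apply: (HB (B + 1)); [rewrite ltrDl|exists x].
have xzE (x : R) j : J x -> E (x - z j).
  have := z1 j; rewrite EE /J/= !in_itv/= ler_norml; lra.
have mgz j : measurable_fun setT (fun x : R => `|g (x - z j) - g x|).
  by apply: measurableT_comp => //; apply: measurable_funB => //; exact: measurable_translate.
have gcv : (\int[leb1]_(x in J) (`|g (x - z j) - g x|)%:E @[j --> \oo] --> 0)%E%classic.
  have := @dominated_convergence _ _ _ leb1 J mJ (fun j x => (`|g (x - z j) - g x|)%:E)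
     (cst 0%E) (cst (2 * B)%:E).
  rewrite integral0 => H; apply H.
  - by move=> j; apply/measurable_EFinP; exact: (measurable_funTS (mgz j)).
  - exact: measurable_cst.
  - apply/aeW => x Jx; apply: cvg_EFin; first exact: nearW.
    rewrite [X in _ --> X](_ : _ = `|g x - g x|); last by rewrite subrr normr0.
    apply: cvg_norm; apply: cvgB; last exact: cvg_cst.
    apply: continuous_cvg; first exact: cg.
    rewrite -[X in _ --> X]subr0; apply: cvgB => //; exact: cvg_cst.
  - apply: (bint _ (cst (2 * B)) `|2 * B|) => //; exact: measurable_cst.
  - apply/aeW => x j Jx; rewrite /= lee_fin normr_id.
    apply: (le_trans (ler_normB _ _)); have := gB _ (xzE x j Jx); have := gB _ (JE _ Jx); lra.
have gz0 j : (0 <= \int[leb1]_(x in J) (`|g (x - z j) - g x|)%:E)%E.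
  by apply: integral_ge0 => x _; rewrite lee_fin.
have {}gcv := (cvge0P gz0).1 gcv _ eps30.
have [N2 _ HN2] := gcv; exists N2 => // j jN2.
(* The three terms, each of integral at most eps / 3, are the translated approximation error, the
   variation of [g] on [J], and the approximation error itself. *)
pose psi (x : R) : R := phi (x - z j) + `|g (x - z j) - g x| * \1_J x + phi x.
apply: (@le_trans _ _ (\int[leb1]_x (psi x)%:E)%E).
  apply: ge0_le_integral => //.
  - apply/measurable_EFinP; apply: measurableT_comp => //; apply: measurable_funB => //; exact: measurable_translate.
  - apply/measurable_EFinP; apply: measurable_funD => //; apply: measurable_funD.
      exact: measurable_translate.
    by apply: measurable_funM; [exact: mgz|exact: measurable_indic].
  - move=> x _; rewrite lee_fin /psi.
    have [Jx|Jx] := pselect (J x).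
      rewrite /phi !indicE !mem_set//; [|exact: JE|exact: xzE].
      rewrite !mulr1.
      have -> : f (x - z j) - f x = (f (x - z j) - g (x - z j)) + (g (x - z j) - g x) + (g x - f x) by ring.
      apply: (le_trans (ler_normD _ _)); rewrite (distrC (g x)) lerD2r; exact: ler_normD.
    have kx : k + 1 < `|x|.
      rewrite ltNge ler_norml; apply/negP => h; apply: Jx; rewrite /J/= in_itv/=; exact: h.
    rewrite !f0; first by rewrite subrr normr0 addr_ge0// addr_ge0// mulr_ge0.
      lra.
    have := z1 j; have := lerB_dist x (z j); lra.
rewrite /psi; under eq_integral do rewrite !EFinD.
rewrite ge0_integralD//; last 4 first.
- by move=> x _; rewrite adde_ge0// lee_fin// mulr_ge0.
- apply: emeasurable_funD; apply/measurable_EFinP; first exact: measurable_translate.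
  by apply: measurable_funM; [exact: mgz|exact: measurable_indic].
- by move=> x _; rewrite lee_fin.
- exact/measurable_EFinP.
rewrite ge0_integralD//; last 3 first.
- by move=> x _; rewrite lee_fin.
- by apply/measurable_EFinP; exact: measurable_translate.
- by apply/measurable_EFinP; apply: measurable_funM; [exact: mgz|exact: measurable_indic].
have -> : (eps%:E = (eps / 3)%:E + (eps / 3)%:E + (eps / 3)%:E)%E.
  by rewrite -!EFinD; congr _%:E; field.
apply: leeD => //; apply: leeD; last first.
  apply: (@le_trans _ _ (\int[leb1]_(x in J) (`|g (x - z j) - g x|)%:E)%E); last exact: HN2.
  rewrite [leRHS]integral_mkcond le_eqVlt; apply/orP; left; apply/eqP.
  apply: eq_integral => x _; rewrite patchE indicE.
  by case: (x \in _); [rewrite mulr1|rewrite mulr0].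
rewrite (@ge0_integral_shift _ (EFin \o phi) (- z j))//; last exact/measurable_EFinP.
Qed.

End translation_continuity.

(** * The Poisson kernel on the line *)

Section poisson_kernel.
Context {R : realType}.
Local Notation leb1 := (@lebesgue_measure R).

(** Abel summation weight: it regularises the inversion integral, has the explicit Poisson kernel as
    transform, and increases to 1 as ep decreases to 0. *)
Definition pweight (ep xi : R) : R := expR (- (ep * `|xi|)).

(** A primitive of exp(-ep x) (1 + cos(z x)) that vanishes at infinity. The summand 1 makes the
    integrand nonnegative, as the form of the fundamental theorem used on the half-line demands;
    [Rintegral_pweight_cos] subtracts it again. *)
Definition poisson_prim (ep z x : R) : R :=
  expR (- ep * x) * (- ep^-1 + (ep ^+ 2 + z ^+ 2)^-1 * (z * sin (z * x) - ep * cos (z * x))).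

Lemma is_derive_poisson_prim ep z (x : R) : 0 < ep ->
  is_derive x 1 (poisson_prim ep z) (expR (- ep * x) * (1 + cos (z * x))).
Proof.
move=> ep0; rewrite /poisson_prim.
have D0 : ep ^+ 2 + z ^+ 2 != 0 by rewrite gt_eqF// ltr_wpDr ?sqr_ge0 ?exprn_gt0.
have d1 (a : R) : is_derive x 1 (fun y : R => a * y) a.
  by apply: is_derive_eq; rewrite /GRing.scale/= ?mulr1 ?mulr0 ?addr0 ?add0r.
have dexp : is_derive x 1 (fun y : R => expR (- ep * y)) (expR (- ep * x) * (- ep)).
  have := @is_derive1_comp R expR (fun y => - ep * y) x _ _ (is_derive_expR _) (d1 (- ep)).
  by move=> h; exact: h.
have dsin : is_derive x 1 (fun y : R => sin (z * y)) (cos (z * x) * z).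
  exact: (@is_derive1_comp R sin (fun y => z * y) x _ _ (is_derive_sin _) (d1 z)).
have dcos : is_derive x 1 (fun y : R => cos (z * y)) (- sin (z * x) * z).
  exact: (@is_derive1_comp R cos (fun y => z * y) x _ _ (is_derive_cos _) (d1 z)).
apply: is_derive_eq.
rewrite /GRing.scale/=; field.
by rewrite D0 gt_eqF.
Qed.

Lemma cvg_poisson_prim (ep z : R) : 0 < ep ->
  (poisson_prim ep z x @[x --> +oo%R] --> 0)%classic.
Proof.
move=> ep0; pose C := ep^-1 + (ep ^+ 2 + z ^+ 2)^-1 * (`|z| + ep).
have D0 : 0 < ep ^+ 2 + z ^+ 2 by rewrite ltr_wpDr ?sqr_ge0 ?exprn_gt0.
have cexp : (expR (- ep * x) @[x --> +oo%R] --> (0 : R))%classic.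
  rewrite (_ : (fun _ => _) = (fun x : R => expR (- x)) \o (fun x => ep * x)).
    apply: cvg_comp; last exact: cvgr_expR.
    by apply: gt0_cvgMry => //; exact: cvg_id.
  by apply/funext => x /=; rewrite mulNr.
have cC : (expR (- ep * x) * C @[x --> +oo%R] --> (0 : R))%classic.
  by rewrite -[X in _ --> X](mul0r C); apply: cvgM; [exact: cexp|exact: cvg_cst].
apply/cvgrPdist_le => eps eps0.
move/cvgrPdist_le : cC => /(_ _ eps0); apply: filterS => x.
rewrite !sub0r !normrN; apply: le_trans.
rewrite /poisson_prim !normrM ler_wpM2l// /C.
have i0 : 0 <= ep^-1 by rewrite invr_ge0 ltW.
have Di0 : 0 <= (ep ^+ 2 + z ^+ 2)^-1 by rewrite invr_ge0 ltW.
have ze0 : 0 <= `|z| + ep by rewrite addr_ge0// ltW.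
rewrite [leRHS]ger0_norm; last by rewrite addr_ge0// mulr_ge0.
apply: (le_trans (ler_normD _ _)); rewrite normrN (ger0_norm i0).
rewrite lerD2l normrM (ger0_norm Di0) ler_wpM2l//.
apply: (le_trans (ler_normB _ _)); rewrite !normrM lerD//.
  by rewrite ler_piMr// ler_norml sin_geN1 sin_le1.
by rewrite (ger0_norm (ltW ep0)) ler_piMr//; [exact: ltW|rewrite ler_norml cos_geN1 cos_le1].
Qed.

Lemma integral_poisson_half (ep z : R) : 0 < ep ->
  (\int[leb1]_(x in `[0%R, +oo[) (expR (- ep * x) * (1 + cos (z * x)))%:E =
   (ep^-1 + ep / (ep ^+ 2 + z ^+ 2))%:E)%E.
Proof.
move=> ep0; have dP x := @is_derive_poisson_prim ep z x ep0.
have cf : continuous (fun x : R => expR (- ep * x) * (1 + cos (z * x))).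
  move=> x; apply: cvgM.
    by apply: continuous_comp; [exact: mulrl_continuous|exact: continuous_expR].
  by apply: cvgD; [exact: cvg_cst|apply: continuous_comp; [exact: mulrl_continuous|exact: continuous_cos]].
rewrite (@ge0_continuous_FTC2y R _ (poisson_prim ep z) 0 0).
- rewrite /poisson_prim !mulr0 expR0 mul1r sin0 cos0 mulr0 mulr1 sub0r sub0e -EFinN.
  by congr _%:E; rewrite opprD opprK mulrN opprK mulrC.
- move=> x _; rewrite mulr_ge0// ?expR_ge0//; have := cos_geN1 (z * x); lra.
- exact: continuous_subspaceT.
- exact: cvg_poisson_prim.
- by move=> x _; have [] := dP x.
- by apply: cvg_at_right_filter; apply: differentiable_continuous; apply/derivable1_diffP; have [] := dP 0.
- by move=> x _; rewrite derive1E; have [] := dP x.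
Qed.

Lemma continuous_pweight ep : continuous (pweight ep).
Proof.
move=> x; apply: continuous_comp; last exact: continuous_expR.
apply: cvgN; apply: cvgM; first exact: cvg_cst.
exact: norm_continuous.
Qed.

Lemma pweight_ge0 ep x : 0 <= pweight ep x. Proof. exact: expR_ge0. Qed.

Lemma integral_poisson (ep z : R) : 0 < ep ->
  (\int[leb1]_x (pweight ep x * (1 + cos (z * x)))%:E =
   (2 * (ep^-1 + ep / (ep ^+ 2 + z ^+ 2)))%:E)%E.
Proof.
move=> ep0; rewrite ge0_symfun_integralT.
- rewrite EFinM -integral_poisson_half// -set_itvcy; congr (_ * _)%E.
  apply: eq_integral => x; rewrite inE/= in_itv/= andbT => x0.
  by rewrite /pweight ger0_norm// mulNr.
- move=> x; rewrite mulr_ge0// ?expR_ge0//; have := cos_geN1 (z * x); lra.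
- move=> x; apply: cvgM; first exact: continuous_pweight.
  by apply: cvgD; [exact: cvg_cst|apply: continuous_comp; [exact: mulrl_continuous|exact: continuous_cos]].
- by move=> x /=; rewrite /pweight normrN mulrN cosN.
Qed.

Lemma integrable_poisson (ep z : R) : 0 < ep ->
  leb1.-integrable setT (EFin \o (fun x => pweight ep x * (1 + cos (z * x)))).
Proof.
move=> ep0; apply/integrableP; split.
  apply/measurable_EFinP; apply: continuous_measurable_fun => x.
  apply: cvgM; first exact: continuous_pweight.
  by apply: cvgD; [exact: cvg_cst|apply: continuous_comp; [exact: mulrl_continuous|exact: continuous_cos]].
have E x : `|(pweight ep x * (1 + cos (z * x)))%:E|%E = (pweight ep x * (1 + cos (z * x)))%:E.
  by rewrite /= ger0_norm// mulr_ge0 ?expR_ge0.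
under eq_integral do rewrite E.
by rewrite integral_poisson// ltry.
Qed.

Lemma integrable_pweight (ep : R) : 0 < ep -> leb1.-integrable setT (EFin \o pweight ep).
Proof.
move=> ep0; apply: (@le_integrable _ _ _ leb1 setT measurableT _ _ _ _ (integrable_poisson 0 ep0)).
  by apply/measurable_EFinP; apply: continuous_measurable_fun; exact: continuous_pweight.
move=> x _ /=; rewrite lee_fin mul0r cos0 !ger0_norm ?pweight_ge0 ?mulr_ge0 ?pweight_ge0//.
by rewrite ler_peMr ?pweight_ge0//; lra.
Qed.

Lemma Rintegral_pweight (ep : R) : 0 < ep -> \int[leb1]_x pweight ep x = 2 / ep.
Proof.
move=> ep0; have := integral_poisson 0 ep0.
have -> : (\int[leb1]_x (pweight ep x * (1 + cos (0 * x)))%:E =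
   \int[leb1]_x (2%:E * (pweight ep x)%:E))%E.
  by apply: eq_integral => x _; rewrite mul0r cos0 -EFinM mulrC.
rewrite integralZl//; last exact: integrable_pweight.
have fp := integrable_fin_num measurableT (integrable_pweight ep0).
rewrite -(fineK fp) -EFinM => -[] h; rewrite /Rintegral.
have : 2 * fine (\int[leb1]_x (pweight ep x)%:E)%E = 2 * (2 / ep).
  rewrite h expr0n addr0; field; by rewrite gt_eqF.
by move/(mulfI _) => ->.
Qed.

Lemma Rintegral_pweight_cos (ep z : R) : 0 < ep ->
  \int[leb1]_x (pweight ep x * cos (z * x)) = 2 * ep / (ep ^+ 2 + z ^+ 2).
Proof.
move=> ep0; rewrite (@eq_Rintegral _ _ _ leb1 _ (fun x => pweight ep x * (1 + cos (z * x)) - pweight ep x)); last first.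
  by move=> x _; ring.
rewrite RintegralB//; [|exact: integrable_poisson|exact: integrable_pweight].
rewrite Rintegral_pweight// {1}/Rintegral integral_poisson//=.
have e0 : ep != 0 by rewrite gt_eqF.
have D0 : ep ^+ 2 + z ^+ 2 != 0 by rewrite gt_eqF// ltr_wpDr ?sqr_ge0 ?exprn_gt0.
by field; rewrite ?e0 ?D0.
Qed.

Lemma Rintegral_pweight_sin (ep z : R) : 0 < ep ->
  \int[leb1]_x (pweight ep x * sin (z * x)) = 0.
Proof.
move=> ep0; have ms : measurable_fun setT (fun x : R => pweight ep x * sin (z * x)).
  apply: continuous_measurable_fun => x.
  apply: cvgM; first exact: continuous_pweight.
  by apply: continuous_comp; [exact: mulrl_continuous|exact: continuous_sin].
have := Rintegral_opp ms.
rewrite (@eq_Rintegral _ _ _ leb1 _ (fun x => - (pweight ep x * sin (z * x)))); last first.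
  by move=> x _; rewrite /pweight normrN mulrN sinN mulrN.
under eq_Rintegral do rewrite -mulN1r.
rewrite RintegralZl//; first lra.
apply: (@le_integrable _ _ _ leb1 setT measurableT _ _ _ _ (integrable_pweight ep0)).
  exact/measurable_EFinP.
move=> x _ /=; rewrite lee_fin normrM ler_piMr//.
by rewrite ler_norml sin_geN1 sin_le1.
Qed.

End poisson_kernel.

Section expi.
Context {R : realType}.

Lemma expiD (s t : R) : expi (s + t) = expi s * expi t.
Proof. by apply: eqcP; rewrite ?RecM ?ImcM /expi/= ?cosD ?sinD//; ring. Qed.

Lemma expi0 : expi (0 : R) = 1.
Proof. by rewrite /expi cos0 sin0. Qed.

Lemma conjc_expi (t : R) : conjc (expi t) = expi (- t).
Proof. by rewrite /expi cosN sinN. Qed.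

Lemma cabs_expi (t : R) : cabs (expi t) = 1.
Proof. by rewrite /expi /= cos2Dsin2 sqrtr1. Qed.

Lemma cmeas_expi d (T : measurableType d) (f : T -> R) :
  measurable_fun setT f -> cmeas (fun x => expi (f x)).
Proof.
move=> mf; split; rewrite /expi/=.
  apply: (measurableT_comp _ mf); apply: continuous_measurable_fun; exact: continuous_cos.
apply: (measurableT_comp _ mf); apply: continuous_measurable_fun; exact: continuous_sin.
Qed.

End expi.

Section plancherel1.
Context {R : realType}.
Local Notation leb1 := (@lebesgue_measure R).

(** The factor in [fourier_trunc], for which the transform is unitary. *)
Definition fnorm n : R := (2 * pi) `^ (- (n%:R / 2)).

Lemma pi2_gt0 : 0 < 2 * pi :> R. Proof. by rewrite mulr_gt0// pi_gt0. Qed.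

Lemma fnorm_gt0 n : 0 < fnorm n.
Proof. by rewrite powR_gt0// pi2_gt0. Qed.

Lemma fnormS n : fnorm n.+1 = fnorm 1 * fnorm n.
Proof.
rewrite /fnorm -powRD; last by rewrite (gt_eqF pi2_gt0) implybT.
by congr (_ `^ _); rewrite -natr1; field.
Qed.

Lemma fnorm_sqr : fnorm 1 * fnorm 1 = (2 * pi)^-1.
Proof.
rewrite /fnorm -powRD; last by rewrite (gt_eqF pi2_gt0) implybT.
rewrite (_ : _ + _ = -1); last by field.
by rewrite powR_inv1// ltW// pi2_gt0.
Qed.

Definition fker1 (z : measurableTypeR R * measurableTypeR R) : R[i] :=
  (fnorm 1)%:C * expi (- (z.1 * z.2)).

Lemma cmeas_fker1 : cmeas fker1.
Proof.
apply: cmeasM; first exact: cmeas_cst.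
apply: cmeas_expi; apply: measurableT_comp => //; apply: measurable_funM => //.
Qed.

Lemma cabs_fker1 z : cabs (fker1 z) <= fnorm 1.
Proof. by rewrite cabsM cabs_expi mulr1 cabs_real ger0_norm// ltW// fnorm_gt0. Qed.

(** The Poisson kernel: (2 pi)^-1 times the Fourier integral of [pweight ep], of total mass 1. *)
Definition pkern (ep z : R) : R := pi^-1 * (ep / (ep ^+ 2 + z ^+ 2)).

Lemma pkern_ge0 ep z : 0 <= ep -> 0 <= pkern ep z.
Proof. by move=> e0; rewrite mulr_ge0 ?invr_ge0 ?pi_ge0// divr_ge0// addr_ge0 ?sqr_ge0. Qed.

Lemma measurable_pkern ep : 0 < ep -> measurable_fun setT (pkern ep).
Proof.
move=> e0; apply: continuous_measurable_fun => z; apply: cvgM; first exact: cvg_cst.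
apply: cvgM; first exact: cvg_cst.
apply: cvgV; first by rewrite gt_eqF// ltr_wpDr ?sqr_ge0 ?exprn_gt0.
by apply: cvgD; [exact: cvg_cst|exact: exprn_continuous].
Qed.

Lemma pkern_scale ep t : 0 < ep -> ep * pkern ep (ep * t) = pkern 1 t.
Proof.
move=> e0; rewrite /pkern.
have D0 : 1 + t ^+ 2 != 0 by rewrite gt_eqF// ltr_wpDr ?sqr_ge0.
have -> : ep ^+ 2 + (ep * t) ^+ 2 = ep ^+ 2 * (1 + t ^+ 2) by ring.
rewrite expr1n mulrCA; congr (_ * _); field.
by rewrite D0 gt_eqF.
Qed.

Lemma integral_pkern1 : (\int[leb1]_t (pkern 1 t)%:E = 1)%E.
Proof.
rewrite ge0_symfun_integralT.
- rewrite -set_itvcy.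
  have -> : (\int[leb1]_(x in `[0%R, +oo[) (pkern 1 x)%:E =
      \int[leb1]_(x in `[0%R, +oo[) ((pi^-1)%:E * (oneDsqr x)^-1%:E))%E.
    by apply: eq_integral => x _; rewrite -EFinM /pkern /oneDsqr expr1n mul1r.
  rewrite ge0_integralZl//.
  + rewrite integral0y_oneDsqr -!EFinM; congr _%:E.
    by rewrite mulrCA (mulrC 2) divfK// mulVf// gt_eqF// pi_gt0.
  + apply/measurable_EFinP; apply: measurable_funTS; apply: continuous_measurable_fun.
    by move=> x; exact: continuous_oneDsqrV.
  + by rewrite lee_fin invr_ge0 pi_ge0.
- by move=> x; exact: pkern_ge0.
- move=> z; apply: cvgM; first exact: cvg_cst.
  apply: cvgM; first exact: cvg_cst.
  apply: cvgV; first by rewrite gt_eqF// ltr_wpDr ?sqr_ge0.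
  by apply: cvgD; [exact: cvg_cst|exact: exprn_continuous].
- by move=> x /=; rewrite /pkern sqrrN.
Qed.

(** The substitution y = x - ep t, as a translation, a reflection and a dilation; it moves the
    dependence on ep from the kernel to [h]. *)
Lemma pkern_subst (h : R -> R) (ep x : R) : 0 < ep -> measurable_fun setT h ->
  (forall y, 0 <= h y) ->
  (\int[leb1]_y (h y * pkern ep (x - y))%:E =
   \int[leb1]_t (h (x - ep * t) * pkern 1 t)%:E)%E.
Proof.
move=> e0 mh h0.
have mP : measurable_fun setT (fun y : R => h y * pkern ep (x - y)).
  apply: measurable_funM => //; apply: (measurableT_comp (measurable_pkern e0)).
  exact: measurable_funB.
have P0 y : 0 <= h y * pkern ep (x - y) by rewrite mulr_ge0// pkern_ge0// ltW.
rewrite -(@ge0_integral_shift _ (fun y => (h y * pkern ep (x - y))%:E) x)//; last exact/measurable_EFinP.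
rewrite -(@ge0_integral_opp _ (fun y => (h (y + x) * pkern ep (x - (y + x)))%:E)); last 2 first.
- apply/measurable_EFinP.
  have ma : measurable_fun setT (fun y : R => y + x) by exact: measurable_funD.
  exact: (measurableT_comp mP ma).
- by move=> y; exact: P0.
rewrite -(@ge0_integral_scale _ (fun y => (h (- y + x) * pkern ep (x - (- y + x)))%:E) _ e0); last 2 first.
- apply/measurable_EFinP.
  have ma : measurable_fun setT (fun y : R => - y + x).
    by apply: measurable_funD => //; exact: measurable_funN.
  exact: (measurableT_comp mP ma).
- by move=> y; exact: P0.
rewrite -ge0_integralZl//.
- apply: eq_integral => t _; rewrite -EFinM; congr _%:E.
  rewrite -(pkern_scale t e0) mulrCA; congr (_ * _).
    by rewrite addrC.
  by congr (_ * pkern _ _); ring.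
- apply/measurable_EFinP.
  have ma : measurable_fun setT (fun y : R => - (ep * y) + x).
    by apply: measurable_funD => //; apply: measurable_funN; exact: measurable_funM.
  exact: (measurableT_comp mP ma).
- by move=> t _; exact: P0.
- by rewrite lee_fin ltW.
Qed.

Lemma integral_pkern ep x : 0 < ep -> (\int[leb1]_y (pkern ep (x - y))%:E = 1)%E.
Proof.
move=> e0; have := @pkern_subst (cst 1) ep x e0 (measurable_cst _) (fun=> ler01).
under eq_integral do rewrite mul1r.
by move=> ->; under eq_integral do rewrite mul1r; exact: integral_pkern1.
Qed.

Lemma cint_pweight_expi ep z : 0 < ep ->
  cint leb1 (fun xi => (pweight ep xi)%:C * expi (z * xi)) = (2 * ep / (ep ^+ 2 + z ^+ 2))%:C.
Proof.
move=> e0; apply: eqcP; rewrite ?Re_cint ?Im_cint.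
  rewrite -(Rintegral_pweight_cos z e0); apply: eq_Rintegral => x _.
  by rewrite RecM/= mul0r subr0.
rewrite -[RHS](Rintegral_pweight_sin z e0); apply: eq_Rintegral => x _.
by rewrite ImcM/= mul0r addr0.
Qed.

Lemma csummable_pweight ep : 0 < ep -> csummable leb1 (fun xi => (pweight ep xi)%:C).
Proof.
move=> e0; apply: (@le_csummable _ _ _ leb1 (fun xi => (pweight ep xi)%:C) (pweight ep)).
- by apply: cmeas_real; apply: continuous_measurable_fun; exact: continuous_pweight.
- exact: integrable_pweight.
- by move=> x; rewrite cabs_real ger0_norm// pweight_ge0.
Qed.

(** Only finitely many [z j] exceed 1 in modulus; setting those to 0 leaves the limit unchanged. *)
Lemma cvg_translate_distT (f : R -> R) (k M : R) (z : nat -> R) :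
  measurable_fun setT f -> 0 <= k -> (forall x, `|f x| <= M) ->
  (forall x, k < `|x| -> f x = 0) ->
  (z j @[j --> \oo] --> 0)%classic ->
  (translate_dist f (z j) @[j --> \oo] --> 0)%E%classic.
Proof.
move=> mf k0 fM f0 zc.
pose z' j := if `|z j| <= 1 then z j else 0.
have nz : \forall j \near \oo, z' j = z j.
  move/cvgrPdist_le : (zc) => /(_ 1 ltr01); apply: filterS => j.
  by rewrite sub0r normrN /z' => ->.
have z'c : (z' j @[j --> \oo] --> 0)%classic.
  by apply: cvg_trans zc; apply: near_eq_cvg; apply: filterS nz => j ->.
have := @cvg_translate_dist R f k M z' mf k0 fM f0 _ z'c.
move=> H; apply: cvg_trans (H _).
  by apply: near_eq_cvg; apply: filterS nz => j ->.
by move=> j; rewrite /z'; case: ifPn => //; rewrite normr0.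
Qed.

End plancherel1.

(** * Plancherel on the line by Abel summation *)

Section plancherel1_proof.
Context {R : realType}.
Local Notation leb1 := (@lebesgue_measure R).
Variables (u : measurableTypeR R -> R[i]) (k : R).
Hypotheses (bu : bfs leb1 u) (k0 : 0 <= k) (uk : forall x, k < `|x| -> u x = 0).

Let uh := kop leb1 fker1 u.
Let su : csummable leb1 u := bfs_csummable bu.
Let mu_ : cmeas u := bfs_meas bu.
Let muh : cmeas uh := cmeas_kop leb1 (@cmeas_fker1 R) mu_.
Let v ep xi := (pweight ep xi)%:C * uh xi.
Let B := fnorm 1 * \int[leb1]_x cabs (u x).

Let uhB xi : cabs (uh xi) <= B.
Proof. exact: (kop_le (@cmeas_fker1 R) (@cabs_fker1 R) xi su). Qed.

Let sv ep : 0 < ep -> csummable leb1 (v ep).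
Proof.
move=> e0; rewrite /v; under eq_fun do rewrite mulrC.
exact: (csummableMb (csummable_pweight e0) muh uhB).
Qed.

Lemma csummable_pkern ep x : 0 < ep -> csummable leb1 (fun y => (pkern ep (x - y))%:C).
Proof.
move=> e0.
have mP : measurable_fun setT (fun y : R => pkern ep (x - y)).
  by apply: (measurableT_comp (measurable_pkern e0)); exact: measurable_funB.
have P0 y : 0 <= pkern ep (x - y) by rewrite pkern_ge0// ltW.
apply: (@le_csummable _ _ _ leb1 (fun y => (pkern ep (x - y))%:C) (fun y => pkern ep (x - y))).
- exact: cmeas_real.
- apply/integrableP; split; first exact/measurable_EFinP.
  under eq_integral do rewrite /= ger0_norm//.
  by rewrite integral_pkern// ltry.
- by move=> y; rewrite cabs_real ger0_norm.
Qed.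

Lemma cint_pkern ep x : 0 < ep -> cint leb1 (fun y => (pkern ep (x - y))%:C) = 1.
Proof.
move=> e0; apply: eqcP; rewrite ?Re_cint ?Im_cint.
  by rewrite /Rintegral integral_pkern.
by rewrite Rintegral_cst// mul0r.
Qed.

(** Fubini: inverting the damped transform convolves [u] with the Poisson kernel. *)
Lemma kadj_pweight ep x : 0 < ep ->
  kadj leb1 fker1 (v ep) x = cint leb1 (fun y => u y * (pkern ep (x - y))%:C).
Proof.
move=> e0; have sp := csummable_pweight e0.
have sw : csummable leb1 (fun xi => conjc (fker1 (x, xi)) * (pweight ep xi)%:C).
  apply: (csummableMb (c := fnorm 1) sp).
    by apply: cmeas_conj; exact: (cmeas_section2 x (@cmeas_fker1 R)).
  by move=> xi; rewrite cabs_conj cabs_fker1.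
transitivity (cint leb1 (fun xi => cint leb1 (fun y => fker1 (y, xi) * u y) *
   (conjc (fker1 (x, xi)) * (pweight ep xi)%:C))).
  by apply: eq_cint => xi; rewrite /v mulrA [RHS]mulrC.
rewrite (cint_kernel su sw (@cmeas_fker1 R) (@cabs_fker1 R)).
apply: eq_cint => y; congr (_ * _).
transitivity (cint leb1 (fun xi => (fnorm 1 * fnorm 1)%:C * ((pweight ep xi)%:C * expi ((x - y) * xi)))).
  apply: eq_cint => xi; rewrite /fker1 conjcM conjc_real conjc_expi opprK/=.
  have -> : (x - y) * xi = - (y * xi) + x * xi by ring.
  by rewrite expiD complex_realM; ring.
rewrite cintZ.
  rewrite cint_pweight_expi// -complex_realM fnorm_sqr /pkern; congr (_%:C).
  have gen (p D : R) : p != 0 -> D != 0 -> (2 * p)^-1 * (2 * ep / D) = p^-1 * (ep / D).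
    by move=> p0 D0; field; rewrite p0 D0.
  by apply: gen; rewrite gt_eqF// ?pi_gt0// ltr_wpDr ?sqr_ge0 ?exprn_gt0.
under eq_fun do rewrite mulrC.
apply: (csummableMb (c := 1) sp).
  by apply: cmeas_expi; exact: measurable_funM.
by move=> xi; rewrite cabs_expi.
Qed.

(** The L1 modulus of continuity of [u]. *)
Let om (z : R) : \bar R := (\int[leb1]_x (cabs (u (x - z) - u x))%:E)%E.

Let mu2 ep : cmeas (fun z : measurableTypeR R * measurableTypeR R => u (z.1 - ep * z.2) - u z.1).
Proof.
apply: cmeasB; last by apply: (cmeas_comp mu_); exact: measurable_fst.
apply: (cmeas_comp mu_ (h := fun z : measurableTypeR R * measurableTypeR R => z.1 - ep * z.2)).
by apply: measurable_funB => //; exact: measurable_funM.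
Qed.

(** As the Poisson kernel has mass 1, the difference is the integral of u(y) - u(x) against it;
    [pkern_subst] and Tonelli then give an average of the modulus of continuity. *)
Lemma kadj_pweight_sub ep : 0 < ep ->
  (\int[leb1]_x (cabs (kadj leb1 fker1 (v ep) x - u x))%:E <=
   \int[leb1]_t ((pkern 1 t)%:E * om (ep * t)%R))%E.
Proof.
move=> e0.
pose G (z : measurableTypeR R * measurableTypeR R) :=
  cabs (u (z.1 - ep * z.2) - u z.1) * pkern 1 z.2.
have mG : measurable_fun setT G.
  apply: measurable_funM; first exact: (measurable_cabs (mu2 ep)).
  by apply: (measurableT_comp (measurable_pkern (@ltr01 R))); exact: measurable_snd.
have G0 z : 0 <= G z by rewrite mulr_ge0 ?cabs_ge0 ?pkern_ge0.
have bound x : ((cabs (kadj leb1 fker1 (v ep) x - u x))%:E <= \int[leb1]_t (G (x, t))%:E)%E.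
  have sP := csummable_pkern x e0.
  have [_ [M uM] _] := bu.
  have suP : csummable leb1 (fun y => u y * (pkern ep (x - y))%:C).
    exact: (csummableMb sP mu_ uM).
  have sd : csummable leb1 (fun y => (u y - u x) * (pkern ep (x - y))%:C).
    apply: (csummableMb (c := M + cabs (u x)) sP).
      by apply: cmeasB => //; exact: cmeas_cst.
    by move=> y; apply: (le_trans (cabsD _ _)); rewrite cabsN lerD2r.
  have -> : kadj leb1 fker1 (v ep) x - u x = cint leb1 (fun y => (u y - u x) * (pkern ep (x - y))%:C).
    rewrite kadj_pweight// -[X in _ - X]mulr1 -(cint_pkern x e0) -cintZ// -cintB//.
      by apply: eq_cint => y; rewrite mulrBl.
    exact: csummableZ.
  apply: (@le_trans _ _ (\int[leb1]_y cabs ((u y - u x) * (pkern ep (x - y))%:C))%:E).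
    by rewrite lee_fin; exact: cabs_cint.
  rewrite /Rintegral fineK; last first.
    by apply: integrable_fin_num => //; have /csummableP[] := sd.
  rewrite -[leRHS](@pkern_subst _ (fun y => cabs (u y - u x)) ep x)//.
  - rewrite le_eqVlt; apply/orP; left; apply/eqP; apply: eq_integral => y _.
    by rewrite cabsM cabs_real ger0_norm// pkern_ge0// ltW.
  - by apply: (@measurable_cabs _ _ _ (fun y => u y - u x)); apply: cmeasB => //; exact: cmeas_cst.
  - by move=> y; exact: cabs_ge0.
apply: (@le_trans _ _ (\int[leb1]_x \int[leb1]_t (G (x, t))%:E)%E).
  apply: ge0_le_integral => //.
  - by move=> x _; rewrite lee_fin cabs_ge0.
  - apply/measurable_EFinP; apply: (@measurable_cabs _ _ _ (fun x => kadj leb1 fker1 (v ep) x - u x)).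
    apply: cmeasB => //; apply: (cmeas_kop leb1 (cmeas_eswap (@cmeas_fker1 R))).
    exact: csummable_meas (sv e0).
  - apply: (@measurable_fun_fubini_tonelli_F _ _ _ _ _ leb1 (EFin \o G)) => //.
    exact/measurable_EFinP.
rewrite (@fubini_tonelli _ _ _ _ _ leb1 leb1 (EFin \o G))//; last exact/measurable_EFinP.
rewrite le_eqVlt; apply/orP; left; apply/eqP; apply: eq_integral => t _.
rewrite /om -ge0_integralZl//.
- by apply: eq_integral => x _; rewrite /= /G /= -EFinM mulrC.
- apply/measurable_EFinP; have h := measurable_cabs (cmeas_section1 t (mu2 ep)).
  exact: h.
- by move=> x _; rewrite lee_fin cabs_ge0.
- by rewrite lee_fin pkern_ge0.
Qed.

Lemma measurable_om (ep : R) : measurable_fun setT (fun t : R => om (ep * t)).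
Proof.
apply: (@measurable_fun_fubini_tonelli_G _ _ _ _ _ leb1 (fun z : measurableTypeR R * measurableTypeR R => (cabs (u (z.1 - ep * z.2) - u z.1))%:E)).
- by apply/measurable_EFinP; exact: (measurable_cabs (mu2 ep)).
- by move=> z; rewrite lee_fin cabs_ge0.
Qed.

Lemma om_le z : (om z <= (2 * \int[leb1]_x cabs (u x))%:E)%E.
Proof.
have /csummableP[_ iu] := su.
have mc : measurable_fun setT (fun x => cabs (u x)) := measurable_cabs mu_.
have mcz : measurable_fun setT (fun x : R => cabs (u (x - z))).
  exact: (measurable_translate z mc).
have E : (\int[leb1]_x (cabs (u x))%:E = (\int[leb1]_x cabs (u x))%:E)%E.
  by rewrite /Rintegral fineK//; exact: integrable_fin_num iu.
apply: (@le_trans _ _ (\int[leb1]_x ((cabs (u (x - z)))%:E + (cabs (u x))%:E))%E).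
  apply: ge0_le_integral => //.
  - by move=> x _; rewrite lee_fin cabs_ge0.
  - apply/measurable_EFinP; apply: (@measurable_cabs _ _ _ (fun x : measurableTypeR R => u (x - z) - u x)).
    apply: cmeasB => //; apply: (cmeas_comp mu_ (h := fun x : measurableTypeR R => x - z)).
    exact: measurable_funB.
  - by apply: emeasurable_funD; exact/measurable_EFinP.
  - by move=> x _; rewrite -EFinD lee_fin; apply: (le_trans (cabsD _ _)); rewrite cabsN.
rewrite ge0_integralD//; last 4 first.
- by move=> x _; rewrite lee_fin cabs_ge0.
- exact/measurable_EFinP.
- by move=> x _; rewrite lee_fin cabs_ge0.
- exact/measurable_EFinP.
rewrite (@ge0_integral_shift _ (fun x => (cabs (u x))%:E) (- z)).
- by rewrite E -EFinD mulr2n mulrDl mul1r.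
- exact/measurable_EFinP.
- by move=> x; rewrite lee_fin cabs_ge0.
Qed.

Lemma om_ge0 z : (0 <= om z)%E.
Proof. by apply: integral_ge0 => x _; rewrite lee_fin cabs_ge0. Qed.

Lemma cvg_om (z : nat -> R) : (z j @[j --> \oo] --> 0)%classic ->
  (om (z j) @[j --> \oo] --> 0)%E%classic.
Proof.
move=> zc; have [_ [M uM] _] := bu.
have H1 := @cvg_translate_distT R (@complex.Re R \o u) k M z mu_.1 k0.
have H2 := @cvg_translate_distT R (@complex.Im R \o u) k M z mu_.2 k0.
have {}H1 : (translate_dist (@complex.Re R \o u) (z j) @[j --> \oo] --> 0)%E%classic.
  apply: H1 => // [x|x kx]; first by apply: le_trans (uM x); exact: Re_le_cabs.
  by rewrite /= uk.
have {}H2 : (translate_dist (@complex.Im R \o u) (z j) @[j --> \oo] --> 0)%E%classic.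
  apply: H2 => // [x|x kx]; first by apply: le_trans (uM x); exact: Im_le_cabs.
  by rewrite /= uk.
have mdiff (h : R -> R) (a : R) : measurable_fun setT h ->
    measurable_fun setT (fun x : R => `|h (x - a) - h x|).
  move=> mh; apply: measurableT_comp => //; apply: measurable_funB => //.
  exact: measurable_translate.
apply: (@squeeze_cvge _ _ _ _ (cst 0%E) _ (fun j => translate_dist (@complex.Re R \o u) (z j) + translate_dist (@complex.Im R \o u) (z j))%E).
- apply: nearW => j; rewrite om_ge0/= /translate_dist -ge0_integralD//.
  + apply: ge0_le_integral => //.
    * by move=> x _; rewrite lee_fin cabs_ge0.
    * apply/measurable_EFinP; apply: (@measurable_cabs _ _ _ (fun x : measurableTypeR R => u (x - z j) - u x)).
      apply: cmeasB => //; apply: (cmeas_comp mu_ (h := fun x : measurableTypeR R => x - z j)).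
      exact: measurable_funB.
    * by apply: emeasurable_funD; apply/measurable_EFinP; apply: mdiff; [exact: mu_.1|exact: mu_.2].
    * move=> x _; rewrite -EFinD lee_fin; apply: (le_trans (cabs_le_ReIm _)).
      by rewrite !ReD !ImD !ReN !ImN.
  + by apply/measurable_EFinP; apply: mdiff; exact: mu_.1.
  + by apply/measurable_EFinP; apply: mdiff; exact: mu_.2.
- exact: cvg_cst.
- by rewrite -[X in _ --> X](adde0 0%E); apply: cvgeD.
Qed.

Let ep (j : nat) : R := j.+1%:R^-1.
Let ep_gt0 j : 0 < ep j. Proof. by rewrite invr_gt0. Qed.

(** The Poisson means converge to [u] in L1: dominated convergence applies to the average in
    [kadj_pweight_sub], since [om] is bounded by twice the L1 norm and tends to 0 at 0. *)
Lemma cvg_kadj_pweight :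
  (\int[leb1]_x (cabs (kadj leb1 fker1 (v (ep j)) x - u x))%:E @[j --> \oo] --> 0)%E%classic.
Proof.
have C0 : 0 <= 2 * \int[leb1]_x cabs (u x).
  by rewrite mulr_ge0//; apply: Rintegral_ge0 => x _; exact: cabs_ge0.
set C := 2 * _ in C0.
have ipk : leb1.-integrable setT (fun t => (pkern 1 t)%:E * C%:E)%E.
  apply/integrableP; split.
    by apply: emeasurable_funM => //; apply/measurable_EFinP; exact: measurable_pkern.
  have E t : `|(pkern 1 t)%:E * C%:E|%E = ((pkern 1 t)%:E * C%:E)%E.
    by rewrite gee0_abs// -EFinM lee_fin mulr_ge0// pkern_ge0.
  under eq_integral do rewrite E.
  rewrite ge0_integralZr//.
  - by rewrite integral_pkern1 mul1e ltry.
  - by apply/measurable_EFinP; exact: measurable_pkern.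
  - by move=> t _; rewrite lee_fin pkern_ge0.
have cv : (\int[leb1]_t ((pkern 1 t)%:E * om (ep j * t)) @[j --> \oo] --> 0)%E%classic.
  have := @dominated_convergence _ _ _ leb1 setT measurableT
     (fun j t => (pkern 1 t)%:E * om (ep j * t))%E (cst 0%E) (fun t => (pkern 1 t)%:E * C%:E)%E.
  rewrite integral0 => H; apply H => //.
  - move=> j; apply: emeasurable_funM; last exact: measurable_om.
    by apply/measurable_EFinP; exact: measurable_pkern.
  - apply/aeW => t _; rewrite -[X in _ --> X](mule0 (pkern 1 t)%:E).
    apply: cvgeZl => //; apply: cvg_om.
    rewrite -[X in _ --> X](mul0r t); apply: cvgMr_tmp; exact: cvg_harmonic.
  - apply/aeW => t j _; rewrite gee0_abs ?mule_ge0 ?om_ge0 ?lee_fin ?pkern_ge0//.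
    by rewrite lee_wpmul2l ?lee_fin ?pkern_ge0// om_le.
apply: (@squeeze_cvge _ _ _ _ (cst 0%E) _ _ _ _ _ cv).
  apply: nearW => j; rewrite kadj_pweight_sub// andbT.
  by apply: integral_ge0 => x _; rewrite lee_fin cabs_ge0.
exact: cvg_cst.
Qed.

Let W j := \int[leb1]_xi (pweight (ep j) xi * cabs (uh xi) ^+ 2).

Lemma W_E j : (W j)%:E = (\int[leb1]_xi (pweight (ep j) xi * cabs (uh xi) ^+ 2)%:E)%E.
Proof.
have ig : leb1.-integrable setT (fun x => (B ^+ 2)%:E * (pweight (ep j) x)%:E)%E.
  by apply: integrableZl => //; exact: integrable_pweight.
rewrite /W /Rintegral fineK//; apply: integrable_fin_num => //.
apply: le_integrable ig => //.
- apply/measurable_EFinP; apply: measurable_funM; last exact: measurable_cabs2.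
  by apply: continuous_measurable_fun; exact: continuous_pweight.
- move=> x _; rewrite -EFinM lee_fin.
  have B0 : 0 <= B := le_trans (cabs_ge0 _) (uhB 0).
  rewrite ger0_norm; last by rewrite mulr_ge0 ?pweight_ge0 ?sqr_ge0.
  rewrite ger0_norm; last by rewrite mulr_ge0 ?pweight_ge0 ?sqr_ge0.
  by rewrite mulrC ler_wpM2r ?pweight_ge0// ler_pXn2r ?nnegrE ?cabs_ge0.
Qed.

Let M_ex : exists2 M, 0 <= M & forall x, cabs (u x) <= M.
Proof.
have [_ [M uM] _] := bu; exists M => //.
exact: le_trans (cabs_ge0 _) (uM 0).
Qed.

(** By adjointness [W j] is the real scalar product of [u] with its Poisson mean w, so the
    difference is that of [u] with w - u; [u] being bounded, L1 convergence of w is enough. *)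
Lemma W_sub M j : 0 <= M -> (forall x, cabs (u x) <= M) ->
  ((`|W j - nsq leb1 u|)%:E <=
   M%:E * \int[leb1]_x (cabs (kadj leb1 fker1 (v (ep j)) x - u x))%:E)%E.
Proof.
move=> M0 uM; have svj := sv (ep_gt0 j).
set w := kadj leb1 fker1 (v (ep j)).
have mw : cmeas w.
  by apply: (cmeas_kop leb1 (cmeas_eswap (@cmeas_fker1 R))); exact: csummable_meas svj.
have wB x : cabs (w x) <= fnorm 1 * \int[leb1]_xi cabs (v (ep j) xi).
  exact: (kop_le (cmeas_eswap (@cmeas_fker1 R)) (eswap_le (@cabs_fker1 R)) x svj).
have suw : csummable leb1 (fun x => u x * conjc (w x)).
  rewrite (_ : (fun _ => _) = (fun x => conjc (w x) * u x)); last first.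
    by apply/funext => x; rewrite mulrC.
  apply: (csummableMb su (cmeas_conj mw)) => x; rewrite cabs_conj; exact: wB.
have suu : csummable leb1 (fun x => u x * conjc (u x)).
  by apply: csummable_L2gM; [exact: bfs_L2g|exact/L2g_conj/bfs_L2g].
have -> : W j - nsq leb1 u = complex.Re (cint leb1 (fun x => u x * conjc (w x - u x))).
  have -> : (fun x => u x * conjc (w x - u x)) = (fun x => u x * conjc (w x) - u x * conjc (u x)).
    by apply/funext => x; rewrite rmorphB mulrBr.
  rewrite cintB// ReD ReN (nsqE (bfs_L2g bu))/=; congr (_ - _).
  rewrite -[RHS]/(complex.Re (cint leb1 (fun x => u x * conjc (w x)))).
  rewrite -(kop_adj (@cmeas_fker1 R) (@cabs_fker1 R) su svj) Re_cint.
  apply: eq_Rintegral => xi _; rewrite /v conjcM conjc_real -/(uh xi).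
  rewrite (mulrCA (uh xi) (pweight (ep j) xi)%:C) mulc_conj.
  by rewrite -complex_realM.
have sd : csummable leb1 (fun x => u x * conjc (w x - u x)).
  have -> : (fun x => u x * conjc (w x - u x)) = (fun x => u x * conjc (w x) + (-1) * (u x * conjc (u x))).
    by apply/funext => x; rewrite rmorphB mulrBr mulN1r.
  by apply: csummableD => //; exact: csummableZ.
apply: (@le_trans _ _ (\int[leb1]_x (cabs (u x * conjc (w x - u x)))%:E)%E).
  have /csummableP[_ isd] := sd.
  have fsd := integrable_fin_num measurableT isd.
  rewrite -(fineK fsd) lee_fin; apply: (le_trans (Re_le_cabs _)).
  exact: cabs_cint.
have mwu : cmeas (fun x => w x - u x) by exact: cmeasB.
rewrite -ge0_integralZl//.
- apply: ge0_le_integral => //.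
  + by move=> x _; rewrite lee_fin cabs_ge0.
  + by apply/measurable_EFinP; exact: measurable_cabs (csummable_meas sd).
  + by apply: emeasurable_funM => //; apply/measurable_EFinP; exact: measurable_cabs mwu.
  + move=> x _; rewrite -EFinM lee_fin cabsM cabs_conj ler_wpM2r ?cabs_ge0//.
- by apply/measurable_EFinP; exact: measurable_cabs mwu.
- by move=> x _; rewrite lee_fin cabs_ge0.
Qed.

Lemma cvg_W : ((W j)%:E @[j --> \oo] --> (nsq leb1 u)%:E)%E%classic.
Proof.
have [M M0 uM] := M_ex.
apply: cvg_EFin; first exact: nearW.
apply/cvgrPdist_le => eps eps0.
have H : ((`|W j - nsq leb1 u|)%:E @[j --> \oo] --> 0)%E%classic.
  apply: (@squeeze_cvge _ _ _ _ (cst 0%E) _ (fun j => M%:E * \int[leb1]_x (cabs (kadj leb1 fker1 (v (ep j)) x - u x))%:E)%E).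
  - by apply: nearW => j; rewrite W_sub// andbT lee_fin.
  - exact: cvg_cst.
  - by rewrite -[X in _ --> X](mule0 M%:E); apply: cvgeZl => //; exact: cvg_kadj_pweight.
have H0 j : (0 <= (`|W j - nsq leb1 u|)%:E)%E by rewrite lee_fin.
by have := (cvge0P H0).1 H _ eps0; apply: filterS => j; rewrite lee_fin distrC.
Qed.

(** Both sides are limits of [W j]: the left one by monotone convergence, as the weights increase to
    1, the right one by [cvg_W]. *)
Lemma plancherel1 : sqn leb1 (kop leb1 fker1 u) = sqn leb1 u.
Proof.
rewrite (sqnE (bfs_L2g bu)) -/uh.
have cpw xi : ((pweight (ep j) xi * cabs (uh xi) ^+ 2)%:E @[j --> \oo] --> (cabs (uh xi) ^+ 2)%:E)%E%classic.
  apply: cvg_EFin; first exact: nearW.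
  rewrite -[X in _ --> X]mul1r; apply: cvgMr_tmp.
  rewrite -(@expR0 R) /pweight; apply: continuous_cvg; first exact: continuous_expR.
  rewrite -oppr0; apply: cvgN; rewrite -(mul0r `|xi|); apply: cvgMr_tmp; exact: cvg_harmonic.
have := @cvg_monotone_convergence _ _ _ leb1 setT measurableT (fun j xi => (pweight (ep j) xi * cabs (uh xi) ^+ 2)%:E).
move=> H; have {}H := H _ _ _.
have L : ((W j)%:E @[j --> \oo] --> sqn leb1 uh)%E%classic.
  rewrite /sqn (_ : (fun j => _) = (fun j => \int[leb1]_xi (pweight (ep j) xi * cabs (uh xi) ^+ 2)%:E)%E); last first.
    by apply/funext => j; rewrite W_E.
  rewrite (_ : (fun xi => (cabs (uh xi) ^+ 2)%:E) = (fun xi => limn (fun j => (pweight (ep j) xi * cabs (uh xi) ^+ 2)%:E))%E); last first.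
    by apply/funext => xi; apply/esym/cvg_lim => //; exact: cpw.
  apply: H.
  - move=> j; apply/measurable_EFinP; apply: measurable_funM; last exact: measurable_cabs2.
    by apply: continuous_measurable_fun; exact: continuous_pweight.
  - by move=> j xi _; rewrite lee_fin mulr_ge0 ?pweight_ge0 ?sqr_ge0.
  - move=> xi _ a b ab; rewrite lee_fin ler_wpM2r ?sqr_ge0// /pweight ler_expR lerN2.
    by rewrite ler_wpM2r// /ep lef_pV2 ?posrE// ler_nat.
exact: (cvg_unique _ L cvg_W).
Qed.

End plancherel1_proof.

(** * Plancherel in dimension n *)

Section plancherel.
Context {R : realType}.
Local Notation leb1 := (@lebesgue_measure R).

Definition fker n (z : n.-tuple R * n.-tuple R) : R[i] :=
  (fnorm n)%:C * expi (- dotp z.1 z.2).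

Lemma measurable_dotp n : measurable_fun setT (fun z : n.-tuple R * n.-tuple R => dotp z.1 z.2).
Proof.
rewrite /dotp; apply: measurable_sum => i; apply: measurable_funM.
  by apply: (measurableT_comp (measurable_tnth i)); exact: measurable_fst.
by apply: (measurableT_comp (measurable_tnth i)); exact: measurable_snd.
Qed.

Lemma cmeas_fker n : cmeas (@fker n).
Proof.
apply: cmeasM; first exact: cmeas_cst.
by apply: cmeas_expi; apply: measurableT_comp => //; exact: measurable_dotp.
Qed.

Lemma cabs_fker n z : cabs (@fker n z) <= fnorm n.
Proof. by rewrite cabsM cabs_expi mulr1 cabs_real ger0_norm// ltW// fnorm_gt0. Qed.

Lemma dotp_cons n (x xi : n.-tuple R) (t s : R) :
  dotp (cons_pair (x, t)) (cons_pair (xi, s)) = t * s + dotp x xi.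
Proof.
rewrite /dotp big_ord_recl !cons_pair_tnth0; congr (_ + _).
by apply: eq_bigr => i _; rewrite !cons_pair_tnthS.
Qed.

Lemma fker_cons n (x xi : n.-tuple R) (t s : R) :
  fker (cons_pair (x, t), cons_pair (xi, s)) = fker (x, xi) * fker1 (t, s).
Proof.
rewrite /fker /fker1 fnormS dotp_cons opprD expiD complex_realM/=; ring.
Qed.

(** Unlike [bfs], this is inherited by every section and every partial transform, hence usable in an
    induction on [n]. *)
Definition bcs n (u : n.-tuple R -> R[i]) := [/\ cmeas u,
  exists M, forall x, cabs (u x) <= M &
  exists2 k, 0 <= k & forall x, ~ cube n k x -> u x = 0].

Lemma bcs_bfs n u : @bcs n u -> bfs (leb R n) u.
Proof.
move=> [mu uM [k k0 uk]]; split => //; exists (cube n k); split => //.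
  exact: measurable_cube.
exact: lebesgue_tuple_cube.
Qed.

Definition fourier n (u : n.-tuple R -> R[i]) := kop (leb R n) (@fker n) u.

Let csections n (u : n.+1.-tuple R -> R[i]) x t := u (@cons_pair R n (x, t)).

Lemma bcs_section n (u : n.+1.-tuple R -> R[i]) x : bcs u ->
  bfs leb1 (csections u x) /\
  exists2 k, 0 <= k & forall t, k < `|t| -> csections u x t = 0.
Proof.
move=> [mu [M uM] [k k0 uk]].
have u0 t : k < `|t| -> csections u x t = 0.
  by move=> kt; apply: uk => /cube_cons[_]; rewrite leNgt kt.
split; last by exists k.
split.
- exact: (cmeas_section2 x (cmeas_cons mu)).
- by exists M => t; exact: uM.
- exists `[- k, k]%classic; split; first exact: measurable_itv.
    by rewrite /= lebesgue_measure_itv/=; case: ifP => _; rewrite ?ltry// -EFinN -EFinD ltry.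
  move=> t /= h; apply: u0; rewrite ltNge; apply/negP; rewrite ler_norml => h'.
  by apply: h; rewrite in_itv.
Qed.

Let part n (u : n.+1.-tuple R -> R[i]) (s : measurableTypeR R) x :=
  kop leb1 fker1 (csections u x) s.

Lemma cmeas_part2 n (u : n.+1.-tuple R -> R[i]) : cmeas u ->
  cmeas (fun z : n.-tuple R * measurableTypeR R => part u z.2 z.1).
Proof.
move=> mu; apply: (@cmeas_int_section1 _ _ _ _ R leb1
  (fun z : measurableTypeR R * (n.-tuple R * measurableTypeR R) =>
     fker1 (z.1, z.2.2) * u (cons_pair (z.2.1, z.1)))).
apply: cmeasM.
  apply: (cmeas_comp (@cmeas_fker1 R) (h := fun z : measurableTypeR R * (n.-tuple R * measurableTypeR R) => (z.1, z.2.2))).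
  apply: measurable_fun_pair; first exact: measurable_fst.
  by apply: measurableT_comp; exact: measurable_snd.
apply: (cmeas_comp (cmeas_cons mu) (h := fun z : measurableTypeR R * (n.-tuple R * measurableTypeR R) => (z.2.1, z.1))).
apply: measurable_fun_pair; last exact: measurable_fst.
by apply: measurableT_comp; [exact: measurable_fst|exact: measurable_snd].
Qed.

Lemma bcs_part n (u : n.+1.-tuple R -> R[i]) s : bcs u -> bcs (part u s).
Proof.
move=> bu; have [mu [M uM] [k k0 uk]] := bu; split.
- exact: (cmeas_section1 s (cmeas_part2 mu)).
(* The section is bounded by [M] and vanishes off [-k, k], so its L1 norm is at most 2 k M. *)
- exists (fnorm 1 * (M * (2 * k))) => x.
  have [bx _] := bcs_section x bu; have sx := bfs_csummable bx.
  apply: (le_trans (kop_le (@cmeas_fker1 R) (@cabs_fker1 R) s sx)).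
  rewrite ler_wpM2l//; first by rewrite ltW// fnorm_gt0.
  have M0 : 0 <= M := le_trans (cabs_ge0 _) (uM (cons_pair (x, 0))).
  have lk : leb1 `[- k, k]%classic = (2 * k)%:E.
    rewrite /= lebesgue_measure_itv/= lte_fin.
    case: ifPn => [_|]; first by rewrite -EFinB; congr _%:E; ring.
    rewrite -leNgt => h; have -> : k = 0 by apply/eqP; rewrite eq_le k0 andbT; lra.
    by rewrite mulr0.
  have /csummableP[_ ix] := sx.
  have fx := integrable_fin_num measurableT ix.
  rewrite -lee_fin EFinM -lk /Rintegral (fineK fx) -integral_cst//.
  rewrite [leRHS]integral_mkcond; apply: ge0_le_integral => //.
  + by move=> t _; rewrite lee_fin cabs_ge0.
  + by apply/measurable_EFinP; exact: measurable_cabs (bfs_meas bx).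
  + by apply/(measurable_restrictT _ (measurable_itv _)); exact: measurable_cst.
  + move=> t _; rewrite patchE; case: ifPn => [_|]; first by rewrite lee_fin; exact: uM.
    rewrite notin_setE/= in_itv/= -ler_norml => /negP; rewrite -ltNge => kt.
    by rewrite /csections uk ?cabs0// => /cube_cons[_]; rewrite leNgt kt.
- exists k => // x nx; rewrite /part /kop.
  rewrite (@eq_cint _ _ _ leb1 _ (fun=> 0)).
    by apply: eqcP; rewrite ?Re_cint ?Im_cint Rintegral_cst// mul0r.
  move=> t; rewrite /csections uk ?mulr0// => /cube_cons[]; by [].
Qed.

Lemma fourier_cons n (u : n.+1.-tuple R -> R[i]) xi s : bcs u ->
  fourier u (cons_pair (xi, s)) = fourier (part u s) xi.
Proof.
move=> bu; have su := bfs_csummable (bcs_bfs bu).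
rewrite /fourier /kop cint_leb_cons; last first.
  exact: (csummable_kop (@cmeas_fker n.+1) (@cabs_fker n.+1) _ su).
apply: eq_cint => x; rewrite /part /kop -cintZ.
  by apply: eq_cint => t; rewrite fker_cons mulrA.
have [bx _] := bcs_section x bu.
exact: (csummable_kop (@cmeas_fker1 R) (@cabs_fker1 R) s (bfs_csummable bx)).
Qed.

Lemma cmeas_fourier n u : cmeas u -> cmeas (@fourier n u).
Proof. exact: (cmeas_kop (leb R n) (@cmeas_fker n)). Qed.

(** Induction on [n]: at fixed frequency [s] the hypothesis applies to [part u s], then Tonelli
    exchanges the variables and [plancherel1] applies to each section in the head coordinate. *)
Lemma plancherel n u : @bcs n u -> sqn (leb R n) (fourier u) = sqn (leb R n) u.
Proof.
elim: n => [|n IH] in u *.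
  (* In dimension 0 the measure is a unit mass and the kernel is 1. *)
  move=> bu; have mfu := cmeas_fourier (bfs_meas (bcs_bfs bu)).
  have E (f : 0.-tuple R -> \bar R) : measurable_fun setT f -> (\int[leb R 0]_x f x = f [tuple])%E.
    move=> mf; rewrite -integral_lebE/= integral_dirac// diracE mem_set// mul1e//.
  rewrite /sqn !E; last 2 first.
  - by apply/measurable_EFinP; exact: measurable_cabs2 (bfs_meas (bcs_bfs bu)).
  - by apply/measurable_EFinP; exact: measurable_cabs2.
  congr ((cabs _ ^+ 2)%:E); rewrite /fourier /kop.
  rewrite (@eq_cint _ _ _ (leb R 0) _ (fun=> u [tuple])); last first.
    move=> x; rewrite /fker /fnorm mul0r oppr0 powRr0 /dotp big_ord0 oppr0 expi0 !mul1r.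
    by rewrite (tuple0 x).
  by apply: eqcP; rewrite ?Re_cint ?Im_cint /Rintegral E.
move=> bu; have mu := bfs_meas (bcs_bfs bu).
have mfu := cmeas_fourier mu.
have mp := cmeas_part2 mu.
rewrite /sqn ge0_integral_leb_consC; last 2 first.
- by apply/measurable_EFinP; exact: measurable_cabs2.
- by move=> x; rewrite lee_fin sqr_ge0.
transitivity (\int[leb1]_s \int[leb R n]_x (cabs (part u s x) ^+ 2)%:E)%E.
  apply: eq_integral => s _; have := IH _ (bcs_part s bu); rewrite /sqn => <-.
  by apply: eq_integral => xi _; rewrite fourier_cons.
have mP : measurable_fun setT (fun z : n.-tuple R * measurableTypeR R => (cabs (part u z.2 z.1) ^+ 2)%:E).
  by apply/measurable_EFinP; exact: measurable_cabs2 mp.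
have P0 (z : n.-tuple R * measurableTypeR R) : (0 <= (cabs (part u z.2 z.1) ^+ 2)%:E)%E by rewrite lee_fin sqr_ge0.
rewrite -(@fubini_tonelli _ _ _ _ _ (leb R n) leb1 _ mP P0).
rewrite ge0_integral_leb_cons; last 2 first.
- by apply/measurable_EFinP; exact: measurable_cabs2.
- by move=> x; rewrite lee_fin sqr_ge0.
apply: eq_integral => x _.
have [bx [k k0 xk]] := bcs_section x bu.
exact: (plancherel1 bx k0 xk).
Qed.

End plancherel.

(** * Truncations, pairings and limits in L2 *)

Section L2_limits.
Context d (T : measurableType d) (R : realType).
Variable mu : {measure set T -> \bar R}.
Implicit Types (f g : T -> R[i]).

Lemma nsqB f g : L2g mu f -> L2g mu g ->
  nsq mu (fun x => f x - g x) = nsq mu f + nsq mu g - 2 * ip mu f g.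
Proof.
move=> lf lg; have lfg := L2gB lf lg.
have e := nsqE lfg; have ef := nsqE lf; have eg := nsqE lg.
have sfg := csummable_L2gM lf (L2g_conj lg); have sgf := csummable_L2gM lg (L2g_conj lf).
have sff := csummable_L2gM lf (L2g_conj lf); have sgg := csummable_L2gM lg (L2g_conj lg).
have ecint : cint mu (fun x => (f x - g x) * conjc (f x - g x)) =
   (cint mu (fun x => f x * conjc (f x)) - cint mu (fun x => f x * conjc (g x))) -
   (cint mu (fun x => g x * conjc (f x)) - cint mu (fun x => g x * conjc (g x))).
  rewrite -[in X in X - _]cintB// -[in X in _ - X]cintB// -cintB.
  - by apply: eq_cint => x; rewrite rmorphB/=; ring.
  - by have := csummable_L2gM lf (L2g_conj lfg); congr csummable; apply/funext => x; rewrite rmorphB mulrBr.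
  - by have := csummable_L2gM lg (L2g_conj lfg); congr csummable; apply/funext => x; rewrite rmorphB mulrBr.
have : complex.Re (cint mu (fun x => (f x - g x) * conjc (f x - g x))) = nsq mu (fun x => f x - g x).
  by rewrite e.
have hf : complex.Re (cint mu (fun x => f x * conjc (f x))) = nsq mu f by rewrite ef.
have hg : complex.Re (cint mu (fun x => g x * conjc (g x))) = nsq mu g by rewrite eg.
rewrite ecint => <-; rewrite !(ReD, ReN) hf hg -/(ip mu f g) -/(ip mu g f) (ipC lg lf); ring.
Qed.

Lemma nsq_conj f : nsq mu (fun x => conjc (f x)) = nsq mu f.
Proof. by rewrite /nsq; congr fine; apply: eq_integral => x _; rewrite cabs_conj. Qed.

Lemma sqn_conj f : sqn mu (fun x => conjc (f x)) = sqn mu f.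
Proof. by apply: eq_integral => x _; rewrite cabs_conj. Qed.

Definition trunc (D : set T) f x := (\1_D x)%:C * f x.

Lemma truncT (D : set T) f x : D x -> trunc D f x = f x.
Proof. by move=> Dx; rewrite /trunc indicE mem_set// mul1r. Qed.

Lemma truncF (D : set T) f x : ~ D x -> trunc D f x = 0.
Proof. by move=> Dx; rewrite /trunc indicE memNset// mul0r. Qed.

Lemma cmeas_trunc D f : measurable D -> cmeas f -> cmeas (trunc D f).
Proof. exact: cmeas_if. Qed.

Lemma cabs_trunc D f x : cabs (trunc D f x) <= cabs (f x).
Proof.
have [Dx|Dx] := pselect (D x); first by rewrite truncT.
by rewrite truncF// cabs0 cabs_ge0.
Qed.

Lemma L2g_trunc D f : measurable D -> L2g mu f -> L2g mu (trunc D f).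
Proof.
move=> mD lf; apply: (le_L2g _ lf); last by move=> x; exact: cabs_trunc.
by apply: cmeas_trunc => //; case: lf.
Qed.

Lemma csummable_trunc D f : measurable D -> (mu D < +oo)%E -> L2g mu f ->
  csummable mu (trunc D f).
Proof.
move=> mD fD lf.
have li : bfs mu (fun x => (\1_D x)%:C : R[i]).
  split; first by apply: cmeas_real; exact: measurable_indic.
    by exists 1 => x; rewrite cabs_real indicE; case: (_ \in _); rewrite ?normr1 ?normr0.
  by exists D; split => // x Dx; rewrite indicE memNset.
exact: csummable_L2gM (bfs_L2g li) lf.
Qed.

Lemma cvg_sqn_trunc (D : nat -> set T) f : (forall k, measurable (D k)) ->
  (forall k l, (k <= l)%N -> D k `<=` D l) -> (forall x, exists k, D k x) ->
  cmeas f -> (sqn mu (trunc (D k) f) @[k --> \oo] --> sqn mu f)%E%classic.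
Proof.
move=> mD nD cD mf.
have cvx x : ((cabs (trunc (D k) f x) ^+ 2)%:E @[k --> \oo] --> (cabs (f x) ^+ 2)%:E)%E%classic.
  apply: cvg_near_cst; have [k Dk] := cD x; exists k => // l /= kl.
  by rewrite truncT//; exact: nD Dk.
rewrite {2}/sqn (_ : (fun x => (cabs (f x) ^+ 2)%:E) = (fun x => limn (fun k => (cabs (trunc (D k) f x) ^+ 2)%:E))%E); last first.
  by apply/funext => x; apply/esym/cvg_lim => //; exact: cvx.
apply: cvg_monotone_convergence => //.
- by move=> k; apply/measurable_EFinP; apply: measurable_cabs2; exact: cmeas_trunc.
- by move=> k x _; rewrite lee_fin sqr_ge0.
- move=> x _ k l kl; rewrite lee_fin.
  have [Dx|Dx] := pselect (D k x).
    by rewrite !truncT//; exact: nD Dx.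
  by rewrite (truncF _ Dx) cabs0 expr0n sqr_ge0.
Qed.

(** Truncation is an orthogonal projection, so this is Pythagoras. *)
Lemma sqn_trunc_sub D f : measurable D -> L2g mu f ->
  sqn mu (fun x => trunc D f x - f x) = (nsq mu f - nsq mu (trunc D f))%:E.
Proof.
move=> mD lf; have lt := L2g_trunc mD lf.
rewrite (sqnE (L2gB lt lf)) nsqB//; congr _%:E.
have -> : ip mu (trunc D f) f = nsq mu (trunc D f).
  rewrite -(ip_id lt) /ip; congr complex.Re; apply: eq_cint => x.
  have [Dx|Dx] := pselect (D x); first by rewrite !truncT.
  by rewrite truncF// !mul0r.
ring.
Qed.

Lemma cvg_nsq_trunc (D : nat -> set T) f : (forall k, measurable (D k)) ->
  (forall k l, (k <= l)%N -> D k `<=` D l) -> (forall x, exists k, D k x) ->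
  L2g mu f -> (nsq mu (trunc (D k) f) @[k --> \oo] --> nsq mu f)%classic.
Proof.
move=> mD nD cD lf; apply/fine_cvg; rewrite -(sqnE lf).
by apply: cvg_sqn_trunc => //; case: lf.
Qed.

Lemma cvg_trunc_sub (D : nat -> set T) f : (forall k, measurable (D k)) ->
  (forall k l, (k <= l)%N -> D k `<=` D l) -> (forall x, exists k, D k x) ->
  L2g mu f -> (sqn mu (fun x => (trunc (D k) f x - f x)%R) @[k --> \oo] --> 0)%E%classic.
Proof.
move=> mD nD cD lf; under eq_fun do rewrite sqn_trunc_sub//.
apply: cvg_EFin; first exact: nearW.
rewrite -(subrr (nsq mu f)); apply: cvgB; first exact: cvg_cst.
exact: cvg_nsq_trunc.
Qed.

Lemma cvg_pairing (f_ : nat -> T -> R[i]) f g : (forall k, cmeas (f_ k)) ->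
  L2g mu f -> L2g mu g ->
  (sqn mu (fun x => (f_ k x - f x)%R) @[k --> \oo] --> 0)%E%classic ->
  (cabs (cint mu (fun x => f_ k x * g x) - cint mu (fun x => f x * g x)) @[k --> \oo] --> (0:R))%classic.
Proof.
move=> mf_ lf lg cf.
have s0 k : (0 <= sqn mu (fun x => (f_ k x - f x)%R))%E by exact: sqn_ge0.
(* The [f_ k] are only assumed measurable, but an extended norm that tends to 0 is finite from some
   k on. *)
have ld : \forall k \near \oo, L2g mu (fun x => f_ k x - f x).
  have := (cvge0P s0).1 cf 1 ltr01; apply: filterS => k h; split.
    by apply: cmeasB => //; case: lf.
  by apply: le_lt_trans h _; rewrite ltry.
have bound k : L2g mu (fun x => f_ k x - f x) ->
    cabs (cint mu (fun x => f_ k x * g x) - cint mu (fun x => f x * g x)) ^+ 2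
    <= nsq mu (fun x => f_ k x - f x) * nsq mu g.
  move=> ldk; have lfk : L2g mu (f_ k).
    by have := L2gD ldk lf; congr (L2g _ _); apply/funext => x; rewrite subrK.
  rewrite -cintB; [|exact: csummable_L2gM|exact: csummable_L2gM].
  rewrite (_ : cint mu _ = cint mu (fun x => (f_ k x - f x) * g x)).
    exact: cint_CS.
  by apply: eq_cint => x; rewrite mulrBl.
have cf' : (nsq mu (fun x => f_ k x - f x) * nsq mu g @[k --> \oo] --> (0:R))%classic.
  by rewrite -(mul0r (nsq mu g)); apply: cvgMr_tmp; exact/fine_cvg.
apply/cvgrPdist_le => eps eps0.
have e2 : 0 < eps ^+ 2 by rewrite exprn_gt0.
move/cvgrPdist_le : cf' => /(_ _ e2) cf'; near=> k.
have h : `|0 - nsq mu (fun x => f_ k x - f x) * nsq mu g| <= eps ^+ 2 by near: k.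
have lk : L2g mu (fun x => f_ k x - f x) by near: k.
move: h; rewrite !sub0r !normrN (ger0_norm (cabs_ge0 _)) => h.
rewrite -(@ler_pXn2r _ 2) ?nnegrE ?cabs_ge0 ?(ltW eps0)//.
by apply: (le_trans (bound k lk)); apply: le_trans h; exact: ler_norm.
Unshelve. all: by end_near. Qed.

Lemma cabs_cvg_unique (a : nat -> R[i]) (A B : R[i]) :
  (cabs (a k - A) @[k --> \oo] --> (0:R))%classic ->
  (cabs (a k - B) @[k --> \oo] --> (0:R))%classic -> A = B.
Proof.
move=> hA hB; apply/eqP; rewrite -subr_eq0; apply/eqP/cabs_eq0.
have : (cabs (a k - A) + cabs (a k - B) @[k --> \oo] --> (0 + 0:R))%classic by exact: cvgD.
rewrite addr0 => h; apply/eqP; rewrite eq_le cabs_ge0 andbT.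
apply/ler_addgt0Pr => e e0; rewrite add0r.
move/cvgrPdist_le : h => /(_ _ e0)[N _ /(_ N (leqnn N))]/=.
rewrite sub0r normrN; apply: le_trans; apply: le_trans (ler_norm _).
have -> : A - B = (a N - B) + (- (a N - A)) by ring.
by apply: (le_trans (cabsD _ _)); rewrite cabsN addrC.
Qed.

Lemma cabs_cvg_eq (a b : nat -> R[i]) (A B : R[i]) : (forall k, a k = b k) ->
  (cabs (a k - A) @[k --> \oo] --> (0:R))%classic ->
  (cabs (b k - B) @[k --> \oo] --> (0:R))%classic -> A = B.
Proof. by move=> /funext <-; exact: cabs_cvg_unique. Qed.

Lemma sqn_eq0_ae f g : cmeas f -> cmeas g -> sqn mu (fun x => f x - g x) = 0%E ->
  f = g %[ae mu].
Proof.
move=> mf mg s0; have md := cmeasB mf mg.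
have := @ae_eq_integral_abs _ _ _ mu setT measurableT (fun x => (cabs (f x - g x) ^+ 2)%:E) _.
have E : (\int[mu]_x `|(cabs (f x - g x) ^+ 2)%:E| = 0)%E.
  by rewrite -s0; apply: eq_integral => x _; rewrite gee0_abs// lee_fin sqr_ge0.
move=> /(_ _)[|h _]; first by apply/measurable_EFinP; exact: measurable_cabs2.
apply: filterS (h E) => x /(_ I) [] /eqP; rewrite expf_eq0/= => /eqP/cabs_eq0/eqP.
by rewrite subr_eq0 => /eqP.
Qed.

End L2_limits.

Section Lp_norm.
Context {R : realType} {n : nat}.
Local Notation mu := (leb R n).
Implicit Types f u v : n.-tuple R -> R[i].

Lemma poweR_Lp_norm2 f : (Lp_norm 2 f `^ 2)%E = sqn mu f.
Proof.
rewrite /Lp_norm poweR_Lnorm// integral_lebE; apply: eq_integral => x _.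
by rewrite /= ger0_norm ?cabs_ge0// powR_mulrn ?cabs_ge0.
Qed.

Lemma Lp_norm_ge0 p f : (0 <= Lp_norm p f)%E.
Proof. exact: Lnorm_ge0. Qed.

Lemma Lp_norm2E f : Lp_norm 2 f = (sqn mu f `^ (2^-1))%E.
Proof. by rewrite -poweR_Lp_norm2 -poweRrM divff// poweRe1// Lp_norm_ge0. Qed.

Lemma L2P f : L2 f <-> L2g mu f.
Proof.
split=> -[mf h]; split => //.
  by rewrite -poweR_Lp_norm2; exact: poweR_lty.
by rewrite Lp_norm2E; exact: poweR_lty.
Qed.

Lemma cvgL2P (f_ : nat -> n.-tuple R -> R[i]) f : cvgL2 f_ f <->
  (sqn mu (fun x => (f_ k x - f x)%R) @[k --> \oo] --> 0)%E%classic.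
Proof.
have s0 k : (0 <= sqn mu (fun x => (f_ k x - f x)%R))%E by exact: sqn_ge0.
have l0 k : (0 <= Lp_norm 2 (fun x => (f_ k x - f x)%R))%E by exact: Lp_norm_ge0.
split=> h.
  apply/(cvge0P s0) => eps eps0.
  have se : 0 < Num.sqrt eps by rewrite sqrtr_gt0.
  have := (cvge0P l0).1 h _ se; apply: filterS => k hk.
  rewrite -poweR_Lp_norm2.
  have -> : eps%:E = ((Num.sqrt eps)%:E `^ 2)%E.
    by rewrite poweR_EFin powR_mulrn ?sqrtr_ge0// sqr_sqrtr// ltW.
  by apply: gt0_ler_poweR => //; rewrite in_itv/= ?l0 ?leey// lee_fin sqrtr_ge0.
apply/(cvge0P l0) => eps eps0.
have se : 0 < eps ^+ 2 by rewrite exprn_gt0.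
have := (cvge0P s0).1 h _ se; apply: filterS => k hk.
rewrite Lp_norm2E.
have -> : eps%:E = ((eps ^+ 2)%:E `^ 2^-1)%E.
  by rewrite poweR_EFin powR12_sqrt ?sqr_ge0// sqrtr_sqr gtr0_norm.
by apply: gt0_ler_poweR => //; rewrite ?in_itv/= ?s0 ?leey// ?invr_ge0// lee_fin sqr_ge0.
Qed.

Lemma Lp_norm2_le (M : R) u v : L2g mu u -> L2g mu v ->
  (Lp_norm 2 v <= M%:E * Lp_norm 2 u)%E -> nsq mu v <= M ^+ 2 * nsq mu u.
Proof.
move=> lu lv h.
have e f : L2g mu f -> Lp_norm 2 f = (Num.sqrt (nsq mu f))%:E.
  by move=> lf; rewrite Lp_norm2E (sqnE lf) poweR_EFin powR12_sqrt ?nsq_ge0.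
move: h; rewrite (e _ lu) (e _ lv) -EFinM lee_fin => h.
have := sqr_ge0 (Num.sqrt (nsq mu v)).
rewrite -[nsq mu v]sqr_sqrtr ?nsq_ge0// -[nsq mu u]sqr_sqrtr ?nsq_ge0// -exprMn.
by move=> _; rewrite ler_pXn2r ?nnegrE ?sqrtr_ge0//; apply: le_trans h; exact: sqrtr_ge0.
Qed.

End Lp_norm.

Section balls.
Context {R : realType}.

(** [fourier_trunc] cuts off at balls and [bcs] at cubes; [eball_cube] and [cube_eball] mediate
    between them. *)
Definition eball n (r : R) : set (n.-tuple R) := [set x | enorm x <= r].

Lemma measurable_enorm n : measurable_fun setT (@enorm R n).
Proof.
apply: measurableT_comp; first exact: measurable_sqrt.
by apply: measurable_sum => i; apply: measurable_funX; exact: measurable_tnth.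
Qed.

Lemma enorm_ge0 n (x : n.-tuple R) : 0 <= enorm x. Proof. exact: sqrtr_ge0. Qed.

Lemma measurable_eball n r : measurable (@eball n r).
Proof.
rewrite (_ : eball r = (@enorm R n) @^-1` `]-oo, r]); last first.
  by apply/seteqP; split => x /=; rewrite in_itv.
by rewrite -[X in measurable X]setTI; exact: measurable_enorm.
Qed.

Lemma eball_cube n r : @eball n r `<=` cube n r.
Proof.
move=> x xr i; apply: le_trans xr; rewrite -sqrtr_sqr /enorm ler_wsqrtr//.
by rewrite (bigD1 i)//= lerDl sumr_ge0// => j _; exact: sqr_ge0.
Qed.

Lemma cube_eball n r : 0 <= r -> cube n r `<=` @eball n (n%:R * r).
Proof.
move=> r0 x xr; rewrite /eball/= -(@ler_pXn2r _ 2) ?nnegrE ?enorm_ge0 ?mulr_ge0//.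
rewrite sqr_sqrtr; last by apply: sumr_ge0 => j _; exact: sqr_ge0.
apply: (@le_trans _ _ (\sum_(i < n) r ^+ 2)).
  by apply: ler_sum => i _; rewrite -real_normK ?num_real// ler_pXn2r ?nnegrE.
rewrite sumr_const card_ord -[leLHS]mulr_natl exprMn ler_wpM2r ?sqr_ge0//.
by rewrite expr2 -natrM ler_nat; case: n {x xr} => // n; rewrite leq_pmulr.
Qed.

Lemma eball_lty n r : (leb R n (@eball n r) < +oo)%E.
Proof.
apply: (@le_lt_trans _ _ (leb R n (cube n r))); last exact: lebesgue_tuple_cube.
apply: le_measure; rewrite ?inE; [exact: measurable_eball|exact: measurable_cube|exact: eball_cube].
Qed.

Lemma eballS n (k l : nat) : (k <= l)%N -> @eball n k%:R `<=` @eball n l%:R.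
Proof. by move=> kl x /= h; apply: (le_trans h); rewrite ler_nat. Qed.

Lemma eball_cover n (x : n.-tuple R) : exists k : nat, eball k%:R x.
Proof. by exists (Num.bound (enorm x)); apply/ltW/archi_boundP/enorm_ge0. Qed.

End balls.

(** * Fourier inversion and Parseval's identity *)

Section fourier_inversion.
Context {R : realType} {n : nat}.
Local Notation mu := (leb R n).
Local Notation B k := (@eball R n k%:R).
Implicit Types u w psi : n.-tuple R -> R[i].

Definition finv psi := kadj mu (@fker R n) psi.

Lemma dotpC (x y : n.-tuple R) : dotp x y = dotp y x.
Proof. by apply: eq_bigr => i _; rewrite mulrC. Qed.

Lemma finvE psi x : csummable mu psi ->
  finv psi x = conjc (fourier (fun xi => conjc (psi xi)) x).
Proof.
move=> sp; rewrite /fourier /kop -cint_conj.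
  by apply: eq_cint => xi; rewrite [RHS]conjcM conjcK /fker/= dotpC.
exact: (csummable_kop (@cmeas_fker R n) (@cabs_fker R n) x (csummable_conj sp)).
Qed.

Lemma fourierE psi x : csummable mu psi ->
  fourier psi x = conjc (finv (fun xi => conjc (psi xi)) x).
Proof.
move=> sp; rewrite finvE; last exact: csummable_conj.
by rewrite conjcK; congr (fourier _ x); apply/funext => y; rewrite conjcK.
Qed.

Lemma bcs_conj psi : bcs psi -> bcs (fun xi => conjc (psi xi)).
Proof.
move=> [mp [M pM] [k k0 pk]]; split; first exact: cmeas_conj.
  by exists M => x; rewrite cabs_conj.
by exists k => // x /pk ->; rewrite conjc0.
Qed.

Lemma bcs_L2g psi : bcs psi -> L2g mu psi.
Proof. by move=> bp; exact/bfs_L2g/bcs_bfs. Qed.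

Lemma bcs_csummable psi : bcs psi -> csummable mu psi.
Proof. by move=> bp; exact/bfs_csummable/bcs_bfs. Qed.

Lemma bcs_trunc (k : nat) f M : cmeas f -> (forall x, cabs (f x) <= M) -> bcs (trunc (B k) f).
Proof.
move=> mf fM; split.
- by apply: cmeas_trunc => //; exact: measurable_eball.
- by exists M => x; apply: (le_trans (cabs_trunc _ _ _)).
- exists k%:R => // x h; apply: truncF => /eball_cube; exact: h.
Qed.

Lemma bcsMb g psi c : bcs psi -> cmeas g -> (forall x, psi x != 0 -> cabs (g x) <= c) ->
  bcs (fun x => g x * psi x).
Proof.
move=> [mp [M pM] [k k0 pk]] mg gc; split; first exact: cmeasM.
  exists (`|c| * `|M|) => x; rewrite cabsM.
  have [->|p0] := eqVneq (psi x) 0; first by rewrite cabs0 mulr0 mulr_ge0.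
  apply: ler_pM; rewrite ?cabs_ge0//.
    by apply: (le_trans (gc _ p0)); exact: ler_norm.
  by apply: (le_trans (pM _)); exact: ler_norm.
by exists k => // x /pk ->; rewrite mulr0.
Qed.

Lemma fourier_bounded u : csummable mu u ->
  exists M, forall xi, cabs (fourier u xi) <= M.
Proof.
move=> su; exists (fnorm n * \int[mu]_x cabs (u x)) => xi.
exact: (kop_le (@cmeas_fker R n) (@cabs_fker R n) xi su).
Qed.

Lemma finv_bounded psi : csummable mu psi ->
  exists M, forall xi, cabs (finv psi xi) <= M.
Proof.
move=> sp; have [M hM] := fourier_bounded (csummable_conj sp); exists M => x.
by rewrite finvE// cabs_conj.
Qed.

Lemma cmeas_finv psi : cmeas psi -> cmeas (finv psi).
Proof. by move=> mp; exact: (cmeas_kop mu (cmeas_eswap (@cmeas_fker R n)) mp). Qed.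

Lemma plancherel_finv psi : bcs psi -> sqn mu (finv psi) = sqn mu psi.
Proof.
move=> bp; have sp := bcs_csummable bp.
rewrite -[RHS]sqn_conj -(plancherel (bcs_conj bp)) -[RHS]sqn_conj; congr sqn.
by apply/funext => x; rewrite finvE.
Qed.

Lemma L2g_fourier u : bcs u -> L2g mu (fourier u).
Proof.
move=> bu; split; first exact/cmeas_fourier/(bfs_meas (bcs_bfs bu)).
by rewrite plancherel//; case: (bcs_L2g bu).
Qed.

Lemma L2g_finv psi : bcs psi -> L2g mu (finv psi).
Proof.
move=> bu; split; first exact/cmeas_finv/(bfs_meas (bcs_bfs bu)).
by rewrite plancherel_finv//; case: (bcs_L2g bu).
Qed.

Lemma fourier_adj u psi : csummable mu u -> csummable mu psi ->
  cint mu (fun xi => fourier u xi * conjc (psi xi)) = cint mu (fun x => u x * conjc (finv psi x)).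
Proof. exact: (kop_adj (@cmeas_fker R n) (@cabs_fker R n)). Qed.

(* By Plancherel and adjointness, the squared distance is
   [nsq psi - nsq (trunc (B k) (finv psi))]. *)
Lemma cvg_fourier_trunc_finv psi : bcs psi ->
  (sqn mu (fun xi => (fourier (trunc (B k) (finv psi)) xi - psi xi)%R) @[k --> \oo] --> 0)%E%classic.
Proof.
move=> bp; have sp := bcs_csummable bp; have lp := bcs_L2g bp; have lg := L2g_finv bp.
have [M hM] := finv_bounded sp.
have bt k : bcs (trunc (B k) (finv psi)).
  by apply: (bcs_trunc _ _ hM); apply: cmeas_finv; case: lp.
have E k : sqn mu (fun xi => (fourier (trunc (B k) (finv psi)) xi - psi xi)%R) =
    sqn mu (fun x => (trunc (B k) (finv psi) x - finv psi x)%R).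
  have lF := L2g_fourier (bt k).
  rewrite (sqnE (L2gB lF lp)) (nsqB lF lp) (sqn_trunc_sub (@measurable_eball R n k%:R) lg).
  have e1 : nsq mu (fourier (trunc (B k) (finv psi))) = nsq mu (trunc (B k) (finv psi)).
    by rewrite /nsq (plancherel (bt k)).
  have e2 : nsq mu (finv psi) = nsq mu psi by rewrite /nsq (plancherel_finv bp).
  have e3 : ip mu (fourier (trunc (B k) (finv psi))) psi = nsq mu (trunc (B k) (finv psi)).
    rewrite /ip (fourier_adj (bcs_csummable (bt k)) sp).
    rewrite -(ip_id (bcs_L2g (bt k))) /ip; congr complex.Re; apply: eq_cint => x.
    have [Dx|Dx] := pselect (B k x); first by rewrite !truncT.
    by rewrite (truncF _ Dx) !mul0r.
  by rewrite e1 e2 e3; congr _%:E; ring.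
under eq_fun do rewrite E.
apply: cvg_trunc_sub => //.
- by move=> k; exact: measurable_eball.
- by move=> k l; exact: eballS.
- exact: eball_cover.
Qed.

(** Conjugation exchanges [fourier] and [finv], which reduces this to [cvg_fourier_trunc_finv]. *)
Lemma cvg_finv_trunc_fourier u : bcs u ->
  (sqn mu (fun x => (finv (trunc (B k) (fourier u)) x - u x)%R) @[k --> \oo] --> 0)%E%classic.
Proof.
move=> bu; have this0 := cvg_fourier_trunc_finv (bcs_conj bu).
have su := bcs_csummable bu; have [M hM] := fourier_bounded su.
have bt k : bcs (trunc (B k) (fourier u)).
  by apply: (bcs_trunc _ _ hM); apply: cmeas_fourier; exact: csummable_meas su.
have E k : sqn mu (fun x => (finv (trunc (B k) (fourier u)) x - u x)%R) =
    sqn mu (fun xi => (fourier (trunc (B k) (finv (fun x => conjc (u x)))) xi - conjc (u xi))%R).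
  have cB (a b : R[i]) : conjc (a - conjc b) = conjc a - b by rewrite rmorphB/= conjcK.
  have h2 : (fun xi => conjc (trunc (B k) (fourier u) xi)) = trunc (B k) (finv (fun x => conjc (u x))).
    apply/funext => y; have [By|By] := pselect (B k y).
      by rewrite !truncT// (fourierE y su) conjcK.
    by rewrite !truncF// conjc0.
  rewrite -[RHS]sqn_conj; congr sqn; apply/funext => x.
  by rewrite (finvE x (bcs_csummable (bt k))) h2 cB.
rewrite (funext E); exact: this0.
Qed.

Lemma fourier_truncE f k : L2 f -> fourier_trunc f k = fourier (trunc (B k) f).
Proof.
move=> /L2P lf; apply/funext => xi.
have lt := csummable_trunc (@measurable_eball R n k%:R) (@eball_lty R n k%:R) lf.
have sk : csummable mu (fun x => expi (- dotp x xi) * trunc (B k) f x).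
  apply: (csummableMb (c := 1) lt).
    apply: cmeas_expi; apply: measurableT_comp => //.
    exact: (measurableT_comp (@measurable_dotp R n) (pair2_measurable xi)).
  by move=> x; rewrite cabs_expi.
rewrite /fourier_trunc /fourier /kop /fker.
rewrite (@eq_cint _ _ _ mu _ (fun x => (fnorm n)%:C * (expi (- dotp x xi) * trunc (B k) f x))); last first.
  by move=> x; rewrite /= mulrA.
rewrite cintZ//; congr (_ * _).
have E (h1 h2 : n.-tuple R -> R) : (forall x, B k x -> h1 x = h2 x) ->
    (forall x, ~ B k x -> h2 x = 0) ->
    \int[lebesgue_tuple R n]_(x in [set x | enorm x <= k%:R]) h1 x = \int[mu]_x h2 x.
  move=> h12 h20; rewrite Rintegral_mkcond /Rintegral integral_lebE; congr fine.
  apply: eq_integral => x _; rewrite patchE; case: ifPn => [|/negP] h.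
    by rewrite h12//; rewrite inE in h.
  by rewrite h20// => h'; apply: h; rewrite inE.
apply: eqcP; apply: E => x Bx.
- by rewrite truncT// mulrC.
- by rewrite truncF// mulr0.
- by rewrite truncT// mulrC.
- by rewrite truncF// mulr0.
Qed.

(** It supplies functions with a prescribed Plancherel transform, from which elements of the domain
    of [H0] are made. *)
Lemma is_fourier_finv psi : bcs psi -> is_fourier (finv psi) psi.
Proof.
move=> bp; have lf := L2g_finv bp; split.
- exact/L2P.
- exact/L2P/bcs_L2g.
- have E k : sqn mu (fun x => fourier_trunc (finv psi) k x - psi x) =
      sqn mu (fun xi => fourier (trunc (B k) (finv psi)) xi - psi xi).
    by rewrite (fourier_truncE k ((L2P _).2 lf)).
  by apply/cvgL2P; rewrite (funext E); exact: cvg_fourier_trunc_finv.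
Qed.

Lemma trunc_bcs u : bcs u -> exists N, forall k : nat, (N <= k)%N -> trunc (B k) u = u.
Proof.
move=> [_ _ [r r0 ur]]; exists (Num.bound (n%:R * r)) => k Nk.
apply/funext => x; have [Bx|Bx] := pselect (B k x); first by rewrite truncT.
rewrite truncF// ur// => cx; apply: Bx; apply: (le_trans (cube_eball r0 cx)).
apply: (@le_trans _ _ (Num.bound (n%:R * r))%:R); last by rewrite ler_nat.
by apply/ltW/archi_boundP; rewrite mulr_ge0.
Qed.

(** The truncations of [u] are eventually [u] itself, so the sequence whose limit is [g] is
    eventually constant. *)
Lemma is_fourier_bcs u g : bcs u -> is_fourier u g -> g = fourier u %[ae mu].
Proof.
move=> bu [lu lg /cvgL2P cg]; have [N hN] := trunc_bcs bu.
have [mg _] := lg; have mF := cmeas_fourier (bfs_meas (bcs_bfs bu)).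
apply: sqn_eq0_ae => //.
have -> : sqn mu (fun x => g x - fourier u x) = sqn mu (fun x => fourier u x - g x).
  by rewrite -sqnN; congr sqn; apply/funext => x; rewrite opprB.
apply: (@cvg_unique _ _ _ _ _ _ _ cg) => //.
apply: cvg_near_cst; exists N => // k /= Nk.
by rewrite (fourier_truncE k lu) (hN k Nk).
Qed.

(** The transform of [w] is only a limit. Replace [c] by [finv (trunc (B N) (fourier c))], for which
    adjointness applies to the truncations of [w]; let these grow first ([step]), then let N tend to
    infinity. *)
Lemma parseval w wh c : is_fourier w wh -> bcs c ->
  cint mu (fun x => w x * conjc (c x)) = cint mu (fun xi => wh xi * conjc (fourier c xi)).
Proof.
move=> [lw' lwh' /cvgL2P cw] bc; have lw := (L2P _).1 lw'; have lwh := (L2P _).1 lwh'.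
have sc := bcs_csummable bc; have [M hM] := fourier_bounded sc.
have mE k : measurable (B k) := @measurable_eball R n k%:R.
have bd N : bcs (trunc (B N) (fourier c)).
  by apply: (bcs_trunc _ _ hM); apply: cmeas_fourier; exact: csummable_meas sc.
have step N : cint mu (fun x => w x * conjc (finv (trunc (B N) (fourier c)) x)) =
    cint mu (fun xi => wh xi * conjc (trunc (B N) (fourier c) xi)).
  have ld := bcs_L2g (bd N).
  apply: (@cabs_cvg_eq R (fun k => cint mu (fun x => trunc (B k) w x * conjc (finv (trunc (B N) (fourier c)) x)))
      (fun k => cint mu (fun xi => fourier_trunc w k xi * conjc (trunc (B N) (fourier c) xi)))).
  - move=> k; rewrite (fourier_truncE k lw') fourier_adj; [by []| |exact: (bcs_csummable (bd N))].
    exact: (csummable_trunc (mE k) (@eball_lty R n k%:R) lw).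
  - apply: (cvg_pairing _ lw).
    + by move=> k; exact: (cmeas_trunc (mE k) lw.1).
    + exact/L2g_conj/L2g_finv.
    + apply: (cvg_trunc_sub mE _ _ lw); last exact: eball_cover.
      by move=> k l; exact: eballS.
  - apply: (cvg_pairing _ lwh _ cw); last exact: L2g_conj.
    by move=> k; rewrite (fourier_truncE k lw'); apply: cmeas_fourier; exact: (cmeas_trunc (mE k) lw.1).
have lF := L2g_fourier bc.
have swap f1 f2 : cint mu (fun x => f1 x * conjc (f2 x)) = cint mu (fun x => conjc (f2 x) * f1 x).
  by apply: eq_cint => x; rewrite mulrC.
apply: (@cabs_cvg_eq R (fun N => cint mu (fun x => conjc (finv (trunc (B N) (fourier c)) x) * w x))
   (fun N => cint mu (fun xi => conjc (trunc (B N) (fourier c) xi) * wh xi))).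
- by move=> N; rewrite -!swap.
- rewrite swap; apply: (cvg_pairing _ _ lw).
  + by move=> N; apply: cmeas_conj; apply: cmeas_finv; exact: (bfs_meas (bcs_bfs (bd N))).
  + by apply: L2g_conj; exact: bcs_L2g.
  + have E N : sqn mu (fun x => conjc (finv (trunc (B N) (fourier c)) x) - conjc (c x)) =
       sqn mu (fun x => finv (trunc (B N) (fourier c)) x - c x).
      by rewrite -[RHS]sqn_conj; congr sqn; apply/funext => x; rewrite rmorphB.
    by rewrite (funext E); exact: cvg_finv_trunc_fourier.
- rewrite swap; apply: (cvg_pairing _ _ lwh).
  + by move=> N; apply: cmeas_conj; exact: (bfs_meas (bcs_bfs (bd N))).
  + exact: L2g_conj.
  + have E N : sqn mu (fun x => conjc (trunc (B N) (fourier c) x) - conjc (fourier c x)) =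
       sqn mu (fun x => trunc (B N) (fourier c) x - fourier c x).
      by rewrite -[RHS]sqn_conj; congr sqn; apply/funext => x; rewrite rmorphB.
    rewrite (funext E); apply: (cvg_trunc_sub mE _ _ lF); last exact: eball_cover.
    by move=> k l; exact: eballS.
Qed.

End fourier_inversion.

(** * The Birman-Schwinger operator *)

Section resolvent.
Context {R : realType} {n : nat}.
Local Notation mu := (leb R n).
Local Notation B k := (@eball R n k%:R).
Variables (m : R) (z : R[i]).
Hypotheses (m0 : 0 < m) (zh : ~ halfline z).

Definition symb (xi : n.-tuple R) : R := enorm xi `^ (2 * m).

Definition rsymb (xi : n.-tuple R) : R[i] := ((symb xi)%:C - z)^-1.

Lemma dist_halfline : exists2 delta, 0 < delta & forall r : R, 0 <= r -> delta <= cabs (r%:C - z).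
Proof.
have [zi|zi] := eqVneq (complex.Im z) 0.
  have zr : complex.Re z < 0.
    rewrite ltNge; apply/negP => h; apply: zh; rewrite /halfline/= lecE/= zi eqxx//.
  exists (- complex.Re z); first by rewrite oppr_gt0.
  move=> r r0; apply: le_trans (Re_le_cabs _); apply: le_trans (ler_norm _).
  by rewrite ReD ReN/= lerDr.
exists `|complex.Im z|; first by rewrite normr_gt0.
by move=> r r0; apply: le_trans (Im_le_cabs _); rewrite ImD ImN/= add0r normrN.
Qed.

Lemma symb_ge0 xi : 0 <= symb xi. Proof. exact: powR_ge0. Qed.

Lemma symb_neq0 xi : (symb xi)%:C - z != 0.
Proof.
have [del d0 hd] := dist_halfline; apply/eqP => h.
by have := hd _ (symb_ge0 xi); rewrite h cabs0 leNgt d0.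
Qed.

Lemma measurable_symb : measurable_fun setT symb.
Proof.
apply: (measurableT_comp (measurable_powR (2 * m))); exact: measurable_enorm.
Qed.

Lemma cabsV (w : R[i]) : cabs w^-1 = (cabs w)^-1.
Proof. exact: ComplexField.Normc.normcV. Qed.

Lemma rsymb_bounded : exists c, forall xi, cabs (rsymb xi) <= c.
Proof.
have [del d0 hd] := dist_halfline; exists del^-1 => xi.
by rewrite cabsV lef_pV2 ?posrE ?cabs_gt0 ?symb_neq0// hd ?symb_ge0.
Qed.

Lemma cmeas_inv d (T : measurableType d) (f : T -> R[i]) : cmeas f -> cmeas (fun x => (f x)^-1).
Proof.
move=> mf.
have mi : measurable_fun setT (fun x => (cabs (f x) ^+ 2)^-1).
  rewrite (_ : (fun _ => _) = (fun x => (cabs (f x) ^+ 2) `^ (-1))); last first.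
    by apply/funext => x; rewrite powR_inv1// sqr_ge0.
  by apply: (measurableT_comp (measurable_powR (-1))); exact: measurable_cabs2.
rewrite (_ : (fun _ => _) = (fun x => ((cabs (f x) ^+ 2)^-1)%:C * conjc (f x))).
  by apply: cmeasM; [exact: cmeas_real|exact: cmeas_conj].
apply/funext => x; have [->|f0] := eqVneq (f x) 0.
  by rewrite invr0 conjc0 mulr0.
have c0 : (cabs (f x) ^+ 2)%:C != 0 :> R[i].
  by rewrite -mulc_conj mulf_neq0// conjc_eq0.
apply: (mulfI f0); rewrite divff// mulrCA mulc_conj -complex_realM mulVf//.
by rewrite expf_neq0// gt_eqF// cabs_gt0.
Qed.

Lemma cmeas_rsymb : cmeas rsymb.
Proof.
apply: cmeas_inv; apply: cmeasB; last exact: cmeas_cst.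
by apply: cmeas_real; exact: measurable_symb.
Qed.

Lemma finvD f g x : csummable mu f -> csummable mu g ->
  finv (fun xi => f xi + g xi) x = finv f x + finv g x.
Proof. by move=> sf sg; exact: (kopD (cmeas_eswap (@cmeas_fker R n)) (eswap_le (@cabs_fker R n)) x sf sg). Qed.

Lemma finvZ a f x : csummable mu f -> finv (fun xi => a * f xi) x = a * finv f x.
Proof. by move=> sf; exact: (kopZ (cmeas_eswap (@cmeas_fker R n)) (eswap_le (@cabs_fker R n)) a x sf). Qed.

Lemma fourierD f g x : csummable mu f -> csummable mu g ->
  fourier (fun xi => f xi + g xi) x = fourier f x + fourier g x.
Proof. by move=> sf sg; exact: (kopD (@cmeas_fker R n) (@cabs_fker R n) x sf sg). Qed.

Lemma fourierZ a f x : csummable mu f -> fourier (fun xi => a * f xi) x = a * fourier f x.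
Proof. by move=> sf; exact: (kopZ (@cmeas_fker R n) (@cabs_fker R n) a x sf). Qed.

Lemma bcs_bounded_on psi (h : n.-tuple R -> R) (k : nat) c : bcs psi ->
  (forall x, ~ B k x -> psi x = 0) -> measurable_fun setT h ->
  (forall x, B k x -> `|h x| <= c) -> bcs (fun x => (h x)%:C * psi x).
Proof.
move=> bp p0 mh hc; apply: (bcsMb (c := c) bp); first exact: cmeas_real.
move=> x px; rewrite cabs_real; apply: hc.
by apply: contrapT => /p0 e; rewrite e eqxx in px.
Qed.

(** On transforms supported in a ball every multiplier is bounded, so the resolvent is explicit and
    the Sobolev condition holds. *)
Lemma shift_H0_finv psi (k : nat) : bcs psi -> (forall xi, ~ B k xi -> psi xi = 0) ->
  op_shift (H0 m) z (finv (fun xi => rsymb xi * psi xi)) (finv psi).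
Proof.
move=> bp p0; have [c rc] := rsymb_bounded.
pose uh xi := rsymb xi * psi xi.
have bu : bcs uh by apply: (bcsMb (c := c) bp) => //; exact: cmeas_rsymb.
have u0 xi : ~ B k xi -> uh xi = 0 by move=> /p0 e; rewrite /uh e mulr0.
have bpu : bcs (fun xi => (symb xi)%:C * uh xi).
  apply: (@bcs_bounded_on _ _ k (k%:R `^ (2 * m)) bu u0 measurable_symb) => x Bx.
  rewrite ger0_norm ?symb_ge0//; apply: ge0_ler_powR => //; rewrite ?nnegrE ?enorm_ge0//.
  by rewrite mulr_ge0// ltW.
have e : (fun xi => (symb xi)%:C * uh xi) = (fun xi => psi xi + z * uh xi).
  apply/funext => xi; transitivity (((symb xi)%:C - z) * uh xi + z * uh xi); first ring.
  by congr (_ + _); rewrite /uh mulrA /rsymb divff ?symb_neq0// mul1r.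
have sp := bcs_csummable bp; have su := bcs_csummable bu.
exists (finv (fun xi => (symb xi)%:C * uh xi)); split; last first.
  apply/funext => x; rewrite e finvD//; last exact: csummableZ.
  by rewrite finvZ// addrK.
split.
  exists uh; split; first exact: is_fourier_finv.
  apply/L2P/bcs_L2g.
  apply: (@bcs_bounded_on _ _ k ((1 + k%:R ^+ 2) `^ (2 * m / 2)) bu u0).
    apply: (measurableT_comp (measurable_powR (2 * m / 2))).
    by apply: measurable_funD => //; apply: measurable_funX; exact: measurable_enorm.
  move=> x Bx; rewrite ger0_norm ?powR_ge0//; apply: ge0_ler_powR.
  - by rewrite mulrAC divff// mul1r ltW.
  - by rewrite nnegrE addr_ge0// sqr_ge0.
  - by rewrite nnegrE addr_ge0// sqr_ge0.
  - by rewrite lerD2l ler_pXn2r ?nnegrE ?enorm_ge0.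
exists uh; first exact: is_fourier_finv.
exact: is_fourier_finv.
Qed.

(* [H0 - z] is Fredholm, hence has closed range: it suffices to solve for the
   truncations of the Fourier transform of [v]. *)
Lemma exists_resolvent (v : n.-tuple R -> R[i]) : fredholm (op_shift (@H0 R n m) z) ->
  bcs v -> exists w, op_shift (H0 m) z w v.
Proof.
move=> [_ cl _] bv.
have [M hM] := fourier_bounded (bcs_csummable bv).
have bt k : bcs (trunc (B k) (fourier v)).
  by apply: (bcs_trunc _ _ hM); apply: cmeas_fourier; exact: (bfs_meas (bcs_bfs bv)).
apply: (cl (fun k => finv (fun xi => rsymb xi * trunc (B k) (fourier v) xi))
  (fun k => finv (trunc (B k) (fourier v)))).
- by move=> k; apply: (@shift_H0_finv _ k (bt k)) => xi; exact: truncF.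
- exact/L2P/bcs_L2g.
- by apply/cvgL2P; exact: cvg_finv_trunc_fourier.
Qed.

Lemma is_fourier_sub (f fh h hh : n.-tuple R -> R[i]) a : is_fourier f fh -> is_fourier h hh ->
  is_fourier (fun x => f x - a * h x) (fun x => fh x - a * hh x).
Proof.
move=> [/L2P lf /L2P lfh /cvgL2P cf] [/L2P lh /L2P lhh /cvgL2P ch].
have ld : L2g mu (fun x => f x - a * h x) by apply: L2gB => //; exact: L2gZ.
have ldh : L2g mu (fun x => fh x - a * hh x) by apply: L2gB => //; exact: L2gZ.
split; [exact/L2P|exact/L2P|apply/cvgL2P].
have mE k : measurable (B k) := @measurable_eball R n k%:R.
have st (u : n.-tuple R -> R[i]) k : L2g mu u -> csummable mu (trunc (B k) u).
  by move=> lu; exact: (csummable_trunc (mE k) (@eball_lty R n k%:R) lu).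
have mF (u : n.-tuple R -> R[i]) k : L2g mu u -> cmeas (fourier (trunc (B k) u)).
  by move=> lu; exact: (cmeas_fourier (cmeas_trunc (mE k) lu.1)).
have E k : (fun x => fourier_trunc (fun x => f x - a * h x) k x - (fh x - a * hh x)) =
   (fun x => (fourier (trunc (B k) f) x - fh x) + (- a) * (fourier (trunc (B k) h) x - hh x)).
  rewrite (fourier_truncE k ((L2P _).2 ld)); apply/funext => x.
  have -> : trunc (B k) (fun x => f x - a * h x) = (fun x => trunc (B k) f x + (- a) * trunc (B k) h x).
    by apply/funext => y; rewrite /trunc; ring.
  rewrite fourierD; [|exact: st|exact/csummableZ/st].
  by rewrite fourierZ; [ring|exact: st].
pose bnd k := (2%:E * sqn mu (fun x => (fourier_trunc f k x - fh x)%R) +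
   (2 * cabs a ^+ 2)%:E * sqn mu (fun x => (fourier_trunc h k x - hh x)%R))%E.
have ub k : (sqn mu (fun x => (fourier_trunc (fun x => (f x - a * h x)%R) k x - (fh x - a * hh x))%R) <=
   bnd k)%E.
  have m1 : cmeas (fun x => fourier (trunc (B k) f) x - fh x).
    by apply: cmeasB; [exact: mF|case: lfh].
  have m2 : cmeas (fun x => fourier (trunc (B k) h) x - hh x).
    by apply: cmeasB; [exact: mF|case: lhh].
  rewrite /bnd E (fourier_truncE k ((L2P _).2 lf)) (fourier_truncE k ((L2P _).2 lh)).
  have := @sqnD _ _ _ mu _ _ 1 ltr01 m1 (cmeasM (cmeas_cst _ (- a)) m2).
  rewrite invr1 sqnZ// cabsN muleA -EFinM.
  by have -> : 1 + 1 = 2 :> R by [].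
apply: (@squeeze_cvge _ _ _ _ (cst 0%E) _ bnd _ _ (cvg_cst _)).
  by apply: nearW => k; rewrite sqn_ge0 ub.
rewrite /bnd -[X in _ --> X](adde0 0%E); apply: cvgeD => //.
  by rewrite -[X in _ --> X](mule0 2%:E); exact: cvgeZl.
by rewrite -[X in _ --> X](mule0 (2 * cabs a ^+ 2)%:E); exact: cvgeZl.
Qed.

(** [exists_resolvent] yields no formula for its solution; the equation (symb - z) wh = fourier v on
    the Fourier side determines the transform of any solution almost everywhere. *)
Lemma shift_H0_fourier (v w : n.-tuple R -> R[i]) : bcs v -> op_shift (H0 m) z w v ->
  exists wh, is_fourier w wh /\ wh = (fun xi => rsymb xi * fourier v xi) %[ae mu].
Proof.
move=> bv [v' [[_ [wh Fw Fv']] ev]]; exists wh; split => //.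
have := is_fourier_sub z Fv' Fw; rewrite -ev => /(is_fourier_bcs bv).
apply: filterS => xi /(_ I) h _.
rewrite -h /rsymb -mulrBl mulrA mulVf ?mul1r//; exact: symb_neq0.
Qed.

End resolvent.

(** * Power weights and the interpolated Fourier bound *)

Section power_weights.
Context d (T : measurableType d) (R : realType).
Variable mu : {measure set T -> \bar R}.
Variables (D : set T) (p : T -> R) (P e : R).
Hypotheses (mD : measurable D) (fD : (mu D < +oo)%E) (mp : measurable_fun setT p).
Hypotheses (p0 : forall x, 0 <= p x) (pP : forall x, D x -> p x <= P) (e0 : 0 <= e).

(** With e = alpha / 2 the weight is the indicator of [D] at s = 0 (0^0 being 1, also where [p]
    vanishes); on [D] it has square p^alpha at s = 1 and equals sqrt p at s = 1 / alpha. *)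
Definition pweights (s : R) (x : T) : R := \1_D x * p x `^ (e * s).

Lemma measurable_pweights s : measurable_fun setT (pweights s).
Proof.
apply: measurable_funM; first exact: measurable_indic.
exact: (measurableT_comp (measurable_powR (e * s)) mp).
Qed.

Lemma pweights_ge0 s x : 0 <= pweights s x.
Proof. by rewrite mulr_ge0// ?powR_ge0// indicE. Qed.

Lemma pweights_le s x : 0 <= s <= 1 -> pweights s x <= (1 + `|P|) `^ e * \1_D x.
Proof.
move=> /andP[s0 s1]; rewrite mulrC /pweights indicE.
have [xD|xD] := boolP (x \in D); last by rewrite !mul0r.
rewrite !mul1r; have P1 : 1 <= 1 + `|P| by rewrite lerDl.
(* A base of at least 1 lets the exponent grow from e s to e, so the bound does not depend on s. *)
apply: (@le_trans _ _ ((1 + `|P|) `^ (e * s))).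
  apply: ge0_ler_powR; rewrite ?nnegrE ?mulr_ge0// ?addr_ge0//.
  apply: (le_trans (pP _)); first by rewrite inE in xD.
  by apply: (le_trans (ler_norm _)); rewrite lerDr.
by apply: ler_powR => //; rewrite ler_piMr.
Qed.

Lemma bfs_indic_cst (c : R) : bfs mu (fun x => (c * \1_D x)%:C : R[i]).
Proof.
split.
- by apply: cmeas_real; apply: measurable_funM => //; exact: measurable_indic.
- exists `|c| => x; rewrite cabs_real normrM indicE; case: (_ \in _); rewrite ?normr1 ?mulr1//.
  by rewrite normr0 mulr0.
- by exists D; split => // x Dx; rewrite indicE memNset// mulr0.
Qed.

Lemma bfsr_pweights s : 0 <= s <= 1 -> bfsr mu (pweights s).
Proof.
move=> sI; have [m1 [M1 hM1] [E [mE fE uE]]] := bfs_indic_cst ((1 + `|P|) `^ e).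
split; first exact/cmeas_real/measurable_pweights.
  exists M1 => x; apply: le_trans (hM1 x); rewrite !cabs_real ger0_norm ?pweights_ge0//.
  by apply: (le_trans (pweights_le x sI)); exact: ler_norm.
by exists D; split => // x Dx; rewrite /pweights indicE memNset// mul0r.
Qed.

Lemma nsq_pweights_le s : 0 <= s <= 1 ->
  nsq mu (fun x => (pweights s x)%:C) <= nsq mu (fun x => ((1 + `|P|) `^ e * \1_D x)%:C).
Proof.
move=> sI; have l1 := bfs_L2g (bfsr_pweights sI); have l2 := bfs_L2g (bfs_indic_cst ((1 + `|P|) `^ e)).
rewrite -lee_fin -(sqnE l1) -(sqnE l2); apply: le_sqn; [by case: l1|by case: l2|].
move=> x; rewrite !cabs_real (ger0_norm (pweights_ge0 _ _)).
by apply: (le_trans (pweights_le x sI)); exact: ler_norm.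
Qed.

(** The base may vanish: the only delicate case is a zero sum of exponents, where both are zero. *)
Lemma powRD_ge0 (a x y : R) : 0 <= x -> 0 <= y -> a `^ (x + y) = a `^ x * a `^ y.
Proof.
move=> x0 y0; have [xy|xy] := eqVneq (x + y) 0; last by rewrite powRD// (negbTE xy).
have /eqP := xy; rewrite paddr_eq0// => /andP[/eqP-> /eqP->].
by rewrite addr0 !powRr0 mulr1.
Qed.

Lemma pweights_mid s t x : 0 <= s <= 1 -> 0 <= t <= 1 ->
  pweights s x * pweights t x = pweights ((s + t) / 2) x * pweights ((s + t) / 2) x.
Proof.
move=> /andP[s0 _] /andP[t0 _]; have st0 : 0 <= (s + t) / 2 by rewrite divr_ge0// addr_ge0.
rewrite /pweights; have E (i a b : R) : i * a * (i * b) = i * i * (a * b) by ring.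
have hs : 0 <= e * s by rewrite mulr_ge0.
have ht : 0 <= e * t by rewrite mulr_ge0.
have hr : 0 <= e * ((s + t) / 2) by rewrite mulr_ge0.
rewrite !E -!powRD_ge0//.
by have -> : e * s + e * t = e * ((s + t) / 2) + e * ((s + t) / 2) by field.
Qed.

Lemma sqn_pweights1 :
  sqn mu (fun x => (pweights 1 x)%:C) = (\int[mu]_(x in D) (p x `^ (2 * e))%:E)%E.
Proof.
rewrite [RHS]integral_mkcond; apply: eq_integral => x _.
rewrite patchE cabs_real ger0_norm ?pweights_ge0// /pweights indicE mulr1.
case: ifPn => xD; last by rewrite mul0r expr0n.
by rewrite mul1r -powR_mulrn ?powR_ge0// -powRrM mulrC.
Qed.

End power_weights.

Section weighted_fourier_bound.
Context {R : realType} {n : nat}.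
Local Notation mu := (leb R n).
Local Notation B k := (@eball R n k%:R).
Variables (p g : n.-tuple R -> R) (G alpha kappa : R).
Hypotheses (mp : measurable_fun setT p) (p0 : forall x, 0 <= p x).
Hypotheses (mg : measurable_fun setT g) (g0 : forall x, 0 <= g x) (gG : forall x, g x <= G).
Hypotheses (alpha1 : 1 <= alpha) (kappa0 : 0 < kappa).
Hypothesis pg : ((fnorm n ^+ 2)%:E * (\int[mu]_x (p x `^ alpha)%:E * \int[mu]_xi (g xi `^ alpha)%:E)
  <= kappa%:E)%E.

(** This is [sand_bound_interp] at s = 1 / alpha. Cutting [p] to [E] and [g] to a ball keeps the
    weights bounded on sets of finite measure; neither cut-off appears in the constant, so N may
    tend to infinity afterwards. *)
Lemma weighted_fourier_bound_trunc (u : n.-tuple R -> R[i]) (k N : nat) : bcs u ->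
  (forall x, u x != 0 -> B k x /\ p x <= k%:R) ->
  nsq mu (trunc (B N) (fun xi => (Num.sqrt (g xi))%:C *
    fourier (fun x => (Num.sqrt (p x))%:C * u x) xi)) <= kappa `^ alpha^-1 * nsq mu u.
Proof.
move=> bu uk.
have alpha0 : 0 < alpha := lt_le_trans ltr01 alpha1.
pose e := alpha / 2; have e0 : 0 <= e by rewrite divr_ge0// ltW.
have ee : 2 * e = alpha by rewrite /e mulrCA divff// mulr1.
pose E := B k `&` [set x | p x <= k%:R].
have mE : measurable E.
  apply: measurableI; first exact: measurable_eball.
  rewrite (_ : [set x | _] = p @^-1` `]-oo, k%:R]); last by apply/seteqP; split => x /=; rewrite in_itv.
  by rewrite -[X in measurable X]setTI; exact: mp.
have mB j : measurable (B j) := @measurable_eball R n j%:R.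
have fB j : (mu (B j) < +oo)%E := @eball_lty R n j%:R.
have fE : (mu E < +oo)%E.
  by apply: le_lt_trans (fB k); apply: le_measure; rewrite ?inE//; exact: subIsetl.
have pE x : E x -> p x <= k%:R by case.
have gB x : B N x -> g x <= G by move=> _; exact: gG.
pose f s := pweights E p e s; pose h s := pweights (B N) g e s.
have bf s : 0 <= s <= 1 -> bfsr mu (f s) by exact: (bfsr_pweights mE fE mp p0 pE e0).
have bh s : 0 <= s <= 1 -> bfsr mu (h s) by exact: (bfsr_pweights (mB N) (fB N) mg g0 gB e0).
have I0 : 0 <= (0 : R) <= 1 by rewrite lexx ler01.
have I1 : 0 <= (1 : R) <= 1 by rewrite ler01 lexx.
have Ialpha : 0 <= alpha^-1 <= 1 by rewrite invr_ge0 ltW//= invf_le1.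
(* At s = 0 the operator is a doubly truncated Fourier transform, a contraction by Plancherel. *)
have B0 : sand_bound mu mu (@fker R n) (f 0) (h 0) 1.
  move=> w bw; rewrite mul1r.
  have f0E : (fun x => (f 0 x)%:C * w x) = trunc E w.
    by apply/funext => x; rewrite /f /pweights mulr0 powRr0 mulr1.
  have bt : bcs (trunc E w).
    have [mw [M wM] _] := bw; split.
    - exact: cmeas_trunc.
    - by exists M => x; apply: (le_trans (cabs_trunc _ _ _)).
    - exists k%:R => // x nx; apply: truncF => -[/eball_cube Bx _]; exact: nx.
  have lF := L2g_fourier bt; have lw := bfs_L2g bw.
  have ls := bfs_L2g (bfs_sand (@cmeas_fker R n) (@cabs_fker R n) (bf _ I0) (bh _ I0) bw).
  apply: (@le_trans _ _ (nsq mu (fourier (trunc E w)))).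
    rewrite -lee_fin -(sqnE lF) -(sqnE ls); apply: le_sqn; [by case: ls|by case: lF|].
    move=> xi; rewrite /sand f0E cabsM cabs_real /h /pweights mulr0 powRr0 mulr1.
    by rewrite ger0_norm indicE; case: (_ \in _); rewrite ?mul1r// mul0r cabs_ge0.
  rewrite /nsq (plancherel bt); rewrite -lee_fin.
  have lt := bcs_L2g bt; rewrite -!/(nsq mu _) -(sqnE lt) -(sqnE lw); apply: le_sqn.
  - by case: lt.
  - by case: lw.
  - by move=> x; exact: cabs_trunc.
(* At s = 1 the Hilbert-Schmidt bound is the product in hypothesis [pg] with the integrals
   restricted to [E] and to a ball. *)
have B1 : sand_bound mu mu (@fker R n) (f 1) (h 1) kappa.
  pose x1 := nsq mu (fun x => (f 1 x)%:C); pose x2 := nsq mu (fun x => (h 1 x)%:C).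
  have s1 : (x1%:E = \int[mu]_(x in E) (p x `^ alpha)%:E)%E.
    have lf := bfs_L2g (bf _ I1); transitivity (sqn mu (fun x => (f 1 x)%:C : R[i])).
      by rewrite (sqnE lf).
    by rewrite -ee; exact: sqn_pweights1.
  have s2 : (x2%:E = \int[mu]_(x in B N) (g x `^ alpha)%:E)%E.
    have lh := bfs_L2g (bh _ I1); transitivity (sqn mu (fun x => (h 1 x)%:C : R[i])).
      by rewrite (sqnE lh).
    by rewrite -ee; exact: sqn_pweights1.
  have sub (D : set (n.-tuple R)) (r : n.-tuple R -> R) : measurable D -> measurable_fun setT r ->
      (\int[mu]_(x in D) (r x `^ alpha)%:E <= \int[mu]_x (r x `^ alpha)%:E)%E.
    move=> mD mr; apply: ge0_subset_integral => //.
    - apply/measurable_EFinP; exact: (measurableT_comp (measurable_powR alpha) mr).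
    - by move=> x _; rewrite lee_fin powR_ge0.
  have x12 (y1 y2 : R) : (y1%:E = \int[mu]_(x in E) (p x `^ alpha)%:E)%E ->
      (y2%:E = \int[mu]_(x in B N) (g x `^ alpha)%:E)%E -> fnorm n ^+ 2 * y1 * y2 <= kappa.
    move=> e1 e2; rewrite -lee_fin -mulrA EFinM (EFinM y1) e1 e2; apply: le_trans pg.
    rewrite lee_wpmul2l ?lee_fin ?sqr_ge0//; apply: lee_pmul.
    - by apply: integral_ge0 => x _; rewrite lee_fin powR_ge0.
    - by apply: integral_ge0 => x _; rewrite lee_fin powR_ge0.
    - exact: sub.
    - exact: sub.
  move=> w bw.
  apply: (le_trans (sand_HS (@cmeas_fker R n) (@cabs_fker R n) (bf _ I1) (bh _ I1) bw)).
  by rewrite ler_wpM2r ?nsq_ge0//; exact: (x12 _ _ s1 s2).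
pose Cf := nsq mu (fun x => ((1 + `|k%:R|) `^ e * \1_E x : R)%:C).
pose Ch := nsq mu (fun x => ((1 + `|G|) `^ e * \1_(B N) x : R)%:C).
(* The iteration starts from some bound uniform in s; this one depends on the cut-offs. *)
have BC s : 0 <= s <= 1 -> sand_bound mu mu (@fker R n) (f s) (h s) (fnorm n ^+ 2 * Cf * Ch).
  move=> sI w bw.
  apply: (le_trans (sand_HS (@cmeas_fker R n) (@cabs_fker R n) (bf _ sI) (bh _ sI) bw)).
  rewrite ler_wpM2r ?nsq_ge0//; apply: ler_pM; rewrite ?nsq_ge0//.
  - by rewrite mulr_ge0 ?nsq_ge0 ?sqr_ge0.
  - rewrite ler_wpM2l ?sqr_ge0//; exact: (nsq_pweights_le mE fE mp p0 pE e0 sI).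
  - exact: (nsq_pweights_le (mB N) (fB N) mg g0 gB e0 sI).
have fM s t x : 0 <= s <= 1 -> 0 <= t <= 1 ->
    f s x * f t x = f ((s + t) / 2) x * f ((s + t) / 2) x by move=> ? ?; exact: pweights_mid.
have hM s t x : 0 <= s <= 1 -> 0 <= t <= 1 ->
    h s x * h t x = h ((s + t) / 2) x * h ((s + t) / 2) x by move=> ? ?; exact: pweights_mid.
have := sand_bound_interp (@cmeas_fker R n) (@cabs_fker R n) kappa0 bf bh fM hM B0 B1 BC Ialpha (bcs_bfs bu).
suff -> : sand mu (@fker R n) (f alpha^-1) (h alpha^-1) u =
  trunc (B N) (fun xi => (Num.sqrt (g xi))%:C * fourier (fun x => (Num.sqrt (p x))%:C * u x) xi) by [].
have ea : e * alpha^-1 = 2^-1 by rewrite /e mulrAC divff ?mul1r// gt_eqF.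
have fE' : (fun x => (f alpha^-1 x)%:C * u x) = (fun x => (Num.sqrt (p x))%:C * u x).
  apply/funext => x; have [->|ux] := eqVneq (u x) 0; first by rewrite !mulr0.
  have [Bx px] := uk _ ux; congr (_%:C * _).
  by rewrite /f /pweights ea powR12_sqrt// indicE mem_set ?mul1r.
apply/funext => xi; rewrite /sand fE' /trunc /h /pweights ea powR12_sqrt// complex_realM.
by rewrite -mulrA.
Qed.

Lemma weighted_fourier_bound (u : n.-tuple R -> R[i]) (k : nat) : bcs u ->
  (forall x, u x != 0 -> B k x /\ p x <= k%:R) ->
  let F := fun xi => (Num.sqrt (g xi))%:C * fourier (fun x => (Num.sqrt (p x))%:C * u x) xi in
  L2g mu F /\ nsq mu F <= kappa `^ alpha^-1 * nsq mu u.
Proof.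
move=> bu uk F.
have bpu : bcs (fun x => (Num.sqrt (p x))%:C * u x).
  apply: (bcsMb (c := Num.sqrt k%:R) bu).
    by apply: cmeas_real; exact: (measurableT_comp (@measurable_sqrt R)).
  by move=> x /uk[_ px]; rewrite cabs_real ger0_norm ?sqrtr_ge0// ler_wsqrtr.
have mF : cmeas F.
  apply: cmeasM; first by apply: cmeas_real; exact: (measurableT_comp (@measurable_sqrt R)).
  exact/cmeas_fourier/(bfs_meas (bcs_bfs bpu)).
have lF : L2g mu F.
  apply: (@L2gMb _ _ _ _ _ _ (Num.sqrt G) (L2g_fourier bpu)).
    by apply: cmeas_real; exact: (measurableT_comp (@measurable_sqrt R)).
  by move=> xi; rewrite cabs_real ger0_norm ?sqrtr_ge0// ler_wsqrtr.
split => //.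
have cv := @cvg_nsq_trunc _ _ R mu (fun N => B N) F (fun N => @measurable_eball R n N%:R)
  (fun k l => @eballS R n k l) (@eball_cover R n) lF.
apply: (cvgr_to_le cv); apply: nearW => N.
exact: weighted_fourier_bound_trunc bu uk.
Qed.

End weighted_fourier_bound.

(** * Norm of the Birman-Schwinger operator *)

Section birman_schwinger.
Context {R : realType} {n : nat}.
Local Notation mu := (leb R n).
Local Notation B k := (@eball R n k%:R).
Variables (m : R) (z : R[i]) (q : n.-tuple R -> R[i]) (alpha kappa : R).
Hypotheses (m0 : 0 < m) (zh : ~ halfline z) (mq : cmeas q).
Hypotheses (alpha1 : 1 <= alpha) (kappa0 : 0 < kappa).
Hypothesis qg : ((fnorm n ^+ 2)%:E * (\int[mu]_x (cabs (q x) `^ alpha)%:E *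
   \int[mu]_xi (cabs (rsymb m z xi) `^ alpha)%:E) <= kappa%:E)%E.
Hypothesis fredH0 : fredholm (op_shift (@H0 R n m) z).

(** It bounds the squared norm of |g|^(1/2) F |q|^(1/2), hence the norm of the Birman-Schwinger
    operator itself. *)
Let kap := kappa `^ alpha^-1.
Let r (xi : n.-tuple R) := Num.sqrt (cabs (rsymb m z xi)).

Lemma cint_ae (f g : n.-tuple R -> R[i]) : cmeas f -> cmeas g -> f = g %[ae mu] ->
  cint mu f = cint mu g.
Proof.
move=> [f1 f2] [g1 g2] fg; apply: eqcP; rewrite ?Re_cint ?Im_cint /Rintegral; congr fine;
  apply: ae_eq_integral => //; try exact/measurable_EFinP;
  by apply: filterS fg => x /= h _; rewrite h.
Qed.

Lemma cmeas_sgnq : cmeas (sgnq q).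
Proof.
rewrite (_ : sgnq q = fun x => q x * ((cabs (q x))%:C)^-1).
  by apply: cmeasM => //; apply: cmeas_inv; apply: cmeas_real; exact: measurable_cabs.
by apply/funext => x; rewrite /sgnq; case: eqP => // ->; rewrite mul0r.
Qed.

Lemma cabs_sgnq x : cabs (sgnq q x) <= 1.
Proof.
rewrite /sgnq; case: eqP => [_|/eqP q0]; first by rewrite cabs0.
rewrite cabsM cabsV cabs_real ger0_norm ?cabs_ge0// divff// gt_eqF//.
exact: cabs_gt0.
Qed.

(** The sets increase to the whole space, and truncating to one of them makes [w] and its product
    with [b_of q] bounded with bounded support. *)
Definition level (w : n.-tuple R -> R[i]) (k : nat) : set (n.-tuple R) :=
  [set x | [/\ B k x, cabs (q x) <= k%:R & cabs (w x) <= k%:R]].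

Lemma measurable_level w k : cmeas w -> measurable (level w k).
Proof.
move=> mw; rewrite (_ : level w k = B k `&` ((cabs \o q) @^-1` `]-oo, k%:R] `&`
   (cabs \o w) @^-1` `]-oo, k%:R])).
  apply: measurableI; first exact: measurable_eball.
  apply: measurableI; rewrite -[X in measurable X]setTI; first exact: (measurable_cabs mq).
  exact: (measurable_cabs mw).
by apply/seteqP; split => x /=; rewrite !in_itv/=; [move=> []|move=> [? []]].
Qed.

Lemma levelS w k l : (k <= l)%N -> level w k `<=` level w l.
Proof.
move=> kl x [h1 h2 h3]; have kl' : (k%:R : R) <= l%:R by rewrite ler_nat.
by split; [exact: eballS h1|exact: le_trans h2 _|exact: le_trans h3 _].
Qed.

Lemma level_cover w x : exists k, level w k x.
Proof.
pose N := maxn (Num.bound (enorm x)) (maxn (Num.bound (cabs (q x))) (Num.bound (cabs (w x)))).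
have bd (a : R) : 0 <= a -> (Num.bound a <= N)%N -> a <= N%:R.
  move=> a0 aN; apply: (@le_trans _ _ (Num.bound a)%:R); last by rewrite ler_nat.
  exact/ltW/archi_boundP.
exists N; split; apply: bd; rewrite ?enorm_ge0 ?cabs_ge0// /N ?leq_max ?leqnn ?orbT//.
Qed.

(** A dense class that multiplication by |q|^(1/2) maps into [bcs], so that the whole chain defining
    [BRA] can be followed. *)
Definition nice (u : n.-tuple R -> R[i]) := bcs u /\
  exists k : nat, forall x, u x != 0 -> B k x /\ cabs (q x) <= k%:R.

Lemma nice_mulb u g c : nice u -> cmeas g -> (forall x, cabs (g x) <= c) ->
  nice (fun x => g x * u x).
Proof.
move=> [bu [k uk]] mg gc; split; first by apply: (bcsMb (c := c) bu).
by exists k => x h; apply: uk; apply: contraNneq h => ->; rewrite mulr0.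
Qed.

Lemma nice_a u : nice u -> bcs (fun x => (Num.sqrt (cabs (q x)))%:C * u x).
Proof.
move=> [bu [k uk]]; apply: (bcsMb (c := Num.sqrt k%:R) bu).
  by apply: cmeas_real; apply: (measurableT_comp (@measurable_sqrt R)); exact: measurable_cabs.
by move=> x /uk[_ px]; rewrite cabs_real ger0_norm ?sqrtr_ge0// ler_wsqrtr.
Qed.

Lemma nice_bound u : nice u ->
  L2g mu (fun xi => (r xi)%:C * fourier (fun x => (Num.sqrt (cabs (q x)))%:C * u x) xi) /\
  nsq mu (fun xi => (r xi)%:C * fourier (fun x => (Num.sqrt (cabs (q x)))%:C * u x) xi) <=
    kap * nsq mu u.
Proof.
move=> [bu [k uk]]; have [G hG] := @rsymb_bounded R n m z zh.
exact: (weighted_fourier_bound (measurable_cabs mq) (fun x => cabs_ge0 (q x))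
  (measurable_cabs (cmeas_rsymb m z)) (fun x => cabs_ge0 _) hG alpha1 kappa0 qg bu uk).
Qed.

(** For w = (H0 - z)^-1 a u, Parseval turns the pairing into an integral of the symbol against two
    transforms. The symbol is a unimodular phase [ph] times the square of [r], one factor for each
    side, and [nice_bound] controls both sides. *)
Lemma pairing_bound u y w wh : nice u -> nice y ->
  is_fourier w wh ->
  wh = (fun xi => rsymb m z xi * fourier (fun x => (Num.sqrt (cabs (q x)))%:C * u x) xi) %[ae mu] ->
  cabs (cint mu (fun x => w x * conjc ((Num.sqrt (cabs (q x)))%:C * y x))) ^+ 2 <=
  (kap * nsq mu u) * (kap * nsq mu y).
Proof.
move=> nu ny Fw ew.
have bay := nice_a ny; have bau := nice_a nu.
rewrite (parseval Fw bay).
set Fu := fourier _ in ew; set Fy := fourier _.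
have mFu : cmeas Fu := cmeas_fourier (bfs_meas (bcs_bfs bau)).
have mFy : cmeas Fy := cmeas_fourier (bfs_meas (bcs_bfs bay)).
have mrs : cmeas (@rsymb R n m z) := cmeas_rsymb m z.
have [lU bU] := nice_bound nu; have [lV bV] := nice_bound ny.
rewrite -/Fu in lU bU; rewrite -/Fy in lV bV.
pose ph (xi : n.-tuple R) := rsymb m z xi * ((cabs (rsymb m z xi))%:C)^-1.
have mph : cmeas ph.
  by apply: cmeasM => //; apply: cmeas_inv; apply: cmeas_real; exact: measurable_cabs.
have rs0 (xi : n.-tuple R) : 0 < cabs (rsymb m z xi).
  by apply: cabs_gt0; rewrite invr_eq0; exact: symb_neq0.
have ph1 xi : cabs (ph xi) <= 1.
  have e (w' : R[i]) : 0 < cabs w' -> cabs (w' * ((cabs w')%:C)^-1) = 1.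
    by move=> w0; rewrite cabsM cabsV cabs_real ger0_norm ?cabs_ge0// divff// gt_eqF.
  by rewrite /ph e.
have [_ /L2P lwh _] := Fw.
have E : cint mu (fun xi => wh xi * conjc (Fy xi)) =
    cint mu (fun xi => (ph xi * ((r xi)%:C * Fu xi)) * conjc ((r xi)%:C * Fy xi)).
  apply: cint_ae.
  - by apply: cmeasM; [case: lwh|exact: cmeas_conj].
  - apply: cmeasM; first by apply: cmeasM => //; case: lU.
    by apply: cmeas_conj; case: lV.
  - apply: filterS ew => xi /(_ I) h _; rewrite h.
    rewrite (conjcM (r xi)%:C) conjc_real.
    have -> : rsymb m z xi = ph xi * ((r xi)%:C * (r xi)%:C).
      rewrite -complex_realM -expr2 /r sqr_sqrtr ?cabs_ge0// /ph -mulrA mulVf ?mulr1//.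
      by apply/eqP => -[] h0; have := rs0 xi; rewrite h0 ltxx.
    by ring.
rewrite E.
have lpU : L2g mu (fun xi => ph xi * ((r xi)%:C * Fu xi)) by apply: (L2gMb lU mph ph1).
apply: (le_trans (cint_CS lpU (L2g_conj lV))).
rewrite nsq_conj; apply: ler_pM; rewrite ?nsq_ge0//.
apply: le_trans bU; rewrite -lee_fin -(sqnE lpU) -(sqnE lU).
apply: le_sqn; [by case: lpU|by case: lU|].
by move=> xi; rewrite cabsM ler_piMl ?cabs_ge0.
Qed.

(** It is not known beforehand that b w is in L2, so it is tested against its own truncations [y]:
    the pairing equals |y|^2, [pairing_bound] gives |y|^4 <= kap^2 |u|^2 |y|^2, and the bound on |y|
    passes to b w by monotone convergence. *)
Lemma BRA_bound u : nice u -> exists v, [/\ BRA m q z u v, L2g mu v &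
  nsq mu v <= kap ^+ 2 * nsq mu u].
Proof.
move=> nu; have bu := nu.1; have bau := nice_a nu.
have [w hw] := exists_resolvent m0 zh fredH0 bau.
have [wh [Fw ew]] := shift_H0_fourier zh bau hw.
have [/L2P lw _ _] := Fw; have mw := lw.1.
pose bw x := b_of q x * w x.
have mb : cmeas (b_of q).
  apply: cmeasM; first exact: cmeas_sgnq.
  by apply: cmeas_real; apply: (measurableT_comp (@measurable_sqrt R)); exact: measurable_cabs.
have mbw : cmeas bw by exact: cmeasM.
have mD k := measurable_level k mw.
have kap0 : 0 < kap by exact: powR_gt0.
have key k : (sqn mu (trunc (level w k) bw) <= (kap ^+ 2 * nsq mu u)%:E)%E.
  set y := trunc _ _.
  have ny : nice y.
    split.
      split; first exact: cmeas_trunc.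
        exists (1 * Num.sqrt k%:R * k%:R) => x.
        have [Dx|Dx] := pselect (level w k x); last first.
          by rewrite /y truncF// cabs0 !mulr_ge0 ?sqrtr_ge0.
        rewrite /y truncT// /bw /b_of !cabsM cabs_real ger0_norm ?sqrtr_ge0//.
        have [_ qk wk] := Dx.
        by apply: ler_pM; rewrite ?mulr_ge0 ?cabs_ge0 ?sqrtr_ge0//;
          apply: ler_pM; rewrite ?cabs_ge0 ?sqrtr_ge0 ?cabs_sgnq// ler_wsqrtr.
      exists k%:R => // x nx; apply: truncF => -[/eball_cube h _ _]; exact: nx.
    exists k => x yx; have [[h1 h2 _]|Dx] := pselect (level w k x) => //.
    by rewrite /y truncF// eqxx in yx.
  (* [pairing_bound] carries the weight |q|^(1/2) on both sides; the conjugate sign turns it into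
     [b_of q]. *)
  pose y' x := conjc (sgnq q x) * y x.
  have ny' : nice y'.
    apply: (nice_mulb (c := 1) ny); first by apply: cmeas_conj; exact: cmeas_sgnq.
    by move=> x; rewrite cabs_conj cabs_sgnq.
  have ly := bcs_L2g ny.1; have ly' := bcs_L2g ny'.1.
  have yy : nsq mu y' <= nsq mu y.
    rewrite -lee_fin -(sqnE ly') -(sqnE ly); apply: le_sqn; [by case: ly'|by case: ly|].
    by move=> x; rewrite /y' cabsM cabs_conj ler_piMl ?cabs_ge0// cabs_sgnq.
  have := pairing_bound nu ny' Fw ew.
  have -> : cint mu (fun x => w x * conjc ((Num.sqrt (cabs (q x)))%:C * y' x)) = (nsq mu y)%:C.
    have cj (a : R) (s v : R[i]) : conjc (a%:C * (conjc s * v)) = a%:C * (s * conjc v).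
      by rewrite !conjcM conjcK conjc_real.
    rewrite -(nsqE ly); apply: eq_cint => x; rewrite /y' cj.
    have [Dx|Dx] := pselect (level w k x); last by rewrite /y truncF// conjc0 !mulr0.
    by rewrite {2}/y truncT// /bw /b_of; ring.
  rewrite cabs_real ger0_norm ?nsq_ge0// => h.
  rewrite (sqnE ly) lee_fin.
  have [->|yn0] := eqVneq (nsq mu y) 0; first by rewrite mulr_ge0 ?sqr_ge0 ?nsq_ge0.
  have yp : 0 < nsq mu y by rewrite lt0r yn0 nsq_ge0.
  rewrite -(ler_pM2r yp) -expr2; apply: (le_trans h).
  apply: (@le_trans _ _ (kap * nsq mu u * (kap * nsq mu y))).
    by rewrite ler_wpM2l ?mulr_ge0 ?nsq_ge0 ?ler_pM2l// ltW.
  by rewrite le_eqVlt; apply/orP; left; apply/eqP; ring.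
have sbw : (sqn mu bw <= (kap ^+ 2 * nsq mu u)%:E)%E.
  have cv := @cvg_sqn_trunc _ _ R mu (level w) bw mD (@levelS w) (level_cover w) mbw.
  by apply: (cvge_to_le cv); apply: nearW.
have lbw : L2g mu bw by split => //; apply: le_lt_trans sbw _; exact: ltry.
exists bw; split => //; last by rewrite -lee_fin -sqnE.
exists w; split.
  exists (fun x => (Num.sqrt (cabs (q x)))%:C * u x); split => //.
  split; [exact/L2P/bcs_L2g|exact/L2P/bcs_L2g|exact/aeW].
by split; [exact/L2P|exact/L2P|exact/aeW].
Qed.

(** [Qz] is estimated sharply only on nice functions, so an eigenvector [u] is approximated by its
    truncations; the unspecified norm bound [M] meets only the error, which tends to 0. *)
Lemma no_eigenvalue (Qz : operator R n) : kappa < 1 ->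
  bounded_extension (BRA m q z) Qz -> ~ eigenvalue_of Qz (-1).
Proof.
move=> k1 [[Qlin _ [M QM]] Qext] [u [/L2P lu un0 Qu]].
have kap0 : 0 < kap by exact: powR_gt0.
have ka1 : kap < 1.
  apply: (@lt_le_trans _ _ (1 `^ alpha^-1)); last by rewrite powR1.
  by apply: gt0_ltr_powR; rewrite ?nnegrE ?ler01 ?(ltW kappa0)// invr_gt0 (lt_le_trans ltr01).
have mu_ := lu.1.
have mD k := measurable_level k mu_.
pose uk k := trunc (level u k) u.
have nuk k : nice (uk k).
  split.
    split; first exact: cmeas_trunc.
      exists k%:R => x; have [Dx|Dx] := pselect (level u k x); last by rewrite /uk truncF// cabs0.
      by rewrite /uk truncT//; case: Dx.
    exists k%:R => // x nx; apply: truncF => -[/eball_cube h _ _]; exact: nx.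
  exists k => x yx; have [[h1 h2 _]|Dx] := pselect (level u k x) => //.
  by rewrite /uk truncF// eqxx in yx.
have luk k := bcs_L2g (nuk k).1.
have nuk_le k : nsq mu (uk k) <= nsq mu u.
  by rewrite -lee_fin -(sqnE (luk k)) -(sqnE lu); apply: le_sqn; [case: (luk k)|case: lu|move=> x; exact: cabs_trunc].
(* With v = Qz (uk k) and Qz u = - u, write - u as the sum of v and Qz (u - uk k), the latter being
   - v - u. *)
have ineq t k : 0 < t -> nsq mu u <= (1 + t) * (kap ^+ 2 * nsq mu u) +
    (1 + t^-1) * (M ^+ 2 * nsq mu (fun x => uk k x - u x)).
  move=> t0; have [v [Bv lv nv]] := BRA_bound (nuk k).
  have Qv := Qext _ _ Bv.
  have Qd := op_lin Qlin (-1) Qv Qu.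
  have ld : L2g mu (fun x => -1 * uk k x + u x) by apply: L2gD => //; exact: L2gZ.
  have ldv : L2g mu (fun x => -1 * v x + -1 * u x) by apply: L2gD; exact: L2gZ.
  have h1 := Lp_norm2_le ld ldv (QM _ _ Qd).
  have e1 : nsq mu (fun x => -1 * uk k x + u x) = nsq mu (fun x => uk k x - u x).
    by rewrite /nsq -[in RHS]sqnN; congr (fine (sqn _ _)); apply/funext => x; rewrite opprB mulN1r addrC.
  rewrite e1 in h1.
  have h2 := sqnD mu t0 lv.1 ldv.1.
  have e2 : sqn mu (fun x => v x + (-1 * v x + -1 * u x)) = sqn mu u.
    by rewrite -[RHS]sqnN; congr sqn; apply/funext => x; rewrite addrA mulN1r subrr add0r mulN1r.
  rewrite e2 (sqnE lu) (sqnE lv) (sqnE ldv) -!EFinM -EFinD lee_fin in h2.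
  apply: (le_trans h2); apply: lerD; rewrite ler_wpM2l//.
  - by rewrite addr_ge0// ltW.
  - by apply: (le_trans nv); rewrite ler_wpM2l ?sqr_ge0.
  - by rewrite addr_ge0// invr_ge0 ltW.
have lim t : 0 < t -> nsq mu u <= (1 + t) * (kap ^+ 2 * nsq mu u).
  move=> t0.
  have c0 : (nsq mu (fun x => uk k x - u x) @[k --> \oo] --> (0:R))%classic.
    apply/fine_cvg; apply: cvg_trunc_sub => //; [exact: levelS|exact: level_cover].
  have c1 : ((1 + t) * (kap ^+ 2 * nsq mu u) +
    (1 + t^-1) * (M ^+ 2 * nsq mu (fun x => uk k x - u x)) @[k --> \oo] -->
     ((1 + t) * (kap ^+ 2 * nsq mu u) : R))%classic.
    rewrite -[X in _ --> X]addr0; apply: cvgD; first exact: cvg_cst.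
    rewrite -(mulr0 (1 + t^-1)); apply: cvgMl_tmp.
    by rewrite -(mulr0 (M ^+ 2)); exact: cvgMl_tmp.
  by apply: (cvgr_to_ge c1); apply: nearW => k; exact: ineq.
have nu0 : nsq mu u = 0.
  apply/eqP; rewrite eq_le nsq_ge0 andbT leNgt; apply/negP => np.
  have k2 : 0 < kap ^+ 2 < 1 by rewrite exprn_gt0//= exprn_ilt1// ltW.
  (* This t keeps (1 + t) kap^2 below 1. *)
  have t0 : 0 < (1 - kap ^+ 2) / 2 by rewrite divr_gt0// subr_gt0; case/andP: k2.
  have := lim _ t0; rewrite mulrA -[leLHS]mul1r ler_pM2r//.
  move: k2 => /andP[]; set a := kap ^+ 2; nra.
apply: un0; apply: (@sqn_eq0_ae _ _ _ mu u (fun=> 0)) => //; first exact: cmeas_cst.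
rewrite (_ : (fun x => u x - 0) = u); first by rewrite (sqnE lu) nu0.
by apply/funext => x; rewrite subr0.
Qed.

End birman_schwinger.

(** * The radial integral and its constant *)

Section sqsum.
Context {R : realType}.
Local Notation leb1 := (@lebesgue_measure R).

(** The square of [enorm]; it is additive in the coordinates, which suits the recursion behind
    [leb]. *)
Definition sqsum n (x : n.-tuple R) : R := \sum_(i < n) tnth x i ^+ 2.

Lemma sqsum_ge0 n (x : n.-tuple R) : 0 <= sqsum x.
Proof. by apply: sumr_ge0 => i _; exact: sqr_ge0. Qed.

Lemma measurable_sqsum n : measurable_fun setT (@sqsum n).
Proof. by apply: measurable_sum => i; apply: measurable_funX; exact: measurable_tnth. Qed.

Lemma sqsum_cons n (x : n.-tuple R) (t : R) : sqsum (cons_pair (x, t)) = t ^+ 2 + sqsum x.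
Proof.
rewrite /sqsum big_ord_recl cons_pair_tnth0; congr (_ + _).
by apply: eq_bigr => i _; rewrite cons_pair_tnthS.
Qed.

Lemma integral_leb0 (f : 0.-tuple R -> \bar R) : measurable_fun setT f ->
  (\int[leb R 0]_x f x = f [tuple])%E.
Proof.
move=> mf; rewrite -integral_lebE/= integral_dirac// diracE mem_set// mul1e//.
Qed.

(** Dilations are needed only for functions of |x|^2. The induction treats one coordinate at a time,
    and [H] varies because a fixed coordinate t turns it into y -> H(t^2 + y). *)
Lemma ge0_integral_sqsum_scale n (H : R -> \bar R) (a : R) : 0 < a ->
  measurable_fun setT H -> (forall y, 0 <= H y)%E ->
  ((a ^+ n)%:E * \int[leb R n]_x H (a ^+ 2 * sqsum x)%R = \int[leb R n]_x H (sqsum x))%E.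
Proof.
move=> a0; elim: n H => [|n IH] H mH H0.
  have m1 : measurable_fun setT (fun x : 0.-tuple R => H (a ^+ 2 * sqsum x)).
    apply: (measurableT_comp mH); apply: measurable_funM => //; exact: measurable_sqsum.
  have m2 : measurable_fun setT (fun x : 0.-tuple R => H (sqsum x)).
    by apply: (measurableT_comp mH); exact: measurable_sqsum.
  by rewrite !integral_leb0// expr0 mul1e /sqsum big_ord0 mulr0.
have m1 : measurable_fun setT (fun x : n.+1.-tuple R => H (a ^+ 2 * sqsum x)).
  apply: (measurableT_comp mH); apply: measurable_funM => //; exact: measurable_sqsum.
have m2 : measurable_fun setT (fun x : n.+1.-tuple R => H (sqsum x)).
  by apply: (measurableT_comp mH); exact: measurable_sqsum.
rewrite [RHS]ge0_integral_leb_consC// [X in (_ * X)%E]ge0_integral_leb_consC//.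
have mH2 t : measurable_fun setT (fun y : R => H (t ^+ 2 + y)).
  by apply: (measurableT_comp mH); exact: measurable_funD.
have mG : measurable_fun setT (fun z : n.-tuple R * measurableTypeR R => H (z.2 ^+ 2 + a ^+ 2 * sqsum z.1)).
  apply: (measurableT_comp mH); apply: measurable_funD.
    by apply: measurable_funX; exact: measurable_snd.
  apply: measurable_funM => //; apply: (measurableT_comp (@measurable_sqsum n)); exact: measurable_fst.
pose g t : \bar R := (\int[leb R n]_x H (t ^+ 2 + a ^+ 2 * sqsum x)%R)%E.
have mg : measurable_fun setT g.
  exact: (@measurable_fun_fubini_tonelli_G _ _ _ _ _ (leb R n) _ mG (fun=> H0 _)).
have g0 t : (0 <= g t)%E by exact: integral_ge0.
have e1 : (\int[leb1]_t \int[leb R n]_x H (a ^+ 2 * sqsum (cons_pair (x, t)))%R =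
   \int[leb1]_t g (a * t)%R)%E.
  apply: eq_integral => t _; apply: eq_integral => x _.
  by rewrite sqsum_cons mulrDr exprMn.
rewrite e1 exprSr EFinM -muleA ge0_integral_scale// -ge0_integralZl//; last by rewrite lee_fin exprn_ge0// ltW.
apply: eq_integral => t _; rewrite /g (IH (fun y => H (t ^+ 2 + y)%R))//.
by apply: eq_integral => x _; rewrite sqsum_cons.
Qed.

Lemma integral_gauss_sqsum n :
  (\int[leb R n]_x (expR (- sqsum x))%:E = (Num.sqrt pi ^+ n)%:E)%E.
Proof.
have mE k : measurable_fun setT (fun x : k.-tuple R => (expR (- sqsum x))%:E).
  apply/measurable_EFinP; apply: measurableT_comp; first exact: measurable_expR.
  by apply: measurableT_comp => //; exact: measurable_sqsum.
elim: n => [|n IH].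
  by rewrite integral_leb0// /sqsum big_ord0 oppr0 expR0 expr0.
rewrite ge0_integral_leb_cons//.
have mgauss : measurable_fun setT (fun t : R => (expR (- t ^+ 2))%:E).
  by apply/measurable_EFinP; exact: measurable_gauss_fun.
transitivity (\int[leb R n]_x ((expR (- sqsum x))%:E * (Num.sqrt pi)%:E))%E.
  apply: eq_integral => x _; rewrite -integralT_gauss -ge0_integralZl//; last by move=> t _; rewrite lee_fin gauss_fun_ge0.
  by apply: eq_integral => t _; rewrite sqsum_cons opprD addrC expRD EFinM.
rewrite ge0_integralZr//.
  by rewrite IH -EFinM exprSr.
exact: mE.
Qed.

(** Logarithms of [sqsum x] are taken below, so the origin has to be a null set; in dimension 0 it
    carries unit mass. *)
Lemma sqsum_gt0_ae n : (0 < n)%N -> {ae leb R n, forall x, 0 < sqsum x}.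
Proof.
case: n => // n _; exists [set x | sqsum x = 0]; split.
- rewrite (_ : [set x | _] = (@sqsum n.+1) @^-1` [set 0]).
    by rewrite -[X in measurable X]setTI; exact: measurable_sqsum.
  by apply/seteqP; split.
- have mS : measurable [set x : n.+1.-tuple R | sqsum x = 0].
    rewrite (_ : [set x | _] = (@sqsum n.+1) @^-1` [set 0]).
      by rewrite -[X in measurable X]setTI; exact: measurable_sqsum.
    by apply/seteqP; split.
  transitivity (\int[leb R n.+1]_x (\1_[set x | sqsum x = 0] x)%:E)%E.
    by rewrite integral_indic// setIT.
  rewrite ge0_integral_leb_cons//.
    rewrite integral0_eq// => x _; apply/eqP; rewrite eq_le integral_ge0// ?andbT//.
    apply: (@le_trans _ _ (\int[leb1]_t (\1_[set 0] t)%:E)%E).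
      apply: ge0_le_integral => //.
      - apply/measurable_EFinP.
        apply: (measurableT_comp (measurable_indic mS)).
        exact: (measurableT_comp (@measurable_cons_pair R n) (pair1_measurable x)).
      - by apply/measurable_EFinP; exact: measurable_indic.
      - move=> t _; rewrite lee_fin !indicE; case: (boolP (_ \in _)) => //.
        rewrite inE/= sqsum_cons => /eqP; rewrite paddr_eq0 ?sqr_ge0 ?sqsum_ge0// => /andP[].
        by rewrite sqrf_eq0 => /eqP-> _; rewrite mem_set.
    by rewrite integral_indic// setIT; rewrite le_eqVlt; apply/orP; left; apply/eqP; exact: (lebesgue_measure_set1 (0 : R)).
  by apply/measurable_EFinP; exact: measurable_indic.
- move=> x /= /negP; rewrite -leNgt => h.
  by apply/eqP; rewrite eq_le h sqsum_ge0.
Qed.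

End sqsum.

(** * Exponential substitution on the half-line *)

Section log_coordinates.
Context {R : realType}.
Local Notation leb1 := (@lebesgue_measure R).

Lemma derive1_expR : derive1 (@expR R) = expR.
Proof. by apply/funext => x; rewrite derive1E derive_val. Qed.

(** Substitution t = e^v on the intervals [e^-i, e^i], which exhaust the half-line; nonnegativity
    allows the passage to the limit. *)
Lemma ge0_integral_expR (G : R -> R) : {in `]0, +oo[, continuous G} ->
  (forall t, 0 < t -> 0 <= G t) ->
  (\int[leb1]_(t in `]0%R, +oo[) (G t)%:E =
   \int[leb1]_v (G (expR v) * expR v)%:E)%E.
Proof.
move=> cG G0.
have mGe : measurable_fun setT (fun v => (G (expR v) * expR v)%:E).
  apply/measurable_EFinP; apply: continuous_measurable_fun => v.
  apply: cvgM; last exact: continuous_expR.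
  apply: (@continuous_comp _ _ _ expR G v); first exact: continuous_expR.
  by apply: cG; rewrite in_itv/= expR_gt0.
have mG : measurable_fun (`]0, +oo[%classic : set (measurableTypeR R)) (fun t => (G t)%:E).
  apply/measurable_EFinP; apply: open_continuous_measurable_fun; first exact: interval_open.
  by move=> t; rewrite inE => /cG.
have cov1 : \bigcup_i (`[expR (- i%:R), expR i%:R]%classic : set R) = `]0, +oo[%classic :> set R.
  apply/seteqP; split => [t [i _]|t]/=; rewrite !in_itv/= andbT.
    by move=> /andP[+ _]; apply: lt_le_trans; exact: expR_gt0.
  move=> t0; exists (Num.bound `|ln t|) => //=; rewrite in_itv/=.
  have h : `|ln t| <= (Num.bound `|ln t|)%:R by rewrite ltW// archi_boundP.
  by rewrite -{2 3}(lnK t0) !ler_expR; rewrite ler_norml in h.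
have cov2 : \bigcup_i (`[- i%:R, i%:R]%classic : set R) = [set: R].
  apply/seteqP; split => // t _; exists (Num.bound `|t|) => //=; rewrite in_itv/=.
  by rewrite -ler_norml ltW// archi_boundP.
have nd1 : nondecreasing_seq (fun i => `[expR (- i%:R), expR i%:R]%classic : set R).
  move=> i j ij; apply/subsetPset => t/=; rewrite !in_itv/= => /andP[h1 h2].
  rewrite (le_trans _ h1)?(le_trans h2)// ler_expR ?lerN2 ler_nat//.
have nd2 : nondecreasing_seq (fun i => `[- i%:R, i%:R]%classic : set R).
  move=> i j ij; apply/subsetPset => t/=; rewrite !in_itv/= => /andP[h1 h2].
  rewrite (le_trans _ h1)?(le_trans h2)// ?lerN2 ler_nat//.
have sub1 i : (`[expR (- i%:R), expR i%:R]%classic : set R) `<=` `]0, +oo[%classic.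
  by rewrite -cov1; exact: (bigcup_sup (i := i)).
have c1 : (\int[leb1]_(x in `[(expR (- i%:R))%R, (expR i%:R)%R]) (G x)%:E @[i --> \oo] -->
    \int[leb1]_(t in `]0%R, +oo[) (G t)%:E)%E.
  rewrite -cov1; apply: ge0_nondecreasing_set_cvg_integral => //.
    by move=> i; apply: (measurable_funS _ (@sub1 i) mG).
  move=> i t /sub1/=; rewrite in_itv/= andbT lee_fin => t0; exact: G0.
have c2 : (\int[leb1]_(x in `[(- i%:R)%R, i%:R%R]) (G (expR x) * expR x)%:E @[i --> \oo] -->
    \int[leb1]_v (G (expR v) * expR v)%:E)%E.
  rewrite -cov2; apply: ge0_nondecreasing_set_cvg_integral => //.
    by move=> i; exact: measurable_funTS.
  move=> i t _.
  by rewrite lee_fin mulr_ge0 ?expR_ge0 ?G0 ?expR_gt0.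
have E i : (\int[leb1]_(x in `[(expR (- i%:R))%R, (expR i%:R)%R]) (G x)%:E =
    \int[leb1]_(x in `[(- i%:R)%R, i%:R%R]) (G (expR x) * expR x)%:E)%E.
  have ii : - i%:R <= i%:R :> R by rewrite (@le_trans _ _ 0)// oppr_le0.
  rewrite (@integration_by_substitution_increasing _ expR)//.
  - by rewrite derive1_expR.
  - by move=> x y _ _; rewrite ltr_expR.
  - by move=> x _; rewrite derive1_expR; exact: continuous_expR.
  - rewrite derive1_expR; apply/cvg_ex; exists (expR (- i%:R)); apply: cvg_at_right_filter; exact: continuous_expR.
  - rewrite derive1_expR; apply/cvg_ex; exists (expR i%:R); apply: cvg_at_left_filter; exact: continuous_expR.
  - split; [by move=> x _; exact: derivable_expR| |].
      by apply: cvg_at_right_filter; exact: continuous_expR.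
    by apply: cvg_at_left_filter; exact: continuous_expR.
  - apply: continuous_in_subspaceT => t; rewrite inE => /sub1 h; exact: cG.
rewrite (funext E) in c1; exact: (cvg_unique _ c1 c2).
Qed.

Lemma integral_exp_moment_lty (s : R) : 0 < s ->
  (\int[leb1]_v (expR (s * v - expR v))%:E < +oo)%E.
Proof.
move=> s0.
have mE : measurable_fun setT (fun v : R => (expR (s * v - expR v))%:E).
  apply/measurable_EFinP; apply: continuous_measurable_fun => v.
  apply: continuous_comp; last exact: continuous_expR.
  apply: cvgB; last exact: continuous_expR.
  by apply: cvgMl_tmp; exact: cvg_id.
have mp : measurable_fun setT (fun v : R => (pweight s v)%:E).
  by apply/measurable_EFinP; apply: continuous_measurable_fun; exact: continuous_pweight.
have /integrableP[_ fin] := integrable_pweight s0.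
(* The comparison is s v - e^v <= 4 s^2 - s |v|: for v >= 0 it follows from e^v >= (v / 2)^2 and 2 s
   v <= (v / 2)^2 + 4 s^2. *)
apply: (@le_lt_trans _ _ ((expR (4 * s ^+ 2))%:E * \int[leb1]_v (pweight s v)%:E)%E).
  rewrite -ge0_integralZl//; last by move=> v _; rewrite lee_fin pweight_ge0.
  apply: ge0_le_integral => //.
  - by apply: measurable_funeM.
  - move=> v _; rewrite -EFinM lee_fin /pweight -expRD ler_expR.
    have [v0|v0] := lerP 0 v; last first.
      by have := expR_gt0 v; rewrite ltr0_norm//; have := sqr_ge0 s; nra.
    have h1 := expR_ge1Dx (v / 2).
    have -> : expR v = expR (v / 2) ^+ 2 by rewrite expr2 -expRD -splitr.
    have h2 : (v / 2) ^+ 2 <= expR (v / 2) ^+ 2 by rewrite ler_sqr ?nnegrE ?expR_ge0//; lra.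
    have h3 := sqr_ge0 (v / 2 - 2 * s).
    by move: h2; rewrite (ger0_norm v0); nra.
apply: lte_mul_pinfty; rewrite ?lee_fin ?expR_ge0//.
move: fin; rewrite (_ : (fun x => `|(EFin \o pweight s) x|%E) = (fun v => (pweight s v)%:E))//.
by apply/funext => v /=; rewrite ger0_norm// pweight_ge0.
Qed.

End log_coordinates.

Section polar.
Context {R : realType}.
Local Notation leb1 := (@lebesgue_measure R).
Variables (n : nat) (m a : R) (Phi : R -> R).
Hypotheses (n0 : (0 < n)%N) (m0 : 0 < m) (a0 : 0 < a).
Hypotheses (mPhi : measurable_fun setT Phi) (Phi0 : forall t, 0 <= Phi t).
Local Notation k := (n%:R / (2 * m)).

(* [gden v = e^v g(e^v)], where [g] is the integrand of [Gamma (n / 2)]. *)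
Definition gden (v : R) : R := expR (n%:R / 2 * v - expR v).

Lemma measurable_gden : measurable_fun setT gden.
Proof.
apply: continuous_measurable_fun => v.
apply: continuous_comp; last exact: continuous_expR.
apply: cvgB; last exact: continuous_expR.
by apply: cvgMl_tmp; exact: cvg_id.
Qed.

Let gden0 v : 0 <= gden v. Proof. exact: expR_ge0. Qed.

Let mexp (c : R) : measurable_fun setT (fun w : R => expR (c * w)).
Proof. by apply: (measurableT_comp (@measurable_expR R)); exact: measurable_funM. Qed.

Let lns (x : n.-tuple R) : R := ln (sqsum x).

Let mlns : measurable_fun setT lns.
Proof. by apply: (measurableT_comp (@measurable_ln R)); exact: measurable_sqsum. Qed.

(** The substitution v = b - w / m; [b] will be the logarithm of |x|^2, which ties the integral to
    the radial variable. *)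
Lemma gamma_log_scale (b : R) :
  (\int[leb1]_v (gden v)%:E = m^-1%:E * \int[leb1]_w (gden (b - w / m))%:E)%E.
Proof.
have mg : measurable_fun setT (fun v => (gden v)%:E) by apply/measurable_EFinP; exact: measurable_gden.
have mi0 : 0 < m^-1 by rewrite invr_gt0.
have p0 v : (0 <= (gden v)%:E)%E by rewrite lee_fin.
have m1 : measurable_fun setT (fun w : R => (gden (m^-1 * w))%:E).
  by apply: (measurableT_comp mg); exact: measurable_funM.
have m2 : measurable_fun setT (fun w : R => (gden (m^-1 * - w))%:E).
  by apply: (measurableT_comp m1); exact: measurable_funN.
have E1 := ge0_integral_scale mi0 mg p0.
have E2 := ge0_integral_opp m1 (fun w => p0 _).
have E3 := ge0_integral_shift (- (m * b)) m2 (fun w => p0 _).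
rewrite -E1 -E2 -E3; apply: (f_equal (fun y => (m^-1%:E * y)%E)).
apply: eq_integral => w _; congr (gden _)%:E.
by field; rewrite gt_eqF.
Qed.

(* Polar coordinates without spheres: after multiplication by [Gamma (n / 2)],
   Tonelli and the dilation [x -> e^(w/2m) x] turn the integrand into a product
   of a Gaussian in [x] and a function of the radial variable. *)
Lemma integral_sqsum_gamma :
  ((\int[leb1]_v (gden v)%:E) * (\int[leb R n]_x (Phi (sqsum x `^ m / a))%:E) =
   (m^-1 * a `^ k * Num.sqrt pi ^+ n)%:E *
     \int[leb1]_w (expR (k * w) * Phi (expR w))%:E)%E.
Proof.
(* [F1] is the integrand once the Gamma integral is written by [gamma_log_scale] with b = [lns x];
   [F2] is the result of the dilation by e^(w / 2m), whose Jacobian is e^(k w). *)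
pose F1 (x : n.-tuple R) (w : R) := gden (lns x - w / m) * Phi (expR (m * lns x) / a).
pose F2 (x : n.-tuple R) (w : R) :=
  expR (k * w) * (gden (lns x) * Phi (expR (m * lns x + w) / a)).
have F10 x w : 0 <= F1 x w by rewrite mulr_ge0.
have F20 x w : 0 <= F2 x w by rewrite !mulr_ge0// expR_ge0.
have ml1 : measurable_fun setT (fun z : n.-tuple R * measurableTypeR R => lns z.1).
  by apply: (measurableT_comp mlns); exact: measurable_fst.
have mF1 : measurable_fun setT (fun z : n.-tuple R * measurableTypeR R => (F1 z.1 z.2)%:E).
  apply/measurable_EFinP; apply: measurable_funM.
    apply: (measurableT_comp measurable_gden); apply: measurable_funB => //.
    by apply: measurable_funM => //; exact: measurable_snd.
  apply: (measurableT_comp mPhi); apply: measurable_funM => //.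
  by apply: (measurableT_comp (mexp m)).
have mF2 : measurable_fun setT (fun z : n.-tuple R * measurableTypeR R => (F2 z.1 z.2)%:E).
  apply/measurable_EFinP; apply: measurable_funM.
    by apply: (measurableT_comp (mexp k)); exact: measurable_snd.
  apply: measurable_funM; first exact: (measurableT_comp measurable_gden).
  apply: (measurableT_comp mPhi); apply: measurable_funM => //.
  apply: (measurableT_comp (@measurable_expR R)); apply: measurable_funD; last exact: measurable_snd.
  by apply: measurable_funM.
have swap F : measurable_fun setT (fun z : n.-tuple R * measurableTypeR R => (F z.1 z.2)%:E) ->
    (forall x w, 0 <= F x w) ->
    (\int[leb R n]_x \int[leb1]_w (F x w)%:E = \int[leb1]_w \int[leb R n]_x (F x w)%:E)%E.
  move=> mF F0.
  by apply: (@fubini_tonelli _ _ _ _ _ (leb R n) leb1 _ mF) => z; rewrite lee_fin.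
have pos := @sqsum_gt0_ae R n n0.
have mT : measurable_fun setT (fun x : n.-tuple R => (Phi (sqsum x `^ m / a))%:E).
  apply/measurable_EFinP; apply: (measurableT_comp mPhi); apply: measurable_funM => //.
  by apply: (measurableT_comp (measurable_powR m)); exact: measurable_sqsum.
have powE x : 0 < sqsum x -> sqsum x `^ m = expR (m * lns x).
  by move=> x0; rewrite /powR gt_eqF.
have Gam0 : (0 <= \int[leb1]_v (gden v)%:E)%E by apply: integral_ge0 => v _; rewrite lee_fin.
have mi0 : (0 <= m^-1%:E)%E by rewrite lee_fin invr_ge0 ltW.
rewrite -ge0_integralZl//; last by move=> x _; rewrite lee_fin.
transitivity (\int[leb R n]_x (m^-1%:E * \int[leb1]_w (F1 x w)%:E))%E.
  apply: ge0_ae_eq_integral => //.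
  - by apply: measurable_funeM.
  - apply: measurable_funeM.
    by apply: (@measurable_fun_fubini_tonelli_F _ _ _ _ _ leb1 _ mF1) => z; rewrite lee_fin.
  - by move=> x _; rewrite mule_ge0// lee_fin.
  - by move=> x _; rewrite mule_ge0// integral_ge0// => w _; rewrite lee_fin.
  case: pos => N [mN N0 subN]; exists N; split => // x nx; apply: subN => x0; apply: nx => _.
  rewrite (gamma_log_scale (lns x)) -muleA; congr (_ * _)%E.
  rewrite -ge0_integralZr//.
  - by apply: eq_integral => w _; rewrite -EFinM powE.
  - apply/measurable_EFinP; apply: (measurableT_comp measurable_gden); apply: measurable_funB => //.
    by apply: measurable_funM.
  - by move=> w _; rewrite lee_fin.
  - by rewrite lee_fin.
rewrite ge0_integralZl//; last 2 first.
- by apply: (@measurable_fun_fubini_tonelli_F _ _ _ _ _ leb1 _ mF1) => z; rewrite lee_fin.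
- by move=> x _; apply: integral_ge0 => w _; rewrite lee_fin.
rewrite (swap _ mF1 F10) -mulrA EFinM -muleA; congr (_ * _)%E.
have cn w : expR (w / (2 * m)) ^+ n = expR (k * w).
  by rewrite -expRM_natl; congr expR; field; rewrite gt_eqF.
have c2 w : expR (w / (2 * m)) ^+ 2 = expR (w / m).
  by rewrite -expRM_natl; congr expR; field; rewrite gt_eqF.
transitivity (\int[leb1]_w \int[leb R n]_x (F2 x w)%:E)%E.
  apply: eq_integral => w _.
  pose H (y : R) : \bar R := (gden (ln y - w / m) * Phi (expR (m * ln y) / a))%:E.
  have mH : measurable_fun setT H.
    have ml := @measurable_ln R.
    apply/measurable_EFinP; apply: measurable_funM.
      by apply: (measurableT_comp measurable_gden); exact: measurable_funB.
    apply: (measurableT_comp mPhi); apply: measurable_funM => //.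
    by apply: (measurableT_comp (mexp m)).
  have H0 y : (0 <= H y)%E by rewrite lee_fin mulr_ge0.
  rewrite [LHS](_ : _ = \int[leb R n]_x H (sqsum x))%E//.
  rewrite -(ge0_integral_sqsum_scale n (expR_gt0 (w / (2 * m))) mH H0) cn c2.
  have mHs : measurable_fun setT (fun x : n.-tuple R => H (expR (w / m) * sqsum x)).
    apply: (measurableT_comp mH); apply: measurable_funM => //; exact: measurable_sqsum.
  rewrite -ge0_integralZl//.
  apply: ge0_ae_eq_integral => //.
  - by apply: measurable_funeM.
  - exact: (measurableT_comp mF2 (pair2_measurable w)).
  - by move=> x _; rewrite mule_ge0// lee_fin expR_ge0.
  - by move=> x _; rewrite lee_fin.
  case: pos => N [mN N0 subN]; exists N; split => // x nx; apply: subN => x0; apply: nx => _.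
  rewrite /H -EFinM /F2 lnM ?posrE ?expR_gt0// expRK; congr (_ * (gden _ * Phi (expR _ / a)))%:E.
  - by rewrite /lns; ring.
  - by rewrite /lns; field; rewrite gt_eqF.
rewrite -(swap _ mF2 F20).
have mk : measurable_fun setT (fun w : R => (expR (k * w) * Phi (expR w))%:E).
  apply/measurable_EFinP; apply: measurable_funM => //.
  apply: (measurableT_comp mPhi); exact: measurable_expR.
have ki0 : (0 <= \int[leb1]_w (expR (k * w) * Phi (expR w))%:E)%E.
  by apply: integral_ge0 => w _; rewrite lee_fin mulr_ge0// expR_ge0.
(* Shifting w by ln a - m [lns x] frees [Phi] of x and produces the factor |x|^-n, which cancels the
   power of |x| in [gden (lns x)] and leaves the Gaussian. *)
transitivity (\int[leb R n]_x ((expR (- sqsum x))%:E *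
    ((a `^ k)%:E * \int[leb1]_w (expR (k * w) * Phi (expR w))%:E)))%E.
  have mg : measurable_fun setT (fun x : n.-tuple R => (expR (- sqsum x))%:E).
    apply/measurable_EFinP; apply: (measurableT_comp (@measurable_expR R)).
    by apply: measurableT_comp => //; exact: measurable_sqsum.
  apply: ge0_ae_eq_integral => //.
  - by apply: (@measurable_fun_fubini_tonelli_F _ _ _ _ _ leb1 _ mF2) => z; rewrite lee_fin.
  - by apply: emeasurable_funM.
  - by move=> x _; apply: integral_ge0 => w _; rewrite lee_fin.
  - by move=> x _; rewrite !mule_ge0// lee_fin ?expR_ge0 ?powR_ge0.
  case: pos => N [mN N0 subN]; exists N; split => // x nx; apply: subN => x0; apply: nx => _.
  have mF2x : measurable_fun setT (fun w : R => (F2 x w)%:E).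
    exact: (measurableT_comp mF2 (pair1_measurable x)).
  rewrite -(@ge0_integral_shift _ (fun w => (F2 x w)%:E) (ln a - m * lns x))//; last by move=> w; rewrite lee_fin.
  rewrite muleA -EFinM -ge0_integralZl//; last 2 first.
  - by move=> w _; rewrite lee_fin mulr_ge0// expR_ge0.
  - by rewrite lee_fin mulr_ge0// ?expR_ge0 ?powR_ge0.
  apply: eq_integral => w _; rewrite -EFinM; congr _%:E.
  rewrite /F2 /gden.
  have -> : expR (lns x) = sqsum x by rewrite /lns lnK.
  have -> : expR (m * lns x + (w + (ln a - m * lns x))) / a = expR w.
    have -> : m * lns x + (w + (ln a - m * lns x)) = w + ln a by ring.
    by rewrite expRD lnK// mulfK// gt_eqF.
  have -> : a `^ k = expR (k * ln a) by rewrite /powR gt_eqF.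
  rewrite !mulrA -!expRD; congr (expR _ * _); field.
  by rewrite gt_eqF.
rewrite ge0_integralZr//; last 2 first.
- apply/measurable_EFinP; apply: (measurableT_comp (@measurable_expR R)).
  by apply: measurableT_comp => //; exact: measurable_sqsum.
- by rewrite mule_ge0// lee_fin powR_ge0.
by rewrite integral_gauss_sqsum muleA -EFinM (mulrC (_ ^+ _)).
Qed.

End polar.

Section gamma.
Context {R : realType}.
Local Notation leb1 := (@lebesgue_measure R).

Lemma continuous_powRl (p : R) : {in `]0, +oo[, continuous (fun t : R => t `^ p)}.
Proof.
move=> t; rewrite in_itv/= andbT => t0.
apply: differentiable_continuous; apply/derivable1_diffP.
by apply: derivable_powR; rewrite in_itv/= t0.
Qed.

Lemma expR_powR_shift (s v : R) : expR v `^ (s - 1) * expR v = expR (s * v).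
Proof. by rewrite -expRM -expRD; congr expR; ring. Qed.

Lemma Gamma_funE (n : nat) : (0 < n)%N ->
  (\int[leb1]_v (gden n v)%:E = (Gamma_fun (n%:R / 2 : R))%:E)%E.
Proof.
move=> n0; have s0 : 0 < n%:R / 2 :> R by rewrite divr_gt0 ?ltr0n.
have E : (\int[leb1]_(t in `]0%R, +oo[) (t `^ (n%:R / 2 - 1) * expR (- t))%:E =
    \int[leb1]_v (gden n v)%:E)%E.
  rewrite ge0_integral_expR.
  - apply: eq_integral => v _; rewrite mulrAC expR_powR_shift -expRD//.
  - move=> t t0; apply: cvgM; first exact: continuous_powRl.
    apply: (@continuous_comp _ _ _ (fun t : R => - t) expR); last exact: continuous_expR.
    by apply: cvgN; exact: cvg_id.
  - by move=> t _; rewrite mulr_ge0 ?powR_ge0 ?expR_ge0.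
rewrite /Gamma_fun /Rintegral E fineK// ge0_fin_numE; first exact: integral_exp_moment_lty.
by apply: integral_ge0 => v _; rewrite lee_fin expR_ge0.
Qed.

Lemma Gamma_fun_gt0 (n : nat) : (0 < n)%N -> 0 < Gamma_fun (n%:R / 2 : R).
Proof.
move=> n0; rewrite -lte_fin -Gamma_funE//.
have mg : measurable_fun setT (fun v : R => (gden n v)%:E) by apply/measurable_EFinP; exact: measurable_gden.
have mI : measurable (`[0, 1]%classic : set (measurableTypeR R)) by exact: measurable_itv.
(* On [0, 1] the integrand is at least exp(-e). *)
apply: (@lt_le_trans _ _ (\int[leb1]_v ((expR (- expR 1))%:E * (\1_`[0%R, 1%R] v)%:E))%E).
  rewrite ge0_integralZl//; last by apply/measurable_EFinP; exact: measurable_indic.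
  rewrite integral_indic// setIT.
  have L1 : leb1 (`[0, 1]%classic : set R) = 1%E.
    by rewrite lebesgue_measure_itv/= lte_fin ltr01 oppr0 adde0.
  by rewrite [X in (_ * X)%E]L1 mule1 lte_fin expR_gt0.
apply: ge0_le_integral => //.
- by apply: measurable_funeM; apply/measurable_EFinP; exact: measurable_indic.
move=> v _; rewrite -EFinM lee_fin indicE; case: (boolP (_ \in _)) => [|_]; last first.
  by rewrite mulr0 expR_ge0.
rewrite inE/= in_itv/= => /andP[v0 v1]; rewrite mulr1 ler_expR.
have : expR v <= expR 1 by rewrite ler_expR.
have : 0 <= n%:R / 2 * v by rewrite mulr_ge0// divr_ge0.
lra.
Qed.

End gamma.

(** * The constant of the bound *)

Section constant.
Context {R : realType}.
Local Notation leb1 := (@lebesgue_measure R).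

Lemma powR_oppr_half (x : R) n : 0 <= x -> x `^ (- (n%:R / 2)) = Num.sqrt x ^- n.
Proof.
move=> x0; rewrite (_ : - _ = 2^-1 * - n%:R); last by ring.
by rewrite powRrM powR12_sqrt// powR_invn// sqrtr_ge0.
Qed.

(** The (2 pi)^-n of the Hilbert-Schmidt bound meets the pi^(n/2) of the Gaussian integral: this is
    where the (4 pi)^(-n/2) of the constant comes from. *)
Lemma fnorm_sqrt_pi n : fnorm n ^+ 2 * Num.sqrt pi ^+ n = (4 * pi) `^ (- (n%:R / 2)) :> R.
Proof.
have p0 : 0 < pi :> R := pi_gt0 R.
have p2 : 0 <= 2 * pi :> R by rewrite mulr_ge0// ltW.
have p4 : 0 <= 4 * pi :> R by rewrite mulr_ge0// ltW.
rewrite /fnorm !powR_oppr_half// exprVn -!exprM mulnC exprM sqr_sqrtr//.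
have -> : Num.sqrt (4 * pi) = 2 * Num.sqrt pi :> R.
  rewrite sqrtrM//; congr (_ * _); rewrite (_ : 4 = 2 ^+ 2); last by ring.
  by rewrite sqrtr_sqr ger0_norm.
rewrite -!exprVn -exprMn; congr (_ ^+ _).
have s0 : Num.sqrt pi != 0 :> R by rewrite gt_eqF// sqrtr_gt0.
rewrite -{1}(@sqr_sqrtr _ pi) ?ltW//.
by move: (Num.sqrt pi) s0 => s s0; field.
Qed.

Variables (n : nat) (m alpha theta : R) (z : R[i]).
Hypotheses (n0 : (0 < n)%N) (m0 : 0 < m) (zh : ~ halfline z) (zt : is_arg z theta).
Local Notation k := (n%:R / (2 * m)).
Let a := cabs z.
Let D (t : R) := t ^+ 2 - 2 * t * cos theta + 1.

Let a_gt0 : 0 < a.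
Proof. by apply: cabs_gt0; apply/eqP => h; apply: zh; rewrite h /halfline/=. Qed.

(** The law of cosines; [D] is the quadratic polynomial in the integrand of [I_m]. *)
Lemma cabs_sub_polar t : cabs ((a * t)%:C - z) ^+ 2 = a ^+ 2 * D t.
Proof.
case: zt => _ _ zE; rewrite cabs_sqr ReD ImD ReN ImN [in complex.Re z]zE [in complex.Im z]zE.
rewrite RecM ImcM /expi/= -/a /D.
have := cos2Dsin2 theta; move: (cos theta) (sin theta) => c s h.
transitivity (a ^+ 2 * (t ^+ 2 - 2 * t * c + (c ^+ 2 + s ^+ 2))); first by ring.
by rewrite h.
Qed.

Let D_gt0 t : 0 <= t -> 0 < D t.
Proof.
move=> t0; have : 0 < cabs ((a * t)%:C - z) ^+ 2.
  have [del d0 hd] := dist_halfline zh.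
  by apply/exprn_gt0/(lt_le_trans d0); apply: hd; rewrite mulr_ge0// ltW.
by rewrite cabs_sub_polar pmulr_rgt0// exprn_gt0.
Qed.

Lemma cabs_rsymb_powR (x : n.-tuple R) :
  cabs (rsymb m z x) `^ alpha = a `^ (- alpha) / D (sqsum x `^ m / a) `^ (alpha / 2).
Proof.
have aa : 0 <= a by exact: ltW.
have t0 : 0 <= sqsum x `^ m / a by rewrite divr_ge0 ?powR_ge0.
have d0 := D_gt0 t0.
have sE : symb m x = a * (sqsum x `^ m / a).
  rewrite mulrC divfK ?gt_eqF// /symb powRrM; congr (_ `^ _).
  by rewrite powR_mulrn ?sqrtr_ge0// sqr_sqrtr// sqsum_ge0.
have cE : cabs (rsymb m z x) = (a * Num.sqrt (D (sqsum x `^ m / a)))^-1.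
  rewrite /rsymb cabsV; congr (_^-1).
  apply/eqP; rewrite -(eqrXn2 (n := 2))// ?cabs_ge0 ?mulr_ge0 ?sqrtr_ge0//.
  by rewrite exprMn sqr_sqrtr ?(ltW d0)// sE cabs_sub_polar.
have s0 : 0 <= Num.sqrt (D (sqsum x `^ m / a)) by exact: sqrtr_ge0.
rewrite cE -(powR_inv1 (mulr_ge0 aa s0)) -powRrM mulN1r powRM//.
congr (_ * _); rewrite -powR12_sqrt ?(ltW d0)// -powRrM -powRN; congr (_ `^ _).
by field.
Qed.

(** In the variable t = |xi|^(2m) / a the symbol has modulus a^-1 D(t)^(-1/2). The power a^(k -
    alpha) collects a^k from the radial formula and a^-alpha from the symbol; it is a^-gamma when
    alpha = gamma + k. *)
Lemma integral_rsymb :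
  ((fnorm n ^+ 2)%:E * \int[leb R n]_x (cabs (rsymb m z x) `^ alpha)%:E =
   (a `^ (k - alpha))%:E * C_const n m alpha theta)%E.
Proof.
pose G := Gamma_fun (n%:R / 2 : R).
have G0 : 0 < G by exact: Gamma_fun_gt0.
pose Phi (t : R) := a `^ (- alpha) / D t `^ (alpha / 2).
have Phi0 t : 0 <= Phi t by rewrite divr_ge0 ?powR_ge0.
have mPhi : measurable_fun setT Phi.
  apply: measurable_funM => //.
  rewrite (_ : (fun t => _) = (fun t => D t `^ (- (alpha / 2)))); last first.
    by apply/funext => t; rewrite powRN.
  apply: (measurableT_comp (measurable_powR _)); apply: continuous_measurable_fun => t.
  apply: cvgD; last exact: cvg_cst.
  apply: cvgB; first by apply: exprn_continuous.
  by apply: cvgMr_tmp; apply: cvgMl_tmp; exact: cvg_id.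
have I0 : (0 <= I_m m n alpha theta)%E.
  by apply: integral_ge0 => t _; rewrite lee_fin divr_ge0 ?powR_ge0.
have cD : continuous D.
  move=> t; apply: cvgD; last exact: cvg_cst.
  apply: cvgB; first by apply: exprn_continuous.
  by apply: cvgMr_tmp; apply: cvgMl_tmp; exact: cvg_id.
have IE : (\int[leb1]_w (expR (k * w) * Phi (expR w))%:E =
    (a `^ (- alpha))%:E * I_m m n alpha theta)%E.
  have -> : I_m m n alpha theta =
      (\int[leb1]_w (expR (k * w) / D (expR w) `^ (alpha / 2))%:E)%E.
    rewrite /I_m ge0_integral_expR.
    - by apply: eq_integral => w _; rewrite mulrAC expR_powR_shift.
    - move=> t t0; have t1 : 0 < t by move: t0; rewrite in_itv/= andbT.
      apply: cvgM; first exact: continuous_powRl.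
      apply: cvgV; first by rewrite gt_eqF// powR_gt0// D_gt0// ltW.
      apply: (@continuous_comp _ _ _ D (fun t : R => t `^ (alpha / 2))); first exact: cD.
      by apply: continuous_powRl; rewrite in_itv/= D_gt0// ltW.
    - by move=> t _; rewrite divr_ge0 ?powR_ge0.
  rewrite -ge0_integralZl//.
  - by apply: eq_integral => w _; rewrite -EFinM /Phi; congr _%:E; ring.
  - apply/measurable_EFinP; apply: continuous_measurable_fun => w.
    apply: cvgM; first by apply: continuous_comp; [apply: cvgMl_tmp; exact: cvg_id|exact: continuous_expR].
    apply: cvgV; first by rewrite gt_eqF// powR_gt0// D_gt0// expR_ge0.
    apply: (@continuous_comp _ _ _ (D \o expR) (fun t : R => t `^ (alpha / 2))).
      by apply: continuous_comp; [exact: continuous_expR|exact: cD].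
    by apply: continuous_powRl; rewrite in_itv/= D_gt0// expR_ge0.
  - by move=> w _; rewrite lee_fin divr_ge0 ?expR_ge0 ?powR_ge0.
  - by rewrite lee_fin powR_ge0.
have key := integral_sqsum_gamma n0 m0 a_gt0 mPhi Phi0.
rewrite Gamma_funE// -/G IE in key.
have {key} -> : (\int[leb R n]_x (cabs (rsymb m z x) `^ alpha)%:E =
    (G^-1)%:E * ((m^-1 * a `^ k * Num.sqrt pi ^+ n)%:E *
      ((a `^ (- alpha))%:E * I_m m n alpha theta)))%E.
  rewrite -key muleA -EFinM mulVf ?gt_eqF// mul1e.
  by apply: eq_integral => x _; rewrite cabs_rsymb_powR.
rewrite /C_const -/G !muleA -!EFinM; congr (_%:E * _)%E.
rewrite powRD; last by rewrite (gt_eqF a_gt0) implybT.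
rewrite -fnorm_sqrt_pi (invfM m G).
move: (a `^ k) (a `^ _) (fnorm n) (Num.sqrt _ ^+ n) => c1 c2 f p; ring.
Qed.

End constant.

(** * The eigenvalue bound *)

Theorem corollary5p2 (R : realType) (n : nat) (m gamma : R)
    (q : n.-tuple R -> R[i]) (Q : R[i] -> operator R n) (H : operator R n)
    (lambda : R[i]) (theta : R) :
  (1 <= n)%N -> 0 < m ->
  (2 * m <= n%:R -> 0 < gamma) ->
  (n%:R < 2 * m -> 1 - n%:R / (2 * m) <= gamma) ->
  in_Lp (gamma + n%:R / (2 * m)) q ->
  standing_assumptions m q ->
  is_Q m q Q ->
  is_Hmq m q Q H ->
  ~ halfline lambda -> eigenvalue_of H lambda -> is_arg lambda theta ->
  ((cabs lambda `^ gamma)%:E <=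
    C_const n m (gamma + n%:R / (2 * m)) theta *
    \int[lebesgue_tuple R n]_x (cabs (q x) `^ (gamma + n%:R / (2 * m)))%:E)%E.
Proof.
move=> n0 m0 gam1 gam2 [mq _] _ hQ hH zh eigH zt.
have a0 : 0 < cabs lambda.
  by apply: cabs_gt0; apply/eqP => h; apply: zh; rewrite h /halfline/=.
set alpha := gamma + _.
(* For n >= 2m already n / (2m) >= 1 and gamma > 0; for n < 2m the lower bound on gamma says exactly
   this. *)
have alpha1 : 1 <= alpha.
  rewrite /alpha; have [nm|nm] := leP (2 * m) n%:R; last first.
    by have := gam2 nm; rewrite lerBlDr.
  apply: (@le_trans _ _ (n%:R / (2 * m))); last by rewrite lerDr ltW// gam1.
  by rewrite ler_pdivlMr ?mul1r// mulr_gt0.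
rewrite integral_lebE leNgt; apply/negP.
set J := (\int[_]_x _)%E => small.
have J0 : (0 <= J)%E by apply: integral_ge0 => x _; rewrite lee_fin powR_ge0.
set X := (\int[leb R n]_xi (cabs (rsymb m lambda xi) `^ alpha)%:E)%E.
have X0 : (0 <= X)%E by apply: integral_ge0 => x _; rewrite lee_fin powR_ge0.
(* [V] bounds the power [alpha] of the norm of [Q lambda]; by [integral_rsymb] the negated
   inequality says that it is less than 1. *)
pose V := ((fnorm n ^+ 2)%:E * (J * X))%E.
have V0 : (0 <= V)%E by rewrite !mule_ge0// lee_fin sqr_ge0.
have V1 : (V < 1)%E.
  have -> : V = ((cabs lambda `^ (- gamma))%:E * (C_const n m alpha theta * J))%E.
    rewrite /V muleCA (integral_rsymb alpha n0 m0 zh zt) muleCA (muleC J); congr (_%:E * _)%E.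
    by congr (_ `^ _); rewrite /alpha; ring.
  apply: (@lt_le_trans _ _ ((cabs lambda `^ (- gamma))%:E * (cabs lambda `^ gamma)%:E)%E).
    by rewrite lte_pmul2l// lte_fin powR_gt0.
  by rewrite -EFinM powRN mulVf// gt_eqF// powR_gt0.
(* [V] vanishes for q = 0, whereas [kappa] has to be positive; 1/2 could be any number strictly
   between 0 and 1. *)
pose kappa : R := Num.max (fine V) 2^-1.
have kappa0 : 0 < kappa by rewrite lt_max invr_gt0 ltr0n orbT.
have fV : V \is a fin_num by rewrite ge0_fin_numE// (lt_le_trans V1)// leey.
have kappa1 : kappa < 1.
  by rewrite gt_max -lte_fin fineK// V1/= invf_lt1 ?ltr0n// ltr1n.
have Vk : (V <= kappa%:E)%E by rewrite -(fineK fV) lee_fin le_max lexx.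
(* [lambda] lies off the half-line, which is the essential spectrum of [H0], that is, the set where
   Fredholmness fails. *)
have fred : fredholm (op_shift (@H0 R n m) lambda).
  have [_ ess] := Hmq_ess hH; apply: contrapT => nf; apply: zh.
  by rewrite -ess.
apply: (no_eigenvalue m0 zh mq alpha1 kappa0 Vk fred kappa1 (hQ _ zh)).
exact: (Hmq_eigen hH zh).1.
Qed.
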